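(* Let $G$ be a connected graph on $[n]$ without cut vertices which is closed with respect to its labeling, and let $\mu(G)=(\mu_1,\ldots,\mu_n)$ with $\mu_j=n-j-\deg^>_G(j)$. Let $s:=\min\{k-1:\mu_k=0\}$. Then $\operatorname{reg}(J_G)=3$ if and only if $s\ge1$ and $\mu_1=\cdots=\mu_s=:\mu\ge1$. In that case, $$\beta_p(J_G)=\beta_{p,p+3}(J_G)=\beta_p(\operatorname{in}(J_G))=\beta_{p,p+3}(\operatorname{in}(J_G))=s\mu,$$ where $p=\operatorname{pd}(J_G)=\operatorname{pd}(\operatorname{in}(J_G))=2n-\mu-s-3$.
   Context: $G$ is closed with respect to its labeling if whenever $\{i,j\},\{i,k\}\in E(G)$ with either $i<j$, $i<k$ or $i>j$, $i>k$, then $\{j,k\}\in E(G)$. $\deg^>_G(j)=|\{l>j:\{j,l\}\in E(G)\}|$. The binomial edge ideal $J_G\subseteq S=k[x_1,\ldots,x_n,y_1,\ldots,y_n]$ ($k$ a field) is generated by $x_iy_j-x_jy_i$ for $\{i,j\}\in E(G)$, $i<j$; $\operatorname{in}(J_G)$ is its initial ideal for the lexicographic order with $x_1>\cdots>x_n>y_1>\cdots>y_n$. $\beta_{i,j}(I)=\dim_k\operatorname{Tor}^S_{i+1}(S/I;k)_j$, $\beta_i=\sum_j\beta_{i,j}$; $\operatorname{pd}$, $\operatorname{reg}$ are projective dimension and regularity. *)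

(* Defs.v *)
(* Graded Betti numbers via Koszul homology, computed degree-wise
   by finite-dimensional linear algebra (mxalgebra). *)
From mathcomp Require Import all_boot all_order all_algebra.
Set Implicit Arguments. Unset Strict Implicit. Unset Printing Implicit Defensive.
Import GRing.Theory.
Local Open Scope ring_scope.

(* ---------- Graphs on [n] = 'I_n (vertex v stands for the label v+1) ---------- *)

Definition connected_graph n (e : rel 'I_n) : Prop :=
  forall u v : 'I_n, connect e u v.

Definition del_vertex n (e : rel 'I_n) (v : 'I_n) : rel 'I_n :=
  [rel a b | [&& e a b, a != v & b != v]].

Definition no_cut_vertex n (e : rel 'I_n) : Prop :=
  forall v a b : 'I_n, a != v -> b != v -> connect (del_vertex e v) a b.

Definition closed_graph n (e : rel 'I_n) : Prop :=
  forall i j l : 'I_n, j != l -> e i j -> e i l ->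
    ((i < j)%N && (i < l)%N) || ((j < i)%N && (l < i)%N) -> e j l.

Definition deg_gt n (e : rel 'I_n) (v : 'I_n) : nat :=
  #|[set l : 'I_n | (v < l)%N && e v l]|.

(* mu_j = n - j - deg^>(j), for the vertex v with label j = v+1 *)
Definition mu_seq n (e : rel 'I_n) (v : 'I_n) : nat := (n - v.+1 - deg_gt e v)%N.

(* s = min{k-1 : mu_k = 0}  (= min{ v : mu(v) = 0 } in 0-based labels) *)
Definition s_index n (e : rel 'I_n) : nat :=
  find (fun v : 'I_n => mu_seq e v == 0%N) (enum 'I_n).

(* monomials of degree d in N variables (exponent vectors) *)
Notation mono N d :=
  {a : {ffun 'I_N -> 'I_d.+1} | (\sum_(u < N) (a u : nat))%N == d}.

Definition ev N d (m : mono N d) (u : 'I_N) : nat := nat_of_ord (val m u).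

(* lexicographic order with z_0 > z_1 > ... : m <lex m' *)
Definition lexlt N d (m m' : mono N d) : bool :=
  [exists u : 'I_N, (ev m u < ev m' u)%N &&
     [forall w : 'I_N, (w < u)%N ==> (ev m w == ev m' w)]].

(* basis e_F (x) z^a with |F| + deg a = j ; homological degree |F| *)
Notation KB N j :=
  {p : {set 'I_N} * {ffun 'I_N -> 'I_j.+1} |
     (#|p.1| + \sum_(u < N) (p.2 u : nat))%N == j}.

Definition mne N d (c : 'I_#|{: mono N d}|) : mono N d := enum_val c.
Definition kbe N j (c : 'I_#|{: KB N j}|) : KB N j := enum_val c.

Section Graded.
Variable k : fieldType.

(* A graded subspace family: in each degree d a subspace of S_d, given as the
   row space of a square matrix (rows = coefficient vectors on the monomial basis). *)
Definition gfam (N : nat) := forall d : nat, 'M[k]_(#|{: mono N d}|).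

(* span of the monomials <= m (resp. < m) in lex order *)
Definition mono_le_mx N d (m : mono N d) : 'M[k]_(#|{: mono N d}|) :=
  \matrix_(r, c) ((r == c) && ((mne c == m) || lexlt (mne c) m))%:R.
Definition mono_lt_mx N d (m : mono N d) : 'M[k]_(#|{: mono N d}|) :=
  \matrix_(r, c) ((r == c) && lexlt (mne c) m)%:R.

(* m is the leading (lex-largest) monomial of some element of I_d *)
Definition is_lead_mono N (I : gfam N) d (m : mono N d) : bool :=
  (\rank (I d :&: mono_lt_mx m)%MS < \rank (I d :&: mono_le_mx m)%MS)%N.

Definition initial N (I : gfam N) : gfam N :=
  fun d => \matrix_(r, c) ((r == c) && is_lead_mono I (mne c))%:R.

(* coefficient of basis element q in d(basis element p) *)
Definition kcoef N j (p q : KB N j) : k :=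
  \sum_(v in (val p).1 |
      ((val q).1 == (val p).1 :\ v) &&
      [forall u, nat_of_ord ((val q).2 u) == (nat_of_ord ((val p).2 u) + (u == v))%N])
    (-1) ^+ #|[set u in (val p).1 | (u < v)%N]|.

Definition kdiff N j : 'M[k]_(#|{: KB N j}|) :=
  \matrix_(r, c) kcoef (kbe r) (kbe c).

(* the subspace of homological degree i *)
Definition kdeg N j (i : nat) : 'M[k]_(#|{: KB N j}|) :=
  \matrix_(r, c) ((r == c) && (#|(val (kbe c)).1| == i))%:R.

(* embedding S_(j-|F|) -> K_j, f |-> e_F (x) f *)
Definition kemb N j (F : {set 'I_N}) : 'M[k]_(#|{: mono N (j - #|F|)}|, #|{: KB N j}|) :=
  \matrix_(r, c) (((val (kbe c)).1 == F) &&
     [forall u, nat_of_ord ((val (kbe c)).2 u) == ev (mne r) u])%:R.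

(* the subcomplex K(z; I) inside K(z; S) *)
Definition ksub N (I : gfam N) j : 'M[k]_(#|{: KB N j}|) :=
  (\sum_(F : {set 'I_N}) <<I (j - #|F|)%N *m kemb j F>>)%MS.

(* dim_k H_i(K(z; S/I))_j, computed as dim Z - dim B in K(z;S) with
   Z = {w in K_i : d w in K(z;I)},  B = d(K_(i+1)) + K(z;I)_i *)
Definition koszul_hom N (I : gfam N) (i j : nat) : nat :=
  let D := ksub I j in
  let Z := (kdeg N j i :&: kermx (kdiff N j *m cokermx D))%MS in
  let B := (kdeg N j i.+1 *m kdiff N j + (D :&: kdeg N j i))%MS in
  (\rank Z - \rank B)%N.

(* beta_{i,j}(I) = dim_k Tor_(i+1)^S(S/I; k)_j = dim_k H_(i+1)(K(z; S/I))_j *)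
Definition betti N (I : gfam N) (i j : nat) : nat := koszul_hom I i.+1 j.

Definition is_pd N (I : gfam N) (p : nat) : Prop :=
  (exists j, betti I p j <> 0%N) /\ (forall i j, (p < i)%N -> betti I i j = 0%N).

Definition is_reg N (I : gfam N) (r : nat) : Prop :=
  (exists i, betti I i (i + r) <> 0%N) /\
  (forall i j, betti I i j <> 0%N -> (j <= i + r)%N).

Definition xv n (i : 'I_n) : 'I_(n + n) := lshift n i.
Definition yv n (i : 'I_n) : 'I_(n + n) := rshift n i.

(* rows: z^b (x_i y_j - x_j y_i) of degree d, indexed by m0 = z^b x_i y_j and (i,j) *)
Definition JG_rows n (e : rel 'I_n) d :
  'M[k]_(#|{: mono (n + n) d * 'I_n * 'I_n}|, #|{: mono (n + n) d}|) :=
  \matrix_(r, c)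
    let: (m0, i, j) := enum_val r in
    let m := mne c in
    if [&& e i j, (i < j)%N, (0 < ev m0 (xv i))%N & (0 < ev m0 (yv j))%N] then
      (m == m0)%:R -
      ([forall u, ev m u == (ev m0 u - ((u == xv i) + (u == yv j)) +
                               ((u == xv j) + (u == yv i)))%N])%:R
    else 0.

Definition JG n (e : rel 'I_n) : gfam (n + n) := fun d => <<JG_rows e d>>%MS.

End Graded.

(* Main.v *)
Require Import Defs.
From mathcomp Require Import all_boot all_order all_algebra.
From mathcomp Require Import zify ring.

(** A connected closed graph is a proper interval graph: the edges [i < u] are those with
    [u <= i + deg^> i], and [mu] is nonincreasing.  The monomials without a factor [x_i y_u],
    [i < u] an edge, form a basis of [S/J_G] as well as of [S/in(J_G)], so both Koszul complexes
    have the same cells up to terms of lower degree for a suitable weight.  Any acyclic matching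
    of the squarefree monomial complex therefore bounds the homology of both: the Betti numbers
    are at most the numbers of unmatched cells, with equality in a homological degree whose two
    neighbours (in the same internal degree) have no unmatched cell.

    When [mu] is constant on the first [s] vertices, [G] is the union of two overlapping cliques.
    In a squarefree degree only the last [x_p] with [p < s] and the last [x_q] with [q >= s]
    matter, and the unmatched cells have at most two variables outside the wedge.  Those with two
    in the top degree are counted by the pairs [(p, q)], which gives [s * mu].  For complete
    graphs ([s = 0]) there is at most one such variable, so the regularity is below 3.

    If [mu] takes two different nonzero values, [G] contains an induced path [a, b = a+1, c, d = c+1].
    An explicit cycle with an explicit linear form vanishing on boundaries and on [J_G] shows that
    [beta_{2,6}(J_G)] is nonzero, so the regularity is at least 4.  *)

Set Implicit Arguments. Unset Strict Implicit. Unset Printing Implicit Defensive.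
Import GRing.Theory.
Local Open Scope ring_scope.

(** * Dimension counts for a matching of the cells *)

(** A cell is a wedge over a set [F] of variables times a monomial. In a squarefree degree [W] the
    monomial has support [A = W :\: F], and the internal degree is [#|F| + #|A|]. As [betti] at [i]
    is Koszul homology at [i.+1], the cells with [#|A| = 2] are those bearing on [beta_{i,i+3}];
    this is the origin of regularity 3. The obstacle: modulo [J_G] the differential of a standard
    cell has to be rewritten in standard cells, which might destroy the pivots of a matching made
    for monomials. Giving [x_i] the weight [n - i] prevents this: the differential preserves the
    weight of the multidegree, whereas replacing [x_i y_u] by [x_u y_i] lowers it by [u - i]. Both
    ideals are then treated at once, with generators [x_i y_u - eps x_u y_i] and [eps] idempotent.
    For constant [mu], [R = n - 1 - mu] is the 0-based last neighbour of every vertex before [s].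
    Unmatched cells with [#|A| = 2] have degree at most [R + n + 1 - s], with one cell in that
    degree for each [p < s] and [R <= q < n - 1]; this range of [q] has [mu] elements. The
    projective dimension is the top degree minus 3. *)

Section Mask.
Variables (k : fieldType) (M : nat).
Implicit Types (P Q : pred 'I_M).

Definition mask P : 'M[k]_M := \matrix_(r, c) ((r == c) && P c)%:R.

Lemma mul_maskE m (w : 'M[k]_(m, M)) P i c : (w *m mask P) i c = if P c then w i c else 0.
Proof.
rewrite mxE (bigD1 c) //= big1 ?addr0 => [|u nuc]; rewrite mxE.
  by rewrite eqxx /=; case: (P c); rewrite ?mulr1 ?mulr0.
by rewrite (negbTE nuc) mulr0.
Qed.

Lemma sub_maskP (w : 'rV[k]_M) P :
  reflect (forall c, ~~ P c -> w 0 c = 0) (w <= mask P)%MS.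
Proof.
apply: (iffP idP) => [/submxP[u ->] c nPc|w0].
  by rewrite mul_maskE (negbTE nPc).
apply/submxP; exists w; apply/rowP => c; rewrite mul_maskE.
by case: ifPn => // /w0.
Qed.

Lemma row_mask P c : row c (mask P) = (P c)%:R *: delta_mx 0 c.
Proof.
by apply/rowP => u; rewrite !mxE eqxx /= eq_sym; case: eqP => [->|] /=; rewrite ?mulr1 ?mulr0.
Qed.

Lemma delta_mask P c : P c -> ((delta_mx 0 c : 'rV[k]_M) <= mask P)%MS.
Proof.
move=> Pc; apply/sub_maskP => u nPu; rewrite mxE eqxx /=.
by case: eqP => // uc; rewrite uc Pc in nPu.
Qed.

Lemma mask_sub P m (A : 'M[k]_(m, M)) :
  (forall c, P c -> ((delta_mx 0 c : 'rV[k]_M) <= A)%MS) -> (mask P <= A)%MS.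
Proof.
move=> h; apply/row_subP => c; rewrite row_mask.
by case Pc: (P c); rewrite ?scale0r ?sub0mx // scale1r h.
Qed.

Lemma mask_mono P Q : subpred P Q -> (mask P <= mask Q)%MS.
Proof. by move=> PQ; apply: mask_sub => c /PQ; apply: delta_mask. Qed.

(** A sum of rank-one matrices gives the upper bound; the bounds for [P] and its complement add up
    to the rank of the identity, so both are sharp. *)
Lemma rank_mask P : \rank (mask P) = #|P|.
Proof.
have le Q : (\rank (mask Q) <= #|Q|)%N.
  have -> : mask Q = \sum_(c in Q) delta_mx c c.
    apply/matrixP => i j; rewrite summxE !mxE.
    case: (boolP (Q j)) => Qj.
      rewrite (bigD1 j) //= big1 ?addr0 ?mxE ?eqxx ?andbT // => u /andP[_ uj].
      by rewrite mxE [j == u]eq_sym (negbTE uj) andbF.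
    rewrite andbF big1 // => u Qu; rewrite mxE; case: (j =P u) => [ju|]; last by rewrite andbF.
    by rewrite ju (Qu : Q u) in Qj.
  rewrite -sum1_card; elim/big_rec2: _ => [|c m A _ hA]; first by rewrite mxrank0.
  by apply: leq_trans (mxrank_add _ _) _; rewrite mxrank_delta leq_add2l.
apply/eqP; rewrite eqn_leq le /=.
have : (\rank (mask P + mask (predC P))%R <= \rank (mask P) + \rank (mask (predC P)))%N.
  exact: mxrank_add.
have -> : mask P + mask (predC P) = 1%:M.
  by apply/matrixP => i j; rewrite !mxE /=; case: (i == j); case: (P j); rewrite /= ?addr0 ?add0r.
rewrite mxrank1 => h; move: (leq_trans h (leq_add (leqnn _) (le (predC P)))).
by rewrite -{1}(etrans (cardC P) (card_ord M)) leq_add2r.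
Qed.

End Mask.

(** * Homology of a quotient complex and acyclic matchings *)

Section Morse.
Variables (k : fieldType) (M : nat) (hd : 'I_M -> nat) (d D : 'M[k]_M).

Definition hmask i : 'M[k]_M := mask k (fun c => hd c == i).
Definition cycles i := (hmask i :&: kermx (d *m cokermx D))%MS.
Definition bounds i := (hmask i.+1 *m d + (D :&: hmask i))%MS.
(** For the Koszul differential and [D] the Koszul subcomplex of the ideal, this is convertible to
    [koszul_hom]. *)
Definition homdim i := (\rank (cycles i) - \rank (bounds i))%N.
Definition drank i := \rank (hmask i *m d *m cokermx D).

Hypothesis d_deg : forall r c, d r c != 0 -> hd r = (hd c).+1.

Lemma hmask_d i : (hmask i.+1 *m d <= hmask i)%MS.
Proof.
apply/row_subP => r; apply/sub_maskP => c nc.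
rewrite row_mul row_mask -scalemxAl -rowE !mxE.
case: eqP => [hr|]; last by rewrite mul0r.
rewrite mul1r; apply: contraNeq nc => /d_deg; rewrite hr => -[->]; exact: eqxx.
Qed.

Lemma rank_cycles i : (\rank (cycles i) + drank i)%N = \rank (hmask i).
Proof. by rewrite /drank -mulmxA addnC mxrank_mul_ker. Qed.

Lemma sub_coker m (w : 'M[k]_(m, M)) : (w <= kermx (d *m cokermx D))%MS = (w *m d <= D)%MS.
Proof. by rewrite sub_kermx mulmxA submxE. Qed.

(** [drank] is the rank of the differential induced on the quotient by [D]. Together with
    [rank_cycles] this makes the homology dimension the dimension of the quotient in degree [i]
    minus [drank i] and [drank i.+1]. *)
Lemma rank_bounds i :
  \rank (bounds i) = (drank i.+1 + \rank (D :&: hmask i))%N.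
Proof.
set X := hmask i.+1 *m d.
have e1 : (\rank (X *m cokermx D) + \rank (X :&: D))%N = \rank X.
  rewrite -(mxrank_mul_ker X (cokermx D)); congr (_ + _)%N.
  apply/eqP; rewrite eqn_leq !mxrankS // sub_capmx capmxSl /=.
    by rewrite submxE -sub_kermx capmxSr.
  by rewrite sub_kermx -submxE capmxSr.
have := mxrank_sum_cap X (D :&: hmask i)%MS.
have -> : \rank (X :&: (D :&: hmask i)) = \rank (X :&: D).
  apply/eqP; rewrite eqn_leq !mxrankS // !sub_capmx capmxSl /=.
    by rewrite capmxSr (submx_trans (capmxSl _ _) (hmask_d _)).
  by rewrite (submx_trans (capmxSr _ _)) // capmxSl.
by rewrite /bounds /drank -/X; lia.
Qed.

Hypothesis d_sq : d *m d = 0.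
Hypothesis D_sub : (D *m d <= D)%MS.

Lemma bounds_cycles i : (bounds i <= cycles i)%MS.
Proof.
rewrite addsmx_sub !sub_capmx hmask_d capmxSr !sub_coker -mulmxA d_sq mulmx0 sub0mx /=.
exact: submx_trans (submxMr _ (capmxSl _ _)) D_sub.
Qed.

(** A linear form that kills [D] and the image of [d] descends to homology, so a cycle on which it
    is nonzero cannot be a boundary. *)
Lemma homdim_neq0 i (w phi : 'rV[k]_M) :
  (w <= cycles i)%MS -> d *m phi^T = 0 -> D *m phi^T = 0 -> w *m phi^T != 0 ->
  homdim i != 0%N.
Proof.
move=> wZ dphi Dphi nz; rewrite subn_eq0 -ltnNge; apply: rank_ltmx.
rewrite /ltmx bounds_cycles /=; apply: contraNN nz => ZB.
have /submx_trans/(_ ZB) := wZ; case/sub_addsmxP => -[u v] /= ->.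
rewrite mulmxDl -!mulmxA dphi !mulmx0 add0r.
have : (v *m (D :&: hmask i)%MS <= D)%MS by rewrite (submx_trans (submxMl _ _)) ?capmxSl.
by rewrite mulmxA; case/submxP => t ->; rewrite -mulmxA Dphi mulmx0.
Qed.

Variables (fw mw : 'I_M -> nat) (std src : pred 'I_M) (p : 'I_M -> 'I_M).

Hypothesis reduce : forall c, ~~ std c -> exists2 c', (hd c' = hd c /\ fw c' < fw c)%N &
  exists a : k, (((delta_mx 0 c - a *: delta_mx 0 c')%R : 'rV[k]_M) <= D)%MS.
Hypothesis lead : forall (f : 'rV[k]_M) c, (f <= D)%MS -> std c -> f 0 c != 0 ->
  exists2 c', f 0 c' != 0 & (fw c < fw c')%N.

Definition stdi i := #|[pred c | std c && (hd c == i)]|.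
Definition srci i := #|[pred c | src c && (hd c == i)]|.

(** The standard cells are a basis modulo [D]: descent on the weight with [reduce] shows that they
    span, and [lead], applied at a term of maximal weight, excludes a nonzero combination of them
    inside [D]. *)
Lemma rank_std i : (\rank (D :&: hmask i) + stdi i)%N = \rank (hmask i).
Proof.
set St := mask k [pred c | std c && (hd c == i)].
have dS : (D :&: hmask i :&: St <= (0 : 'M_M))%MS.
  apply/row_subP => r; set f := row r _.
  have fS : (f <= D :&: hmask i :&: St)%MS by exact: row_sub.
  move: fS; rewrite !sub_capmx => /andP[/andP[fD _] /sub_maskP fSt].
  rewrite submx0; apply/eqP/rowP => c0; rewrite [RHS]mxE; apply/eqP; apply: contraT => nz.
  have [c fc cmax] := @arg_maxnP _ c0 (fun c => f 0 c != 0) fw nz.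
  have /= sc : [pred c | std c && (hd c == i)] c.
    by apply: contraT => /fSt f0; rewrite f0 eqxx in fc.
  case/andP: sc => sc _; have [c' fc' lt] := lead fD sc fc.
  by move: (cmax c' fc') lt; rewrite /= leqNgt => /negbTE ->.
have gen : (hmask i <= D :&: hmask i + St)%MS.
  apply: mask_sub => c; elim: {c}_.+1 {-2}c (ltnSn (fw c)) => // m IH c; rewrite ltnS => cm hc.
  case sc: (std c).
    by apply: submx_trans (addsmxSr _ _); apply: delta_mask; rewrite /= sc.
  have [|c' [h' w'] [a ha]] := reduce (c := c); first by rewrite sc.
  rewrite -[delta_mx 0 c](subrK (a *: delta_mx 0 c')) addmx_sub //.
    apply: submx_trans (addsmxSl _ _); rewrite sub_capmx ha /=.
    by rewrite addmx_sub ?eqmx_opp ?scalemx_sub ?delta_mask // h'.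
  by rewrite scalemx_sub // IH ?h' // (leq_trans w').
have := mxrank_sum_cap (D :&: hmask i)%MS St.
have -> : \rank (D :&: hmask i :&: St) = 0%N.
  by apply/eqP; rewrite mxrank_eq0 -submx0.
have -> : \rank (D :&: hmask i + St) = \rank (hmask i).
  apply/eqP; rewrite eqn_leq !mxrankS // addsmx_sub capmxSr /=.
  by apply: mask_mono => c /andP[].
by rewrite /St rank_mask addn0 => ->.
Qed.

Hypothesis d_fw : forall r c, d r c != 0 -> fw r = fw c.
Hypothesis src_p : forall c, src c -> std (p c) /\ d c (p c) != 0.
(** Acyclicity: along a path alternating between the differential and the matching, [mw] of the
    partners strictly drops, so no such path closes up. *)
Hypothesis src_mw : forall c c2, src c -> src c2 -> c != c2 -> d c (p c2) != 0 ->
  (mw (p c2) < mw (p c))%N.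

(* On the span of the sources the differential is triangular modulo [D] with nonzero diagonal. *)
Lemma src_drank i : (srci i <= drank i)%N.
Proof.
set Sr := mask k [pred c | src c && (hd c == i)].
rewrite /drank -mulmxA.
have le : (\rank (Sr *m (d *m cokermx D)) <= \rank (hmask i *m (d *m cokermx D)))%N.
  by apply/mxrankS/submxMr/mask_mono => c /andP[].
apply: leq_trans le.
have := mxrank_mul_ker Sr (d *m cokermx D); rewrite rank_mask /srci.
suff -> : \rank (Sr :&: kermx (d *m cokermx D)) = 0%N by rewrite addn0 => ->.
apply/eqP; rewrite mxrank_eq0 -submx0; apply/row_subP => r; set f := row r _.
have : (f <= Sr :&: kermx (d *m cokermx D))%MS by exact: row_sub.
rewrite sub_capmx sub_coker => /andP[/sub_maskP fS fD].
have fsrc c : f 0 c != 0 -> src c.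
  by move=> nz; apply: contraT => ns; rewrite fS ?eqxx //= (negbTE ns) in nz.
rewrite submx0; apply/eqP/rowP => c0; rewrite [RHS]mxE; apply/eqP; apply: contraT => nz0.
(* Two-stage choice: maximal weight in the support of [f], then maximal [mw] of the partner among
   those. No other source in the support can then hit [p c]. *)
have [c1 nz1 max1] := @arg_maxnP _ c0 (fun c => f 0 c != 0) fw nz0.
have nzfw : (f 0 c1 != 0) && (fw c1 == fw c1) by rewrite nz1 eqxx.
have [c /andP[nz /eqP fwc] max] := @arg_maxnP _ c1 [pred c | (f 0 c != 0) && (fw c == fw c1)]
  (fun c => mw (p c)) nzfw.
have sc := fsrc _ nz; have [sp dp] := src_p sc.
have fdE : (f *m d) 0 (p c) = f 0 c * d c (p c).
  rewrite mxE (bigD1 c) //= big1 ?addr0 // => c2 nc2.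
  apply/eqP; rewrite mulf_eq0; apply: contraT; rewrite negb_or => /andP[n2 d2].
  have := src_mw (fsrc _ n2) sc nc2 d2.
  have := max c2; rewrite /= n2 (d_fw d2) -(d_fw dp) fwc eqxx => /(_ isT) le lt.
  by move: (leq_trans lt le); rewrite ltnn.
have nzp : (f *m d) 0 (p c) != 0 by rewrite fdE mulf_neq0.
(* [f *m d] lies in [D] and involves the standard cell [p c], so it also involves a heavier cell;
   this is impossible because [d] preserves the weight and [c] was heaviest. *)
have [c' nzc' lt] := lead fD sp nzp.
have : exists2 c2, f 0 c2 != 0 & d c2 c' != 0.
  apply/exists_inP; move: nzc'; apply: contraR => /exists_inPn h.
  rewrite mxE big1 // => c2 _; case: (eqVneq (f 0 c2) 0) => [->|n2]; first by rewrite mul0r.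
  by have := h c2 n2; rewrite negbK => /eqP ->; rewrite mulr0.
case=> c2 n2 d2; have := max1 c2 n2; rewrite (d_fw d2) -fwc (d_fw dp) => le.
by move: (leq_trans lt le); rewrite ltnn.
Qed.

Variable crit : pred 'I_M.
Definition criti i := #|[pred c | crit c && (hd c == i)]|.
Hypothesis count_std : forall i, stdi i = (criti i + srci i + srci i.+1)%N.

(** The dimension is [stdi i - drank i - drank i.+1], and [src_drank] bounds both ranks from below
    by the numbers of sources. *)
Lemma homdim_le_crit i : (homdim i <= criti i)%N.
Proof.
rewrite /homdim rank_bounds.
move: (rank_cycles i) (rank_std i) (count_std i) (src_drank i) (src_drank i.+1); lia.
Qed.

(** From [d] squared being zero, [drank l + drank l.+1 <= stdi l]. In a degree without unmatched
    cells this leaves no room above [src_drank], so both ranks adjacent to degree [i.+1] equal the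
    source counts. *)
Lemma homdim_eq_crit i : criti i = 0%N -> criti i.+2 = 0%N -> homdim i.+1 = criti i.+1.
Proof.
rewrite /homdim => c0 c2.
have le l : (drank l + drank l.+1 <= stdi l)%N.
  have := mxrankS (bounds_cycles l); rewrite rank_bounds.
  move: (rank_cycles l) (rank_std l); lia.
rewrite rank_bounds; move: c0 c2.
move: (le i) (le i.+1) (le i.+2) (rank_cycles i.+1) (rank_std i.+1).
move: (count_std i) (count_std i.+1) (count_std i.+2).
move: (src_drank i) (src_drank i.+1) (src_drank i.+2) (src_drank i.+3); lia.
Qed.

End Morse.

(** * The Koszul complex *)

Section Cells.
Variables (k : fieldType) (N j : nat).
Local Notation I := ('I_#|{: KB N j}|).
Implicit Types (c : I) (E : {ffun 'I_N -> nat}) (F : {set 'I_N}).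

Definition cS c : {set 'I_N} := (val (kbe c)).1.
Definition cE c : {ffun 'I_N -> nat} := [ffun u => nat_of_ord ((val (kbe c)).2 u)].

Lemma cell_deg c : (#|cS c| + \sum_u cE c u = j)%N.
Proof.
have /eqP h := valP (kbe c); apply: etrans h.
by congr (_ + _)%N; apply: eq_bigr => u _; rewrite ffunE.
Qed.

Lemma cell_inj c c' : cS c = cS c' -> cE c = cE c' -> c = c'.
Proof.
move=> hS /ffunP hE; apply: enum_val_inj; apply: val_inj.
rewrite [LHS]surjective_pairing [RHS]surjective_pairing; congr (_, _) => //.
by apply/ffunP => u; apply: val_inj; have := hE u; rewrite !ffunE.
Qed.

Lemma cell_ex F E : (#|F| + \sum_u E u = j)%N -> exists c, (cS c == F) && (cE c == E).
Proof.
move=> h; have le u : (E u < j.+1)%N by rewrite ltnS -h (bigD1 u) //= addnA addnAC leq_addl.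
pose a := [ffun u => inord (E u) : 'I_j.+1].
have ha : (#|(F, a).1| + \sum_(u < N) ((F, a).2 u : nat))%N == j.
  by rewrite -[X in _ == X]h; apply/eqP; congr (_ + _)%N; apply: eq_bigr => u _;
     rewrite /= ffunE inordK.
pose q : KB N j := Sub (F, a) ha.
exists (enum_rank q); rewrite /cS /cE /kbe enum_rankK eqxx /=.
by apply/eqP/ffunP => u; rewrite !ffunE inordK.
Qed.

(* The cell [e_F (x) z^E], with default [c0] when its degree is not [j]. *)
Definition toc c0 F E : I := odflt c0 [pick c | (cS c == F) && (cE c == E)].

Lemma tocE c0 F E : (#|F| + \sum_u E u = j)%N ->
  (cS (toc c0 F E) = F) * (cE (toc c0 F E) = E).
Proof.
move=> h; rewrite /toc; case: pickP => [c /andP[/eqP-> /eqP->] //|no].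
by have [c hc] := cell_ex h; rewrite no in hc.
Qed.

Definition addE E v : {ffun 'I_N -> nat} := [ffun u => (E u + (u == v))%N].

Lemma sum_unit (v : 'I_N) : (\sum_u (u == v : nat) = 1)%N.
Proof. by rewrite (bigD1 v) //= eqxx big1 // => u /negbTE->. Qed.

Lemma sum_addE E v : (\sum_u addE E v u = (\sum_u E u).+1)%N.
Proof.
under eq_bigr do rewrite ffunE.
by rewrite big_split /= sum_unit addn1.
Qed.

(** The term of the differential of [c] that moves [v] from the wedge into the monomial. *)
Definition nx c v : I := toc c (cS c :\ v) (addE (cE c) v).

Lemma nxE c v : v \in cS c -> (cS (nx c v) = cS c :\ v) * (cE (nx c v) = addE (cE c) v).
Proof.
move=> vF; apply: tocE; rewrite sum_addE -(cell_deg c).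
by rewrite [#|cS c|](cardsD1 v) vF addnS add1n addSn.
Qed.

Definition sg v F : k := (-1) ^+ #|[set u in F | (u < v)%N]|.

Lemma sg_neq0 v F : sg v F != 0.
Proof. by rewrite /sg expf_neq0 // oppr_eq0 oner_eq0. Qed.

Lemma nx_eq c v c' : v \in cS c ->
  (c' == nx c v) = (cS c' == cS c :\ v) &&
      [forall u, (val (kbe c')).2 u == ((val (kbe c)).2 u + (u == v))%N :> nat].
Proof.
move=> vF; have [hS hE] := nxE vF; apply/eqP/andP => [->|[/eqP eS /forallP eE]].
  rewrite hS eqxx; split=> //; apply/forallP => u; move/ffunP/(_ u): hE.
  by rewrite !ffunE => ->.
apply: cell_inj; rewrite ?hS ?hE //; apply/ffunP => u.
by rewrite !ffunE; apply/eqP/eE.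
Qed.

Lemma row_kdiff c : row c (kdiff k N j) = \sum_(v in cS c) sg v (cS c) *: delta_mx 0 (nx c v).
Proof.
apply/rowP => c'; rewrite !mxE summxE /kcoef big_mkcondr /=.
apply: eq_bigr => v vF; rewrite !mxE eqxx /= nx_eq //.
by case: ifP => _; rewrite ?mulr1 ?mulr0.
Qed.

Lemma kdiff_nx c v : v \in cS c -> kdiff k N j c (nx c v) = sg v (cS c).
Proof.
move=> vF; have := congr1 (fun w : 'rV_ _ => w 0 (nx c v)) (row_kdiff c).
rewrite mxE => ->; rewrite summxE (bigD1 v) //= !mxE !eqxx mulr1 big1 ?addr0 //.
move=> u /andP[uF uv]; rewrite !mxE eqxx /=; case: eqP => [h|]; last by rewrite mulr0.
have := (nxE uF).1; rewrite -h (nxE vF).1 => /setP/(_ u).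
by rewrite !inE eqxx uF uv.
Qed.

Lemma kdiff_neq0 c c' : kdiff k N j c c' != 0 -> exists2 v, v \in cS c & c' = nx c v.
Proof.
have := congr1 (fun w : 'rV_ _ => w 0 c') (row_kdiff c).
rewrite mxE => -> nz.
suff /exists_inP[v vF /eqP]: [exists v in cS c, c' == nx c v] by exists v.
apply: contraR nz => /exists_inPn h; rewrite summxE big1 // => v vF; rewrite !mxE eqxx /= (negbTE (h v vF)).
by rewrite mulr0.
Qed.

Lemma kdiff_deg c c' : kdiff k N j c c' != 0 -> #|cS c| = #|cS c'|.+1.
Proof. by case/kdiff_neq0 => v vF ->; rewrite (nxE vF).1 [LHS](cardsD1 v) vF. Qed.

Lemma sg_anti F v w : v \in F -> w \in F -> (w < v)%N ->
  sg v F * sg w (F :\ v) = - (sg w F * sg v (F :\ w)).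
Proof.
move=> vF wF wv; rewrite /sg.
have -> : [set u in F :\ v | (u < w)%N] = [set u in F | (u < w)%N].
  apply/setP => u; rewrite !inE; case: eqP => //= ->.
  by rewrite [(v < w)%N]ltnNge (ltnW wv) !andbF.
have -> : #|[set u in F | (u < v)%N]| = #|[set u in F :\ w | (u < v)%N]|.+1.
  rewrite (cardsD1 w) !inE wF wv add1n; congr _.+1; apply: eq_card => u.
  by rewrite !inE -!andbA.
by rewrite exprS mulN1r mulNr mulrC.
Qed.

Lemma kdiff_sq : kdiff k N j *m kdiff k N j = 0.
Proof.
apply/row_matrixP => c; rewrite row0 row_mul row_kdiff mulmx_suml.
set F := cS c.
pose f (v w : 'I_N) : 'rV[k]_(#|{: KB N j}|) :=
  (sg v F * sg w (F :\ v)) *: delta_mx 0 (nx (nx c v) w).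
pose A := \sum_(v in F) \sum_(w in F | (w < v)%N) f v w.
pose B := \sum_(v in F) \sum_(w in F | (v < w)%N) f v w.
transitivity (A + B).
  rewrite -big_split /=; apply: eq_bigr => v vF.
  rewrite -scalemxAl -rowE row_kdiff (nxE vF).1 scaler_sumr (bigID (fun w : 'I_N => (w < v)%N)) /=.
  congr (_ + _); apply: eq_big => [w|w _]; rewrite ?scalerA // !inE -/F andbAC andbC.
    by case: (w \in F) => //=; rewrite -val_eqE ltn_neqAle; case: eqP.
  by case: (w \in F) => //=; rewrite -val_eqE -leqNgt ltn_neqAle eq_sym.
suff -> : B = - A by rewrite subrr.
rewrite /A /B.
rewrite (exchange_big_dep (mem F)) /= => [|v w _ /andP[] //].
rewrite -sumrN; apply: eq_bigr => v vF; rewrite -sumrN.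
apply: eq_big => [w|w /andP[wF /andP[_ wv]]]; first by rewrite vF.
rewrite /f (sg_anti vF wF wv) scaleNr opprK.
have vFw : v \in cS (nx c w) by rewrite (nxE wF).1 !inE vF andbT -val_eqE neq_ltn wv orbT.
have wFv : w \in cS (nx c v) by rewrite (nxE vF).1 !inE wF andbT -val_eqE neq_ltn wv.
have -> : nx (nx c w) v = nx (nx c v) w; last by [].
apply: cell_inj; rewrite !(nxE vFw, nxE wFv, nxE vF, nxE wF).
  by apply/setP => u; rewrite !inE andbCA.
by apply/ffunP => u; rewrite !ffunE addnAC.
Qed.
End Cells.

(** * Standard monomials *)

Section Exponents.
Variables (n : nat) (adj : rel 'I_n).
Local Notation expo := {ffun 'I_(n + n) -> nat}.
Implicit Types (E : expo) (i u w : 'I_n).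

Lemma xy_neq i u : (xv i == yv u) = false.
Proof. by rewrite /xv /yv eq_lrshift. Qed.
Lemma yx_neq i u : (yv i == xv u) = false.
Proof. by rewrite /xv /yv eq_rlshift. Qed.
Lemma xx_eq i u : (xv i == xv u) = (i == u).
Proof. by rewrite /xv eq_lshift. Qed.
Lemma yy_eq i u : (yv i == yv u) = (i == u).
Proof. by rewrite /yv eq_rshift. Qed.
Definition xyE := (xy_neq, yx_neq, xx_eq, yy_eq).

Lemma varP (v : 'I_(n + n)) : (exists i, v = xv i) \/ (exists i, v = yv i).
Proof. by case: (split_ordP v) => i ->; [left | right]; exists i. Qed.

Lemma sum_xy (R : nmodType) (f : 'I_(n + n) -> R) :
  \sum_v f v = \sum_i f (xv i) + \sum_i f (yv i).
Proof. by rewrite big_split_ord. Qed.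

Definition swE E i u : expo :=
  [ffun v => (E v - ((v == xv i) + (v == yv u)) + ((v == xv u) + (v == yv i)))%N].

Definition has_edge E i u := [&& adj i u, (0 < E (xv i))%N & (0 < E (yv u))%N].
Definition stdE E := [forall i, forall u, ~~ has_edge E i u].

Definition cdeg E i := (E (xv i) + E (yv i))%N.
Definition psum E t := (\sum_(i < n | i <= t) E (xv i))%N.
(* No edge of the support of [E] crosses the cut after [t]: moving along edges preserves [psum _ t]. *)
Definition blk E t := [forall u : 'I_n, forall w : 'I_n,
  [&& (u <= t)%N, (t < w)%N & adj u w] ==> (cdeg E u == 0) || (cdeg E w == 0)]%N.
(** The fibres of monomials modulo the binomials, described by invariants: swaps preserve the
    relation ([eqv_swE]), and a fibre has at most one standard monomial ([weight_std]). Since [blk]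
    depends only on the column degrees [cdeg], the relation is symmetric. *)
Definition eqv E E' := [forall i, cdeg E i == cdeg E' i] &&
  [forall t : 'I_n, blk E t ==> (psum E t == psum E' t)].

Lemma swE_x E i u l : (0 < E (xv i))%N -> swE E i u (xv l) = (E (xv l) - (l == i) + (l == u))%N.
Proof. by rewrite ffunE !xyE !addn0. Qed.
Lemma swE_y E i u l : (0 < E (yv u))%N -> swE E i u (yv l) = (E (yv l) - (l == u) + (l == i))%N.
Proof. by rewrite ffunE !xyE !add0n. Qed.

Lemma sub_unit E v : (0 < E v)%N -> forall v', ((v' == v) <= E v')%N.
Proof. by move=> h v'; case: eqP => // ->. Qed.

Lemma sum_swE E i u : (0 < E (xv i))%N -> (0 < E (yv u))%N ->
  (\sum_v swE E i u v = \sum_v E v)%N.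
Proof.
move=> hx hy.
suff : (\sum_v (swE E i u v + ((v == xv i) + (v == yv u))) =
        \sum_v (E v + ((v == xv u) + (v == yv i))))%N.
  by rewrite !big_split /= !sum_unit; apply: addIn.
apply: eq_bigr => v _; rewrite ffunE.
have : ((v == xv i) + (v == yv u) <= E v)%N.
  have [->|_] := eqVneq v (xv i); first by rewrite xyE addn0.
  exact: sub_unit.
by lia.
Qed.

Lemma psumS E t (h : (t.+1 < n)%N) : psum E t.+1 = (psum E t + E (xv (Ordinal h)))%N.
Proof.
rewrite /psum (bigD1 (Ordinal h)) //= addnC; congr (_ + _)%N.
by apply: eq_bigl => i; rewrite -val_eqE /=; lia.
Qed.

Lemma psum0 E (h : (0 < n)%N) : psum E 0 = E (xv (Ordinal h)).
Proof.
rewrite /psum (bigD1 (Ordinal h)) //= big1 ?addn0 // => i.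
by rewrite -val_eqE /=; lia.
Qed.

(** Summation by parts: [n - i] is the number of cuts [t >= i], so comparing the partial sums cut by
    cut compares the weights. *)
Lemma sum_psum E : (\sum_i E (xv i) * (n - i) = \sum_(t < n) psum E t)%N.
Proof.
rewrite /psum (exchange_big_dep predT) //=; apply: eq_bigr => i _.
rewrite sum_nat_const mulnC; congr (_ * _)%N.
rewrite -sum1_card -(big_mkord (fun t => i <= t)%N (fun=> 1%N)).
rewrite (big_cat_nat _ (n := i)) //=; last exact: ltnW.
rewrite big_nat_cond big_pred0 => [|t]; last by lia.
rewrite big_nat_cond (eq_bigl (fun t => (i <= t < n)%N)) => [|t]; last by lia.
by rewrite -big_nat sum_nat_const_nat muln1 add0n.
Qed.

Lemma blk_last E t : (n <= t.+1)%N -> blk E t.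
Proof.
by move=> h; apply/forallP=> u; apply/forallP=> w; apply/implyP=> /and3P[_ tw]; have := ltn_ord w; lia.
Qed.

Lemma eqv_cdeg E E' i : eqv E E' -> cdeg E i = cdeg E' i.
Proof. by case/andP => /forallP/(_ i)/eqP. Qed.

Lemma eqv_x E E' : eqv E E' -> (forall i, E (xv i) = E' (xv i)) -> E = E'.
Proof.
move=> h hx; apply/ffunP => v; case: (varP v) => [] [i ->] //.
by move: (eqv_cdeg i h); rewrite /cdeg hx; apply: addnI.
Qed.

Hypothesis adj_lt : forall i u, adj i u -> (i < u)%N.
Hypothesis adj_itv : forall i u i' u', adj i u -> (i <= i')%N -> (i' < u')%N -> (u' <= u)%N ->
  adj i' u'.

(* In a standard monomial an exponent [x_i > 0] forces every later [y_u] of the same component to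
   vanish, i.e. the [x]'s are pushed as far right as possible. *)
Lemma psum_std E E' t : stdE E -> eqv E E' -> (t < n)%N -> (psum E t <= psum E' t)%N.
Proof.
move=> sE hE tn; rewrite leqNgt; apply/negP.
(* An excess of [E] over [E'] at a vertex where [x] occurs persists to the right. The cut after [m]
   cannot be blocked, so an edge of the support crosses it and some [x_u1] with [u1 <= m] is
   adjacent to [m.+1]; standardness makes the exponent of [y] at [m.+1] zero, so [E] has all of that
   column degree in [x]. The last cut is always blocked, a contradiction. *)
have step t0 (h0 : (t0 < n)%N) : (psum E' t0 < psum E t0)%N -> (0 < E (xv (Ordinal h0)))%N -> False.
  move=> lt0 pos.
  have Q m : (t0 <= m)%N -> (m < n)%N -> (psum E' m < psum E m)%N /\
      (forall w, (t0 < w <= m)%N -> E (yv w) = 0%N).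
    elim: m => [|m IH] t0m mn.
      by have t00 : t0 = 0%N by [lia]; subst; split=> // w; lia.
    have [/eqP e0|ne] := boolP (t0 == m.+1).
      by subst; split=> // w; lia.
    have [|lt full] := IH _ (ltnW mn); first by lia.
    have nb : ~~ blk E m.
      apply: contraTN lt => b; case/andP: hE => _ /forallP/(_ (Ordinal (ltnW mn)))/implyP/=.
      by move=> /(_ b)/eqP ->; rewrite ltnn.
    have ym : E (yv (Ordinal mn)) = 0%N.
      case/forallPn: nb => u0 /forallPn[w]; rewrite negb_imply negb_or -!lt0n.
      case/andP=> /and3P[um mw auw] /andP[cu cw].
      have [u1 a1 x1] : exists2 u1, adj u1 (Ordinal mn) & (0 < E (xv u1))%N.
        have [le|lt1] := leqP t0 u0.
          exists u0; first by apply: adj_itv auw _ _ _ => //=; lia.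
          have [/eqP e0|ne0] := boolP (val u0 == t0).
            by rewrite (_ : u0 = Ordinal h0) //; apply: val_inj.
          by move: cu; rewrite /cdeg full ?addn0 //; move: ne0 => /=; lia.
        by exists (Ordinal h0) => //; apply: adj_itv auw _ _ _ => //=; lia.
      move/forallP/(_ u1)/forallP/(_ (Ordinal mn)): sE.
      by rewrite /has_edge a1 x1 /= -leqNgt leqn0 => /eqP.
    split=> [|w /andP[tw]].
      rewrite !(psumS _ mn); move: (eqv_cdeg (Ordinal mn) hE); rewrite /cdeg ym; lia.
    rewrite leq_eqVlt => /orP[/eqP wm|wm]; last by apply: full; lia.
    by rewrite (_ : w = Ordinal mn) //; apply: val_inj.
  have n0 : (n.-1 < n)%N by lia.
  have [|lt _] := Q n.-1 _ n0; first by lia.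
  have b : blk E n.-1 by apply: blk_last; lia.
  move: lt; case/andP: hE => _ /forallP/(_ (Ordinal n0))/implyP/= /(_ b)/eqP ->.
  by rewrite ltnn.
(* If [x] does not occur at the present vertex, the excess already holds one vertex earlier. *)
elim: t tn => [|t IH] tn lt.
  apply: (step 0%N tn) => //; move: lt; rewrite !psum0; lia.
have [x0|x0] := posnP (E (xv (Ordinal tn))); last exact: (step _ tn).
apply: (IH (ltnW tn)); move: lt; rewrite !(psumS _ tn) x0; lia.
Qed.

Lemma weight_std E E' : stdE E -> eqv E E' -> E != E' ->
  (\sum_i E (xv i) * (n - i) < \sum_i E' (xv i) * (n - i))%N.
Proof.
move=> sE hE ne; rewrite !sum_psum ltnNge; apply: contra ne => ge.
have le (t : 'I_n) : (psum E t <= psum E' t)%N by exact: psum_std.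
have eqp (t : 'I_n) : psum E t = psum E' t.
  apply/eqP; rewrite eqn_leq le /= leqNgt; apply: contraL ge => lt; rewrite -ltnNge.
  rewrite (bigD1 t) //= [ltnRHS](bigD1 t) //= -addSn leq_add // leq_sum //.
apply/eqP; apply: (eqv_x hE) => i; case: i => [[|t] h].
  by have := eqp (Ordinal h); rewrite /= !psum0.
have := eqp (Ordinal (ltnW h)); have := eqp (Ordinal h); rewrite /= !(psumS _ h) => + e1.
by rewrite e1 => /addnI.
Qed.

(** Lexicographic counterpart of [weight_std]: the standard monomial is also lex-least in its fibre.
    The weight serves the homology, the lex order serves the initial ideal. *)
Lemma first_diff_std E E' : stdE E -> eqv E E' -> E != E' ->
  exists2 i, (E (xv i) < E' (xv i))%N & forall u, (u < i)%N -> E (xv u) = E' (xv u).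
Proof.
move=> sE hE ne.
have [i0 ni0] : exists i, E (xv i) != E' (xv i).
  apply/existsP; apply: contraR ne => /existsPn h; apply/eqP; apply: (eqv_x hE) => i.
  by apply/eqP; move: (h i); rewrite negbK.
have [i ni imin] := @arg_minnP _ i0 (fun i => E (xv i) != E' (xv i)) (fun i => val i) ni0.
have eqb u : (u < i)%N -> E (xv u) = E' (xv u).
  by move=> ui; apply/eqP; apply: contraTT ui => /imin; rewrite -leqNgt.
exists i => //; rewrite ltn_neqAle ni /=.
have := psum_std sE hE (ltn_ord i); rewrite /psum (bigD1 i) //= [leqRHS](bigD1 i) //=.
rewrite (eq_bigr (fun u => E' (xv u))) ?leq_add2r // => u /andP[ui ne0].
by apply: eqb; rewrite ltn_neqAle ui -val_eqE in ne0 *; rewrite ne0.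
Qed.

Lemma cdeg_swE E i u l : has_edge E i u -> cdeg (swE E i u) l = cdeg E l.
Proof.
case/and3P => a hx hy; rewrite /cdeg swE_x // swE_y //; have := adj_lt a.
by case: (eqVneq l i) (eqVneq l u) => [->|_] [->|_]; lia.
Qed.

Lemma psum_swE E i u t : has_edge E i u -> (t < i)%N || (u <= t)%N ->
  psum (swE E i u) t = psum E t.
Proof.
case/and3P => a hx hy; have iu := adj_lt a; rewrite /psum => /orP[ti|ut].
  apply: eq_bigr => l lt; rewrite swE_x // -!val_eqE.
  by do 2 (case: eqP => /= [?|_]; first by lia); lia.
have : (\sum_(l < n | l <= t) (swE E i u (xv l) + (l == i)) =
        \sum_(l < n | l <= t) (E (xv l) + (l == u)))%N.
  by apply: eq_bigr => l _; rewrite swE_x //; case: (eqVneq l i) => [->|_]; lia.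
rewrite !big_split /=.
have one (v : 'I_n) : (v <= t)%N -> (\sum_(l < n | l <= t) (l == v) = 1)%N.
  by move=> vt; rewrite (bigD1 v) //= eqxx big1 // => l /andP[_ /negbTE->].
by rewrite !one //; [apply: addIn | lia].
Qed.

(** A swap along [i u] changes the partial sums only at cuts between [i] and [u], and those are not
    blocked, because the edge [i u] itself lies in the support. *)
Lemma eqv_swE E E0 i u : has_edge E0 i u -> eqv E (swE E0 i u) = eqv E E0.
Proof.
move=> h; rewrite /eqv.
under eq_forallb do rewrite cdeg_swE //.
have [/forallP hc|] //= := boolP [forall i0, cdeg E i0 == cdeg E0 i0].
apply: eq_forallb => t; case b: (blk E t) => //=.
rewrite psum_swE //; apply/negPn/negP; rewrite negb_or -leqNgt -ltnNge => /andP[it tu].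
move/forallP/(_ i)/forallP/(_ u)/implyP: b; case/and3P: h => a hx hy.
rewrite it tu a (eqP (hc i)) (eqP (hc u)) /cdeg => /(_ isT); lia.
Qed.

Lemma eqvxx E : eqv E E.
Proof. by apply/andP; split; apply/forallP => t; rewrite ?eqxx ?implybT. Qed.

End Exponents.

Section Monomials.
Variables (N d : nat).
Local Notation I := ('I_#|{: mono N d}|).
Definition mE (r : I) : {ffun 'I_N -> nat} := [ffun u => ev (mne r) u].

Lemma mE_deg r : (\sum_u mE r u = d)%N.
Proof.
by have /eqP h := valP (mne r); apply: etrans h; apply: eq_bigr => u _; rewrite ffunE.
Qed.

Lemma ev_inj (m m' : mono N d) : (forall u, ev m u = ev m' u) -> m = m'.
Proof. by move=> h; apply: val_inj; apply/ffunP => u; apply: val_inj; exact: h. Qed.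

Lemma mE_inj : injective mE.
Proof.
move=> r r' /ffunP h; apply: enum_val_inj; apply: ev_inj => u.
by have := h u; rewrite !ffunE.
Qed.

Lemma mE_ex (E : {ffun 'I_N -> nat}) : (\sum_u E u = d)%N -> exists r, mE r = E.
Proof.
move=> h; have le u : (E u < d.+1)%N by rewrite ltnS -h (bigD1 u) //= leq_addr.
pose a := [ffun u => inord (E u) : 'I_d.+1].
have ha : (\sum_(u < N) (a u : nat))%N == d.
  by rewrite -[X in _ == X]h; apply/eqP; apply: eq_bigr => u _; rewrite ffunE inordK.
exists (enum_rank (Sub a ha : mono N d)); apply/ffunP => u.
by rewrite ffunE /mne enum_rankK /ev /= ffunE inordK.
Qed.

End Monomials.

(** * The Koszul subcomplexes of the binomial edge ideal and of its initial ideal *)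

Section Ideals.
Variables (k : fieldType) (n : nat) (e : rel 'I_n).
Local Notation N := (n + n)%N.
Definition adj : rel 'I_n := [rel i u : 'I_n | e i u && (i < u)%N].

Lemma adj_lt i u : adj i u -> (i < u)%N.
Proof. by case/andP. Qed.

Hypothesis adj_itv : forall i u i' u' : 'I_n, adj i u -> (i <= i')%N -> (i' < u')%N -> (u' <= u)%N ->
  adj i' u'.

Section Degree.
Variable j : nat.
Local Notation I := ('I_#|{: KB N j}|).
Implicit Types c : I.

Definition sw c i u : I := toc c (cS c) (swE (cE c) i u).

Lemma sw_E c i u : has_edge adj (cE c) i u -> (cS (sw c i u) = cS c) * (cE (sw c i u) = swE (cE c) i u).
Proof. by case/and3P => _ hx hy; apply: tocE; rewrite sum_swE // cell_deg. Qed.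

Definition gen (eps : k) (t : I * 'I_n * 'I_n) : 'rV[k]_(#|{: KB N j}|) :=
  let: (c, i, u) := t in
  if has_edge adj (cE c) i u then delta_mx 0 c - eps *: delta_mx 0 (sw c i u) else 0.

(* The binomial ideal for [eps = 1], its initial ideal for [eps = 0]. *)
Definition Dg eps := (\sum_(t : I * 'I_n * 'I_n) <<gen eps t>>)%MS.

Lemma gen_Dg eps t : (gen eps t <= Dg eps)%MS.
Proof. by apply: (sumsmx_sup t) => //; rewrite genmxE. Qed.

Lemma Dg_sub eps m (A : 'M[k]_(m, #|{: KB N j}|)) :
  (forall t, (gen eps t <= A)%MS) -> (Dg eps <= A)%MS.
Proof. by move=> h; apply/sumsmx_subP => t _; rewrite genmxE. Qed.

Lemma Dg_ker eps (phi : 'rV[k]_(#|{: KB N j}|)) :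
  (forall c i u, has_edge adj (cE c) i u -> phi 0 c = eps * phi 0 (sw c i u)) ->
  Dg eps *m phi^T = 0.
Proof.
move=> h; apply/eqP; rewrite -sub_kermx; apply: Dg_sub => -[[c i] u]; rewrite sub_kermx /gen.
case: ifP => he; last by rewrite mul0mx.
rewrite mulmxBl -scalemxAl -!rowE; apply/eqP/rowP => o; rewrite !mxE.
by rewrite ord1 (h _ _ _ he) subrr.
Qed.

Lemma kdiff_gen eps t : (gen eps t *m kdiff k N j <= Dg eps)%MS.
Proof.
case: t => [[c i] u]; rewrite /gen; case: ifP => he; last by rewrite mul0mx sub0mx.
have [hS hE] := sw_E he.
rewrite mulmxBl -scalemxAl -!rowE !row_kdiff hS scaler_sumr -sumrB summx_sub // => v vF.
rewrite scalerA mulrC -scalerA -scalerBr scalemx_sub //.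
have [nS nE] := nxE vF.
have he' : has_edge adj (cE (nx c v)) i u.
  by case/and3P: he => a hx hy; rewrite /has_edge a nE ![addE _ _ _]ffunE !addn_gt0 hx hy.
suff -> : nx (sw c i u) v = sw (nx c v) i u by have := gen_Dg eps (nx c v, i, u); rewrite /gen he'.
have vF' : v \in cS (sw c i u) by rewrite hS.
have [oS oE] := nxE vF'; have [pS pE] := sw_E he'.
apply: cell_inj; rewrite ?oS ?pS ?nS ?hS // oE pE nE hE; apply/ffunP => x.
rewrite [LHS]ffunE ![swE _ _ _ _]ffunE ![addE _ _ _]ffunE.
suff le : ((x == xv i) + (x == yv u) <= cE c x)%N by rewrite addnAC addnBAC.
case/and3P: he => _ hx hy.
have [->|_] := eqVneq x (xv i); first by rewrite xyE addn0.
exact: sub_unit.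
Qed.

Lemma Dg_kdiff eps : (Dg eps *m kdiff k N j <= Dg eps)%MS.
Proof.
rewrite sumsmxMr; apply/sumsmx_subP => t _.
by rewrite (eqmxMr _ (genmxE _)) kdiff_gen.
Qed.

(* The multidegree of a cell, preserved by the differential. *)
Definition cB c v := (cE c v + (v \in cS c))%N.
Definition fw c := (\sum_i cB c (xv i) * (n - i))%N.
Definition std c := stdE adj (cE c).

Lemma cB_nx c v x : v \in cS c -> cB (nx c v) x = cB c x.
Proof.
move=> vF; rewrite /cB !nxE // !inE ffunE; case: (eqVneq x v) => [->|_] /=; last by rewrite addn0.
by rewrite vF addn0.
Qed.

Lemma kdiff_fw c c' : kdiff k N j c c' != 0 -> fw c = fw c'.
Proof. by case/kdiff_neq0 => v vF ->; apply: eq_bigr => i _; rewrite cB_nx. Qed.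

Lemma fw_sw c i u : has_edge adj (cE c) i u -> (fw (sw c i u) < fw c)%N.
Proof.
move=> he; have [hS hE] := sw_E he; case/and3P: (he) => a hx hy.
have : (\sum_l (cB (sw c i u) (xv l) + (l == i)) * (n - l) =
        \sum_l (cB c (xv l) + (l == u)) * (n - l))%N.
  apply: eq_bigr => l _; congr (_ * _)%N; rewrite /cB hS hE swE_x //.
  move: (nat_of_bool (xv l \in cS c)) => m; move: hx; case: (eqVneq l i) => [->|_]; clear.
    by move: (cE _ _) (nat_of_bool (i == u)) => x y; rewrite /nat_of_bool; lia.
  by move: (cE _ _) (cE _ _) (nat_of_bool (l == u)) => x y z; rewrite /nat_of_bool; lia.
have one (v : 'I_n) : (\sum_(l < n) (l == v) * (n - l) = n - v)%N.
  by rewrite (bigD1 v) //= eqxx mul1n big1 ?addn0 // => l /negbTE->.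
under eq_bigr do rewrite mulnDl; under [in RHS]eq_bigr do rewrite mulnDl.
rewrite !big_split /= !one -/(fw c) -/(fw (sw c i u)).
by move: (fw _) (fw _) (adj_lt a) (ltn_ord u) => x y; clear; lia.
Qed.

Lemma reduce_cell eps c : ~~ std c -> exists2 c', (#|cS c'| = #|cS c| /\ fw c' < fw c)%N &
  exists a : k, (((delta_mx 0 c - a *: delta_mx 0 c')%R : 'rV[k]_(#|{: KB N j}|)) <= Dg eps)%MS.
Proof.
case/forallPn => i /forallPn[u]; rewrite negbK => he.
exists (sw c i u); first by rewrite (sw_E he).1 fw_sw.
by exists eps; have := gen_Dg eps (c, i, u); rewrite /gen he.
Qed.

(** The form [phi] takes the coefficient at [c] plus [eps] times the sum over the rest of its fibre.
    It kills the generators: their first cell is never the standard [c], and a swap stays in the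
    fibre; [eps * eps = eps] covers both ideals. So a nonzero coefficient at [c] forces another one
    in the fibre, at a heavier cell by [weight_std]. *)
Lemma lead_cell eps (f : 'rV[k]_(#|{: KB N j}|)) c : eps * eps = eps ->
  (f <= Dg eps)%MS -> std c -> f 0 c != 0 -> exists2 c', f 0 c' != 0 & (fw c < fw c')%N.
Proof.
move=> ee fD sc nz.
pose Q c' := (cS c' == cS c) && eqv adj (cE c) (cE c').
pose phi : 'rV[k]_(#|{: KB N j}|) := \row_c' (if c' == c then 1 else eps * (Q c')%:R).
have phi0 : Dg eps *m phi^T = 0.
  apply: Dg_ker => c0 i u he; rewrite !mxE.
  have nc : c0 != c.
    by apply: contraTneq he => ->; move/forallP/(_ i)/forallP/(_ u): sc.
  have QE : Q (sw c0 i u) = Q c0 by rewrite /Q !(sw_E he) (eqv_swE adj_lt).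
  rewrite (negbTE nc) -QE; case: eqP => [->|_]; last by rewrite mulrA ee.
  by rewrite /Q eqxx eqvxx.
have : f *m phi^T = 0 by case/submxP: fD => v ->; rewrite -mulmxA phi0 mulmx0.
move/rowP/(_ 0); rewrite !mxE (bigD1 c) //= !mxE eqxx mulr1 => /eqP.
rewrite addr_eq0 => /eqP e0.
have : exists c', [&& c' != c, Q c' & f 0 c' != 0].
  apply/existsP; apply: contraR nz => /existsPn h; rewrite e0 oppr_eq0 big1 // => c' nc.
  rewrite !mxE (negbTE nc); move: (h c'); rewrite nc /=.
  case: (Q c') => /= [|_]; last by rewrite !mulr0.
  by rewrite negbK => /eqP ->; rewrite mul0r.
case=> c' /and3P[nc /andP[/eqP qS qE] nz']; exists c' => //.
rewrite /fw /cB qS; under eq_bigr do rewrite mulnDl.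
under [ltnRHS]eq_bigr do rewrite mulnDl.
rewrite !big_split /= ltn_add2r; apply: (weight_std adj_itv) => //.
by apply: contraNneq nc => h; apply/eqP/cell_inj.
Qed.

Lemma kembE (F : {set 'I_N}) r c :
  kemb k j F r c = ((cS c == F) && (cE c == mE r))%:R.
Proof.
rewrite mxE; congr ((_ && _)%:R); apply/forallP/eqP => [h|/ffunP h u].
  by apply/ffunP => u; rewrite !ffunE; apply/eqP/h.
by have := h u; rewrite !ffunE => ->.
Qed.

Lemma mul_kemb (F : {set 'I_N}) (w : 'rV[k]_(#|{: mono N (j - #|F|)}|)) c :
  (w *m kemb k j F) 0 c = \sum_(r | (cS c == F) && (cE c == mE r)) w 0 r.
Proof.
rewrite mxE [RHS]big_mkcond; apply: eq_bigr => r _; rewrite kembE.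
by case: ifP => _; rewrite ?mulr1 ?mulr0.
Qed.

Lemma mul_kemb_cell (F : {set 'I_N}) (w : 'rV[k]_(#|{: mono N (j - #|F|)}|)) c r :
  cS c = F -> cE c = mE r -> (w *m kemb k j F) 0 c = w 0 r.
Proof.
move=> hF hr; rewrite mul_kemb (big_pred1 r) // => r'.
by rewrite hF eqxx hr /=; apply/eqP/eqP => [/mE_inj|] ->.
Qed.

Lemma cell_mono c (F : {set 'I_N}) : cS c = F -> exists r : 'I_#|{: mono N (j - #|F|)}|, cE c = mE r.
Proof.
move=> hF; have [|r hr] := @mE_ex N (j - #|F|) (cE c); last by exists r.
by have := cell_deg c; rewrite hF; lia.
Qed.

Lemma kemb_gen eps c0 (F : {set 'I_N}) (q : 'rV[k]_(#|{: mono N (j - #|F|)}|)) i u :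
  cS c0 = F -> has_edge adj (cE c0) i u ->
  (forall r, q 0 r = (mE r == cE c0)%:R - eps * (mE r == swE (cE c0) i u)%:R) ->
  q *m kemb k j F = gen eps (c0, i, u).
Proof.
move=> hF he hq; have [sS sE] := sw_E he; apply/rowP => c; rewrite /gen he.
have -> : (delta_mx 0 c0 - eps *: delta_mx 0 (sw c0 i u) : 'rV[k]_(#|{: KB N j}|)) 0 c =
    (c == c0)%:R - eps * (c == sw c0 i u)%:R by rewrite !mxE eqxx.
have [hc|hc] := eqVneq (cS c) F; last first.
  rewrite mul_kemb (negbTE hc) big_pred0 //.
  do 2 (case: eqP => [h|_]; first by rewrite h ?sS hF eqxx in hc).
  by rewrite mulr0 subr0.
have [r hr] := cell_mono hc; rewrite (mul_kemb_cell _ hc hr) hq -hr /=.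
congr ((_ : bool)%:R - eps * (_ : bool)%:R); apply/eqP/eqP => [h|->] //.
  by apply: cell_inj; rewrite // hc.
by apply: cell_inj; rewrite ?hc ?sS // sE.
Qed.

End Degree.

Section MonoDegree.
Variable d : nat.
Local Notation I := ('I_#|{: mono N d}|).

Lemma JG_row t r : row t (JG_rows k e d) 0 r =
  let: (m0, i, u) := enum_val t in
  let E0 : {ffun 'I_N -> nat} := [ffun v => ev m0 v] in
  if has_edge adj E0 i u then (mE r == E0)%:R - (mE r == swE E0 i u)%:R else 0.
Proof.
rewrite !mxE; case: (enum_val t) => [[m0 i] u] /=.
rewrite /has_edge /= !ffunE -andbA; case: ifP => // _.
congr ((_ : bool)%:R - (_ : bool)%:R).
  by apply/eqP/eqP => [<-|/ffunP h] //; apply: ev_inj => v; have := h v; rewrite !ffunE.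
apply/forallP/eqP => [h|/ffunP h v]; last by have := h v; rewrite !ffunE => ->.
by apply/ffunP => v; rewrite !ffunE; apply/eqP/h.
Qed.

Lemma JG_row_gen (r0 : I) i u r : has_edge adj (mE r0) i u ->
  row (enum_rank (mne r0, i, u)) (JG_rows k e d) 0 r =
  (mE r == mE r0)%:R - (mE r == swE (mE r0) i u)%:R.
Proof. by move=> h; rewrite JG_row enum_rankK /= -/(mE r0) h. Qed.

(** The two terms of a generator lie in the same fibre, with opposite coefficients. *)
Lemma JG_eqv E (f : 'rV[k]_(#|{: mono N d}|)) : (f <= JG k e d)%MS ->
  \sum_(r | eqv adj E (mE r)) f 0 r = 0.
Proof.
move=> fJ.
pose phi : 'rV[k]_(#|{: mono N d}|) := \row_r (eqv adj E (mE r))%:R.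
have mulE (w : 'rV[k]_(#|{: mono N d}|)) : w *m phi^T = (\sum_(r | eqv adj E (mE r)) w 0 r)%:M.
  apply/rowP => o; rewrite !ord1 !mxE eqxx mulr1n [RHS]big_mkcond /=; apply: eq_bigr => r _.
  by rewrite !mxE; case: eqv; rewrite ?mulr1 ?mulr0.
suff h : f *m phi^T = 0.
  by have := mulE f; rewrite h => /rowP/(_ 0); rewrite !mxE eqxx mulr1n.
suff J0 : JG k e d *m phi^T = 0 by case/submxP: fJ => v ->; rewrite -mulmxA J0 mulmx0.
apply/eqP; rewrite -sub_kermx genmxE; apply/row_subP => t; rewrite sub_kermx mulE.
under eq_bigr do rewrite JG_row.
case: (enum_val t) => [[m0 i] u]; set E0 := finfun _.
rewrite /=; case he: (has_edge adj E0 i u); last by rewrite big1 // raddf0.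
have E0d : (\sum_v E0 v = d)%N.
  by have /eqP h := valP m0; apply: etrans h; apply: eq_bigr => v _; rewrite ffunE.
have [r0 h0] := mE_ex E0d; case/and3P: (he) => _ hx hy.
have [|r1 h1] := @mE_ex N d (swE E0 i u); first by rewrite sum_swE.
rewrite sumrB -h1 -h0.
have one (r : I) : \sum_(r' : I | eqv adj E (mE r')) ((mE r' == mE r)%:R : k) = (eqv adj E (mE r))%:R.
  case h: (eqv adj E (mE r)).
    rewrite (bigD1 r) //= eqxx big1 ?addr0 // => r' /andP[_ ne].
    by rewrite (inj_eq (@mE_inj _ _)) (negbTE ne).
  by rewrite big1 // => r' h'; case: eqP => // /mE_inj e'; rewrite e' h in h'.
by rewrite !one h1 h0 (eqv_swE adj_lt) // subrr raddf0.
Qed.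

(** The generators form a Gröbner basis. If [mE r] is standard, the rest of its fibre is lex-larger,
    so by [JG_eqv] an element of the ideal supported on monomials up to [r] has coefficient zero at
    [r]. Otherwise the binomial of an edge dividing [mE r] leads with it. *)
Lemma lead_JG (r : I) : is_lead_mono (JG k e) (mne r) = ~~ stdE adj (mE r).
Proof.
rewrite /is_lead_mono; set lt := mono_lt_mx _ _; set le := mono_le_mx _ _.
have ltE : lt = mask k (fun c => lexlt (mne c) (mne r)) by [].
have leE : le = mask k (fun c => (mne c == mne r) || lexlt (mne c) (mne r)) by [].
have irr (m : mono N d) : lexlt m m = false.
  by apply/negbTE/existsPn => v; rewrite ltnn.
have sub : (JG k e d :&: lt <= JG k e d :&: le)%MS.
  by apply: capmxS => //; apply: mask_mono => c /= ->; rewrite orbT.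
case s: (stdE adj (mE r)) => /=.
  apply/negbTE; rewrite -leqNgt; apply: mxrankS.
  apply/row_subP => t; set f := row t _.
  have : (f <= JG k e d :&: le)%MS by exact: row_sub.
  rewrite !sub_capmx => /andP[fJ fle]; rewrite fJ /=.
  rewrite leE in fle; move/sub_maskP: fle => fle.
  apply/sub_maskP => c nc; have [cr|ne] := eqVneq c r; last first.
    by apply: fle; rewrite negb_or (inj_eq enum_val_inj) ne.
  have := JG_eqv (mE r) fJ; rewrite (bigD1 r) ?eqvxx //= big1 ?addr0 => [|c' /andP[hc ne]].
    by rewrite cr.
  apply: fle; rewrite negb_or (inj_eq enum_val_inj) ne /=.
  have nE : mE r != mE c' by rewrite (inj_eq (@mE_inj _ _)) eq_sym.
  have [i lti eqi] := first_diff_std adj_itv s hc nE.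
  apply/existsPn => v; apply/negP => /andP[lv /forallP av].
  rewrite !ffunE in lti.
  have eqi' (l : 'I_n) : (l < i)%N -> ev (mne r) (xv l) = ev (mne c') (xv l).
    by move/eqi; rewrite !ffunE.
  case: (ltngtP v (xv i)) => h.
  - case: (varP v) h lv => [] [l ->] /= h; last by move: h (ltn_ord i); clear; lia.
    by rewrite (eqi' l) ?ltnn.
  - by have := av (xv i); rewrite h /= => /eqP e0; rewrite e0 ltnn in lti.
  - by move: lv; rewrite (val_inj h : v = xv i) ltnNge ltnW.
case/negbT/forallPn: s => i /forallPn[u]; rewrite negbK => he.
apply: rank_ltmx; rewrite /ltmx sub /=; apply/negP => ge.
set g := row (enum_rank (mne r, i, u)) (JG_rows k e d).
have gE c : g 0 c = _ := JG_row_gen c he.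
have gJ : (g <= JG k e d)%MS by rewrite genmxE row_sub.
case/and3P: (he) => a hx hy; have iu := adj_lt a.
have niu : (i == u) = false by apply/negbTE; rewrite -val_eqE neq_ltn iu.
have nsw : mE r != swE (mE r) i u.
  apply/eqP => /ffunP/(_ (xv i)); rewrite swE_x // eqxx.
  rewrite niu addn0; move: (mE r (xv i)) hx => x; clear.
  by rewrite /nat_of_bool; lia.
have : (g <= JG k e d :&: le)%MS.
  rewrite sub_capmx gJ /= leE; apply/sub_maskP => c; rewrite negb_or (inj_eq enum_val_inj).
  case/andP => ne nlt; rewrite gE (inj_eq (@mE_inj _ _)) (negbTE ne) sub0r.
  case: eqP => [h|_]; last by rewrite oppr0.
  case/negP: nlt; apply/existsP; exists (xv i).
  have evE v : ev (mne c) v = swE (mE r) i u v by rewrite -h ffunE.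
  apply/andP; split.
    rewrite evE swE_x // eqxx niu addn0 -[ev _ _]/(ev (mne r) (xv i)).
    have -> : ev (mne r) (xv i) = mE r (xv i) by rewrite ffunE.
    by move: (mE r (xv i)) hx => x; clear; rewrite /nat_of_bool; lia.
  apply/forallP => v; apply/implyP; rewrite evE.
  case: (varP v) => [] [l ->] /= li; last by exfalso; move: li (ltn_ord i); clear; lia.
  rewrite swE_x //.
  have -> : (l == i) = false by apply/negbTE; rewrite -val_eqE neq_ltn li.
  have -> : (l == u) = false by apply/negbTE; rewrite -val_eqE neq_ltn (ltn_trans li iu).
  by rewrite subn0 addn0 ffunE.
move/submx_trans/(_ ge); rewrite sub_capmx ltE => /andP[_ /sub_maskP/(_ r)].
rewrite irr gE eqxx (negbTE nsw) subr0 => /(_ isT)/eqP; exact/negP/oner_neq0.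
Qed.

End MonoDegree.

Lemma ksub_JG j : (ksub (JG k e) j == Dg j 1)%MS.
Proof.
apply/andP; split; last first.
  apply: Dg_sub => -[[c0 i] u]; rewrite /gen; case: ifP => he; last exact: sub0mx.
  have [r0 h0] := cell_mono (erefl (cS c0)).
  apply: (sumsmx_sup (cS c0)) => //; rewrite genmxE.
  have := he; rewrite h0 => he0.
  have := @kemb_gen j 1 c0 (cS c0) (row (enum_rank (mne r0, i, u)) (JG_rows k e _)) i u
    (erefl _) he.
  rewrite /gen he => <-; last by move=> r; rewrite JG_row_gen // h0 mul1r.
  by apply: submxMr; rewrite genmxE row_sub.
apply/sumsmx_subP => F _; rewrite genmxE.
rewrite (submx_trans (submxMr _ (_ : _ <= JG_rows k e _)%MS)) ?genmxE //.
apply/row_subP => t; rewrite row_mul.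
case ht: (enum_val t) => [[m0 i] u]; set E0 : {ffun 'I_(n + n) -> nat} := [ffun v => ev m0 v].
have rowE0 r : row t (JG_rows k e (j - #|F|)) 0 r =
    if has_edge adj E0 i u then (mE r == E0)%:R - (mE r == swE E0 i u)%:R else 0.
  by rewrite JG_row ht.
case he: (has_edge adj E0 i u) in rowE0; last first.
  rewrite (_ : row t _ = 0) ?mul0mx ?sub0mx //.
  by apply/rowP => r; rewrite rowE0 mxE.
(* For [#|F| > j] the degree [j - #|F|] is truncated to 0, but no cell has wedge [F], so the
   embedding is zero. *)
have [leF|gtF] := leqP #|F| j; last first.
  rewrite (_ : _ *m _ = 0) ?sub0mx //; apply/rowP => c; rewrite mul_kemb mxE big1 // => r.
  by case/andP => /eqP hc _; have := cell_deg c; rewrite hc; lia.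
have [|c0 /andP[/eqP hS /eqP hE]] := @cell_ex _ j F E0.
  have /eqP h := valP m0; rewrite -[in RHS](subnKC leF); congr (_ + _)%N.
  by apply: etrans h; apply: eq_bigr => v _; rewrite ffunE.
rewrite (@kemb_gen j 1 c0 F _ i u) ?hE ?gen_Dg // => r.
by rewrite rowE0 mul1r.
Qed.

Lemma ksub_initial j : (ksub (initial (JG k e)) j == Dg j 0)%MS.
Proof.
have initE d : initial (JG k e) d = mask k (fun r => ~~ stdE adj (mE r)).
  by apply/matrixP => r c; rewrite !mxE lead_JG.
apply/andP; split; last first.
  apply: Dg_sub => -[[c0 i] u]; rewrite /gen; case: ifP => he; last exact: sub0mx.
  have [r0 h0] := cell_mono (erefl (cS c0)).
  apply: (sumsmx_sup (cS c0)) => //; rewrite genmxE.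
  have := @kemb_gen j 0 c0 (cS c0) (delta_mx 0 r0) i u (erefl _) he.
  rewrite /gen he => <-; last first.
    by move=> r; rewrite mxE eqxx h0 (inj_eq (@mE_inj _ _)) mul0r subr0.
  apply: submxMr; rewrite initE; apply: delta_mask.
  by apply/forallPn; exists i; apply/forallPn; exists u; rewrite negbK -h0.
apply/sumsmx_subP => F _; rewrite genmxE initE.
apply/row_subP => r; rewrite row_mul row_mask.
case: (boolP (stdE adj (mE r))) => [_|]; first by rewrite scale0r mul0mx sub0mx.
case/forallPn => i /forallPn[u]; rewrite negbK scale1r => he.
have [leF|gtF] := leqP #|F| j; last first.
  rewrite (_ : _ *m _ = 0) ?sub0mx //; apply/rowP => c; rewrite mul_kemb mxE big1 // => r'.
  by case/andP => /eqP hc _; have := cell_deg c; rewrite hc; lia.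
have [|c0 /andP[/eqP hS /eqP hE]] := @cell_ex _ j F (mE r).
  by rewrite mE_deg subnKC.
rewrite (@kemb_gen j 0 c0 F _ i u) ?hE ?gen_Dg // => r'.
by rewrite mxE eqxx (inj_eq (@mE_inj _ _)) mul0r subr0.
Qed.

End Ideals.

(** * A matching for two overlapping cliques *)

Local Close Scope ring_scope.

Section Matching.
Variables (n s R : nat).
Local Notation V := 'I_(n + n).
Implicit Types (W A : {set V}) (i j p q : 'I_n) (v w : V).

(** Edges of the two cliques on [0..R] and [s..n-1]. *)
Definition cadj : rel 'I_n := [rel i j : 'I_n | (i < j) && ((s <= i) || (j <= R))].

Definition indep A := [forall i, forall j, ~~ [&& cadj i j, xv i \in A & yv j \in A]].
Definition near A j := [exists i, (xv i \in A) && cadj i j].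
(** No [y] of [W] can be joined to [A] without creating an edge; an independent [A] inside [W] with
    this property contains no [y] at all. *)
Definition cov W A := [forall j, (yv j \in W) ==> near A j].
Definition isP W p := [&& xv p \in W, p < s & [forall i : 'I_n, (xv i \in W) && (i < s) ==> (i <= p)]].
Definition isQ W q := [&& xv q \in W, s <= q & [forall i : 'I_n, (xv i \in W) && (s <= i) ==> (i <= q)]].
(** For [i < p < s] every [y] blocked by [x_p] is blocked by [x_i], so [x_p] can be added or removed
    freely. [lowQ] is the same domination in the other range. *)
Definition lowP A p := [exists i : 'I_n, [&& xv i \in A, i < s & i < p]].
Definition lowQ A q := [exists i : 'I_n, [&& xv i \in A, s <= i & i < q]].
Definition q_free W A q := isQ W q && cov W (A :\ xv q).
(** The last clause is tested with [x_p] added; as [q_free] is monotone in [A], it keeps both sets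
    of the pair out of the class of [q_free]. *)
Definition p_free W A p := [&& isP W p, cov W (A :\ xv p) &
  ~~ [exists q, q_free W (xv p |: A) q]].

(* The element toggled in the independent set [A] of the squarefree degree [W], with
   the rank of its class; classes decrease when [A] grows. *)
Definition toggle W A : nat * option V :=
  if [pick p | isP W p && lowP A p] is Some p then (0, Some (xv p)) else
  if [pick q | isQ W q && lowQ A q] is Some q then (1, Some (xv q)) else
  if [pick j | (yv j \in W) && ~~ near A j] is Some j
    then (5 + #|[set i | xv i \in W :\: A]|, Some (yv j)) else
  if [pick q | q_free W A q] is Some q then (2, Some (xv q)) else
  if [pick p | p_free W A p] is Some p then (3, Some (xv p)) else (4, None).

Lemma isP_uniq W p p' : isP W p -> isP W p' -> p = p'.
Proof.
case/and3P=> a b /forallP c /and3P[a' b' /forallP c']; apply/val_inj/eqP.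
by rewrite eqn_leq; have:= c p'; have := c' p; rewrite a a' b b' /= => -> ->.
Qed.

Lemma isQ_uniq W q q' : isQ W q -> isQ W q' -> q = q'.
Proof.
case/and3P=> a b /forallP c /and3P[a' b' /forallP c']; apply/val_inj/eqP.
by rewrite eqn_leq; have:= c q'; have := c' q; rewrite a a' b b' /= => -> ->.
Qed.

Lemma isP_ex W i : xv i \in W -> i < s -> exists2 p, isP W p & i <= p.
Proof.
move=> iW is_; have h : (xv i \in W) && (i < s) by rewrite iW is_.
have [p /andP[a b] c] := @arg_maxnP _ i (fun i => (xv i \in W) && (i < s)) (fun i => val i) h.
exists p; last exact: c.
by apply/and3P; split=> //; apply/forallP => l; apply/implyP => /c.
Qed.

Lemma isQ_ex W i : xv i \in W -> s <= i -> exists2 q, isQ W q & i <= q.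
Proof.
move=> iW is_; have h : (xv i \in W) && (s <= i) by rewrite iW is_.
have [p /andP[a b] c] := @arg_maxnP _ i (fun i => (xv i \in W) && (s <= i)) (fun i => val i) h.
exists p; last exact: c.
by apply/and3P; split=> //; apply/forallP => l; apply/implyP => /c.
Qed.

Lemma near_mono A A' j : A \subset A' -> near A j -> near A' j.
Proof. by move/subsetP=> h /existsP[i /andP[/h iA a]]; apply/existsP; exists i; rewrite iA. Qed.

Lemma cov_mono W A A' : A \subset A' -> cov W A -> cov W A'.
Proof.
move=> h /forallP c; apply/forallP => j; apply/implyP => jW.
by apply: near_mono h _; have := c j; rewrite jW.
Qed.

Lemma indep_sub A A' : A \subset A' -> indep A' -> indep A.
Proof.
move/subsetP=> h /forallP c; apply/forallP => i; apply/forallP => j.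
by apply: contra (forallP (c i) j) => /and3P[-> /h-> /h->].
Qed.

Variant toggle_spec W A : nat * option V -> Prop :=
| Toggle0 p of isP W p & lowP A p : toggle_spec W A (0, Some (xv p))
| Toggle1 q of isQ W q & lowQ A q & (forall p, isP W p -> ~~ lowP A p) :
    toggle_spec W A (1, Some (xv q))
| ToggleY j of yv j \in W & ~~ near A j & (forall p, isP W p -> ~~ lowP A p)
    & (forall q, isQ W q -> ~~ lowQ A q) & [pick j | (yv j \in W) && ~~ near A j] = Some j :
    toggle_spec W A (5 + #|[set i | xv i \in W :\: A]|, Some (yv j))
| Toggle2 q of q_free W A q & (forall p, isP W p -> ~~ lowP A p)
    & (forall q, isQ W q -> ~~ lowQ A q) & cov W A : toggle_spec W A (2, Some (xv q))
| Toggle3 p of p_free W A p & (forall q, ~~ q_free W A q) & (forall p, isP W p -> ~~ lowP A p)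
    & (forall q, isQ W q -> ~~ lowQ A q) & cov W A : toggle_spec W A (3, Some (xv p))
| Toggle4 of (forall p, ~~ p_free W A p) & (forall q, ~~ q_free W A q)
    & (forall p, isP W p -> ~~ lowP A p)
    & (forall q, isQ W q -> ~~ lowQ A q) & cov W A : toggle_spec W A (4, None).

Lemma toggleP W A : toggle_spec W A (toggle W A).
Proof.
rewrite /toggle; case: pickP => [p /andP[]|noP]; first exact: Toggle0.
have hP p : isP W p -> ~~ lowP A p by move=> h; have := noP p; rewrite h /= => ->.
case: pickP => [q /andP[a b]|noQ]; first exact: Toggle1.
have hQ q : isQ W q -> ~~ lowQ A q by move=> h; have := noQ q; rewrite h /= => ->.
case ej: [pick j | _] => [j|].
  by move: (ej); case: pickP => // j' /andP[a b] [h]; rewrite h in a b; apply: ToggleY.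
have c : cov W A.
  move: ej; case: pickP => // noY _; apply/forallP => j; apply/implyP => jW.
  by have := noY j; rewrite jW /= => /negbFE.
case: pickP => [q h|no2]; first exact: Toggle2.
have n2 q : ~~ q_free W A q by rewrite no2.
case: pickP => [p h|no3]; first exact: Toggle3.
by apply: Toggle4 => // p; rewrite no3.
Qed.

Lemma toggle0 W A p : isP W p -> lowP A p -> toggle W A = (0, Some (xv p)).
Proof.
by move=> hp hl; case: toggleP => [p' /(isP_uniq hp) <-|q _ _|j _ _|q _|p' _ _|_ _] //
  => /(_ p hp); rewrite hl.
Qed.

Lemma toggle1 W A q : isQ W q -> lowQ A q -> (forall p, isP W p -> ~~ lowP A p) ->
  toggle W A = (1, Some (xv q)).
Proof.
move=> hq hl hp; case: toggleP => [p /hp/negbTE->|q' /(isQ_uniq hq) <-|j _ _ _|q' _ _|p' _ _ _|_ _ _] //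
  => /(_ q hq); rewrite hl //.
Qed.

Lemma toggle_mem W A v : (toggle W A).2 = Some v -> v \in W.
Proof.
case: toggleP => [p h _|q h _ _|j h _ _ _ _|q /andP[h _] _ _ _|p /and3P[h _ _] _ _ _ _|_ _ _ _ _] //= [<-] //;
by case/and3P: h.
Qed.

Lemma indep_cov W A : A \subset W -> indep A -> cov W A -> forall j, yv j \notin A.
Proof.
move=> /subsetP AW /forallP ia /forallP c j; apply/negP => jA.
have := c j; rewrite (AW _ jA) /= => /existsP[i /andP[iA a]].
by have /forallP/(_ j) := ia i; rewrite a iA jA.
Qed.

Lemma indep_noY A : (forall j, yv j \notin A) -> indep A.
Proof. by move=> h; apply/forallP => i; apply/forallP => j; rewrite (negbTE (h j)) !andbF. Qed.

Lemma toggle2 W A q : q_free W A q -> (forall p, isP W p -> ~~ lowP A p) ->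
  (forall q, isQ W q -> ~~ lowQ A q) -> toggle W A = (2, Some (xv q)).
Proof.
move=> hq hP hQ; have c : cov W A by case/andP: hq => _; apply: cov_mono (subsetDl _ _).
case: toggleP => [p /hP/negbTE->|q' /hQ/negbTE->|j jW nj _ _ _|q' hq' _ _ _|p' _ /(_ q)|_ /(_ q)] //.
- by have /forallP/(_ j) := c; rewrite jW (negbTE nj).
- by case/andP: hq => h _; case/andP: hq' => h' _; rewrite (isQ_uniq h h').
- by rewrite hq.
by rewrite hq.
Qed.

Lemma toggle3 W A p : p_free W A p -> (forall q, ~~ q_free W A q) ->
  (forall p, isP W p -> ~~ lowP A p) ->
  (forall q, isQ W q -> ~~ lowQ A q) -> toggle W A = (3, Some (xv p)).
Proof.
move=> hp nq hP hQ; have c : cov W A by case/and3P: hp => _ + _; apply: cov_mono (subsetDl _ _).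
case: toggleP => [p' /hP/negbTE->|q' /hQ/negbTE->|j jW nj _ _ _|q' hq'|p' hp' _ _ _ _|/(_ p)] //.
- by have /forallP/(_ j) := c; rewrite jW (negbTE nj).
- by rewrite (negbTE (nq q')) in hq'.
- by case/and3P: hp => h _ _; case/and3P: hp' => h' _ _; rewrite (isP_uniq h h').
by rewrite hp.
Qed.

Lemma eq_lowP A A' p : (forall i, i < s -> i < p -> (xv i \in A) = (xv i \in A')) ->
  lowP A p = lowP A' p.
Proof.
move=> h; apply: eq_existsb => i; case is_: (i < s); rewrite ?andbF //=.
by case ip: (i < p); rewrite ?andbF //= h.
Qed.

Lemma eq_lowQ A A' q : (forall i, s <= i -> i < q -> (xv i \in A) = (xv i \in A')) ->
  lowQ A q = lowQ A' q.
Proof.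
move=> h; apply: eq_existsb => i; case is_: (s <= i); rewrite ?andbF //=.
by case ip: (i < q); rewrite ?andbF //= h.
Qed.

(** The rule reads only the [x]'s of [A], hence toggling a [y] cannot change the rule that
    applies. *)
Lemma toggle_ext W A A' : (forall i, (xv i \in A) = (xv i \in A')) -> toggle W A = toggle W A'.
Proof.
move=> h.
have hP p : lowP A p = lowP A' p by apply: eq_lowP.
have hQ p : lowQ A p = lowQ A' p by apply: eq_lowQ.
have nE (B B' : {set V}) (hB : forall i, (xv i \in B) = (xv i \in B')) j : near B j = near B' j.
  by apply: eq_existsb => i; rewrite hB.
have cE (B B' : {set V}) (hB : forall i, (xv i \in B) = (xv i \in B')) : cov W B = cov W B'.
  by apply: eq_forallb => j; rewrite (nE _ _ hB).
have qE (B B' : {set V}) (hB : forall i, (xv i \in B) = (xv i \in B')) q : q_free W B q = q_free W B' q.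
  by rewrite /q_free (cE _ (B' :\ xv q)) // => i; rewrite !inE hB.
have pE p : p_free W A p = p_free W A' p.
  rewrite /p_free (cE _ (A' :\ xv p)) => [|i]; last by rewrite !inE h.
  congr [&& _, _ & ~~ _]; apply: eq_existsb => q; apply: qE => i; by rewrite !inE h.
have e1 : [pick p | isP W p && lowP A p] = [pick p | isP W p && lowP A' p].
  by apply: eq_pick => p; rewrite hP.
have e2 : [pick q | isQ W q && lowQ A q] = [pick q | isQ W q && lowQ A' q].
  by apply: eq_pick => p; rewrite hQ.
have e3 : [pick j | (yv j \in W) && ~~ near A j] = [pick j | (yv j \in W) && ~~ near A' j].
  by apply: eq_pick => p; rewrite (nE _ A').
rewrite /toggle e1 e2 e3 (eq_pick (qE _ _ h)) (eq_pick pE).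
suff -> : [set i | xv i \in W :\: A] = [set i | xv i \in W :\: A'] by [].
by apply/setP => i; rewrite !inE h.
Qed.

(** This makes toggling an involution on independent sets. Each rule that fires is insensitive to
    its own element, and toggling that element does not make an earlier rule applicable. *)
Lemma toggle_inv W A A' v : A \subset W -> A' \subset W -> indep A ->
  (toggle W A).2 = Some v -> A' :\ v = A :\ v -> indep A' /\ toggle W A' = toggle W A.
Proof.
move=> AW AW' iA tA /setP e'.
have e u : u != v -> (u \in A') = (u \in A) by move=> uv; have := e' u; rewrite !inE uv.
have iE i j : cadj i j -> xv i \in A -> yv j \in A -> False.
  by move=> a b c; have /forallP/(_ i)/forallP/(_ j) := iA; rewrite a b c.
have xe i p : v = xv p -> i != p -> (xv i \in A') = (xv i \in A).
  by move=> vp ne; apply: e; rewrite vp xyE.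
move: tA (toggleP W A); move E: (toggle W A) => t tA ht.
case: ht tA E => [p hp hl|q hq hl nP|j jW nj nP nQ _|q hq nP nQ c|p hp nq nP nQ c|_ _ _ _ _];
  last by move=> /= tA; discriminate tA.
all: move=> [ve] E.
- have ye j : (yv j \in A') = (yv j \in A) by apply: e; rewrite -ve xyE.
  have hl' : lowP A' p.
    rewrite (@eq_lowP _ A) // => i _ ip; apply: (xe _ p) => //.
    by rewrite -val_eqE neq_ltn ip.
  split; last by rewrite (toggle0 hp hl').
  apply/forallP => i; apply/forallP => j; apply/negP => /and3P[a xi yj]; rewrite ye in yj.
  have [ip|ip] := eqVneq i p; last by apply: (iE i j) => //; rewrite -(xe _ p).
  case/existsP: hl => l /and3P[lA ls lp]; apply: (iE l j) => //.
  by move: a; rewrite ip /cadj /=; case/and3P: hp => _ ps _; lia.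
- have ye j : (yv j \in A') = (yv j \in A) by apply: e; rewrite -ve xyE.
  have hl' : lowQ A' q.
    rewrite (@eq_lowQ _ A) // => i _ ip; apply: (xe _ q) => //.
    by rewrite -val_eqE neq_ltn ip.
  case/and3P: (hq) => _ qs _; split.
    apply/forallP => i; apply/forallP => j; apply/negP => /and3P[a xi yj]; rewrite ye in yj.
    have [ip|ip] := eqVneq i q; last by apply: (iE i j) => //; rewrite -(xe _ q).
    case/existsP: hl => l /and3P[lA ls lp]; apply: (iE l j) => //.
    by move: a; rewrite ip /cadj /=; lia.
  rewrite (toggle1 hq hl') // => p /nP; rewrite (@eq_lowP A' A) // => i is_ _.
  by apply: (xe _ q) => //; rewrite -val_eqE neq_ltn (leq_trans is_ qs).
- have xe' i : (xv i \in A') = (xv i \in A) by apply: e; rewrite -ve xyE.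
  split; last by rewrite (toggle_ext _ xe').
  apply/forallP => i; apply/forallP => l; apply/negP => /and3P[a xi yj]; rewrite xe' in xi.
  have [lj|lj] := eqVneq l j; last by apply: (iE i l) => //; rewrite -e // -ve xyE.
  by case/existsP: nj; exists i; rewrite xi -lj.
- have eD : A' :\ xv q = A :\ xv q by apply/setP => u; rewrite ve e'.
  have hq' : q_free W A' q by rewrite /q_free eD.
  have c' : cov W A' by case/andP: hq' => _; apply: cov_mono (subsetDl _ _).
  case/andP: (hq) => /and3P[_ qs _] _.
  split.
    apply: indep_noY => l; rewrite e ?(indep_cov AW iA c) //.
    by rewrite -ve xyE.
  rewrite (toggle2 hq') // => [p /nP|q' hq''].
    rewrite (@eq_lowP A' A) // => i is_ _.
    by apply: (xe _ q) => //; rewrite -val_eqE neq_ltn (leq_trans is_ qs).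
  have := nQ _ hq''; rewrite (@eq_lowQ A' A) // => i is_ iq.
  apply: (xe _ q) => //; case/andP: hq => hq _.
  by rewrite (isQ_uniq hq hq'') -val_eqE neq_ltn iq.
have eD : A' :\ xv p = A :\ xv p by apply/setP => u; rewrite ve e'.
have eU : xv p |: A' = xv p |: A.
  by apply/setP => u; rewrite !inE; case: eqP => //= /eqP un; apply: e; rewrite -ve.
have hp' : p_free W A' p by rewrite /p_free eD eU.
have c' : cov W A' by case/and3P: hp' => _ + _; apply: cov_mono (subsetDl _ _).
case/and3P: (hp) => isp _ nqf; case/and3P: (isp) => _ ps _.
split.
  apply: indep_noY => l; rewrite e ?(indep_cov AW iA c) //.
  by rewrite -ve xyE.
rewrite (toggle3 hp') // => [q|p' hp''|q' /nQ].
- apply: contra nqf => /andP[a b]; apply/existsP; exists q; rewrite /q_free a /=.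
  by rewrite -eU; apply: cov_mono b; apply/setSD/subsetUr.
- have := nP _ hp''; rewrite (@eq_lowP A' A) // => i is_ iq.
  by apply: (xe _ p) => //; rewrite (isP_uniq isp hp'') -val_eqE neq_ltn iq.
rewrite (@eq_lowQ A' A) // => i is_ _.
by apply: (xe _ p) => //; rewrite -val_eqE neq_ltn (leq_trans ps is_) orbT.
Qed.

(** The source of acyclicity: within one squarefree degree the differential moves a variable [w] of
    the wedge into [A]. *)
Lemma toggle_mono W A w : A \subset W -> w \in W -> indep (w |: A) ->
  (toggle W (w |: A)).1 <= (toggle W A).1 /\
  ((toggle W (w |: A)).1 = (toggle W A).1 -> (toggle W (w |: A)).2 = (toggle W A).2).
Proof.
move=> AW wW iA'; have [wA|wA] := boolP (w \in A); first by have -> : w |: A = A by apply/setUidPr; rewrite sub1set.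
set A' := w |: A; have sA : A \subset A' by apply: subsetUr.
have AW' : A' \subset W by rewrite subUset sub1set wW.
have mP p : lowP A p -> lowP A' p.
  by case/existsP => i /and3P[a b c]; apply/existsP; exists i; rewrite b c (subsetP sA).
have mQ p : lowQ A p -> lowQ A' p.
  by case/existsP => i /and3P[a b c]; apply/existsP; exists i; rewrite b c (subsetP sA).
have mq q : q_free W A q -> q_free W A' q.
  by case/andP => a b; rewrite /q_free a /=; apply: cov_mono b; apply: setSD.
have := toggleP W A; move E: (toggle W A) => t ht.
case: ht E => [p hp /mP hl|q hq /mQ hl nP|j jW nj nP nQ _|q hq nP nQ c|p hp nq nP nQ c|np nq nP nQ c] E.
- by rewrite (toggle0 hp hl).
- case: toggleP => [||j _ _ _ /(_ q hq)|q' _ _ /(_ q hq)|p' _ _ _ /(_ q hq)|_ _ _ /(_ q hq)];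
    rewrite ?hl // => q' /(isQ_uniq hq) -> //.
(* A new [x] may block the chosen [y_j] and change the choice; the class therefore also counts the
   [x]'s of [W] outside [A], which strictly drops. A new [y] changes nothing. *)
- case: (varP w) => [[i wi]|[i wi]]; last first.
    by rewrite (@toggle_ext W A' A) ?E // => l; rewrite !inE wi xyE.
  have lt : #|[set l | xv l \in W :\: A']| < #|[set l | xv l \in W :\: A]|.
    apply: proper_card; apply/properP; split.
      by apply/subsetP => l; rewrite !inE negb_or -andbA => /and3P[_ -> ->].
    by exists i; rewrite !inE -wi ?eqxx ?wA ?wW.
  by case: toggleP => *; split => //=; [by rewrite ltnW // ltn_add2l | move=> /addnI e; rewrite e ltnn in lt].
- have c' := cov_mono sA c.
  case: toggleP => [||j jW nj _ _ _|q' hq'|p' _ /(_ q)|_ /(_ q)]; rewrite ?mq //.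
    by have /forallP/(_ j) := c'; rewrite jW (negbTE nj).
  by case/andP: hq => hq _; case/andP: hq' => hq' _; rewrite (isQ_uniq hq hq').
- have c' := cov_mono sA c.
  case: toggleP => [||j jW nj _ _ _||p' hp'|np' nq' nP' nQ' _] //.
  + by have /forallP/(_ j) := c'; rewrite jW (negbTE nj).
  + by case/and3P: hp => hp _ _; case/and3P: hp' => hp' _ _; rewrite (isP_uniq hp hp').
  (* Excluding a rise from class 3 to class 4: [p_free] could only be lost through a new [q_free].
     But [w] must be [x_p] or [x_q], since earlier [x]'s would trigger a low rule, and neither
     alters [(xv p |: A) :\ xv q]. *)
  case/and3P: hp => isp cp nqf; have := np' p; rewrite /p_free isp /=.
  rewrite (cov_mono _ cp) ?setSD //= negbK => /existsP[q /andP[isq cq]].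
  case/negP: nqf; apply/existsP; exists q; rewrite /q_free isq /=.
  case: (varP w) => [[i wi]|[i wi]]; last first.
    by have := indep_cov AW' iA' c' i; rewrite !inE wi eqxx.
  have iW : xv i \in W by rewrite -wi.
  have iA : xv i \in A' by rewrite !inE wi eqxx.
  have [is_|is_] := ltnP i s.
    have [p0 isp0 le] := isP_ex iW is_; rewrite (isP_uniq isp0 isp) in le.
    have ip : i = p.
      apply/val_inj/eqP; rewrite eqn_leq le /= leqNgt.
      by apply: contra (nP' p isp) => lt; apply/existsP; exists i; rewrite iA is_.
    by rewrite (_ : xv p |: A = xv p |: A') // /A' wi ip setUA setUid.
  have [q0 isq0 le] := isQ_ex iW is_; rewrite (isQ_uniq isq0 isq) in le.
  have iq : i = q.
    apply/val_inj/eqP; rewrite eqn_leq le /= leqNgt.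
    by apply: contra (nQ' q isq) => lt; apply/existsP; exists i; rewrite iA is_.
  move: cq; congr (cov _ _); apply/setP => u; rewrite !inE wi iq.
  by case: eqP.
have c' := cov_mono sA c.
case: toggleP => [||j jW nj _ _ _||p' hp'|np' nq' nP' nQ' _] //.
by have /forallP/(_ j) := c'; rewrite jW (negbTE nj).
Qed.

End Matching.

(** * The unmatched sets and the sizes of their degrees *)

Section Critical.
Variables (n s R : nat).
Local Notation V := 'I_(n + n).
Implicit Types (W A : {set V}) (i j p q : 'I_n) (v w : V).

Lemma cadjE i j : cadj s R i j = (i < j) && ((s <= i) || (j <= R)).
Proof. by []. Qed.

(** In [CritQ] some [x_p] may lie in [W] but not in [A]. It is not toggled because adding it would
    make [x_q] free, which means that [x_p] alone covers. *)
Variant crit_spec W A : Prop :=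
| Crit0 of A = set0 & W = set0
| CritP p of isP s W p & A = [set xv p] & (forall i, xv i \in W -> i < s)
| CritQ q of isQ s W q & A = [set xv q] & (forall p, isP s W p -> cov s R W [set xv p])
    & ~~ cov s R W set0
| CritPQ p q of isP s W p & isQ s W q & A = [set xv p; xv q] &
    ~~ cov s R W [set xv p] & ~~ cov s R W [set xv q].

(** With both low rules inapplicable, [A] contains at most the last [x] of each range, and covering
    excludes the [y]'s. The cases then record why neither of these two can be toggled. *)
Lemma critP W A : A \subset W -> indep s R A -> (toggle s R W A).2 = None ->
  crit_spec W A /\ cov s R W A.
Proof.
move=> AW iA; case: toggleP => //= np nq nP nQ c _; split=> //.
have noY := indep_cov AW iA c.
have AP i : xv i \in A -> i < s -> isP s W i.
  move=> iA' is_; have [p hp le] := isP_ex (subsetP AW _ iA') is_.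
  suff -> : i = p by [].
  apply/val_inj/eqP; rewrite eqn_leq le /= leqNgt.
  by apply: contra (nP p hp) => lt; apply/existsP; exists i; rewrite iA' is_.
have AQ i : xv i \in A -> s <= i -> isQ s W i.
  move=> iA' is_; have [p hp le] := isQ_ex (subsetP AW _ iA') is_.
  suff -> : i = p by [].
  apply/val_inj/eqP; rewrite eqn_leq le /= leqNgt.
  by apply: contra (nQ p hp) => lt; apply/existsP; exists i; rewrite iA' is_.
have memA v : v \in A -> exists2 i, v = xv i & isP s W i || isQ s W i.
  case: (varP v) => [] [i ->]; last by rewrite (negbTE (noY i)).
  by move=> h; exists i => //; case: (ltnP i s) => g; [rewrite AP | rewrite orbC AQ].
have nPQ i : isP s W i -> isQ s W i -> False.
  by case/and3P=> _ a _ /and3P[_ b _]; move: a; rewrite ltnNge b.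
case: (pickP (fun p => isP s W p && (xv p \in A))) => [p /andP[hp pA]|noP];
  case: (pickP (fun q => isQ s W q && (xv q \in A))) => [q /andP[hq qA]|noQ].
- have eA : A = [set xv p; xv q].
    apply/setP => v; rewrite !inE; apply/idP/orP => [/memA[i -> /orP[h|h]]|[/eqP->|/eqP->]] //.
      by rewrite (isP_uniq h hp) eqxx; left.
    by rewrite (isQ_uniq h hq) eqxx; right.
  have pq : (p == q) = false by apply/eqP => e; apply: (nPQ q) => //; rewrite -e.
  have e1 : A :\ xv q = [set xv p].
    apply/setP => v; rewrite eA !inE; case: eqP => [->|] /=; last by rewrite orbF.
    by rewrite xyE eq_sym pq.
  have e2 : A :\ xv p = [set xv q].
    by apply/setP => v; rewrite eA !inE; case: eqP => [->|] //=; rewrite xyE pq.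
  have ncp : ~~ cov s R W [set xv p] by have := nq q; rewrite /q_free hq e1.
  apply: (CritPQ hp hq) => //.
  apply: contra (np p) => cq; rewrite /p_free hp e2 cq /=; apply/existsPn => q'.
  apply/negP => /andP[hq']; rewrite (isQ_uniq hq' hq).
  by rewrite (setUidPr _) ?sub1set // e1 (negbTE ncp).
- have eA : A = [set xv p].
    apply/setP => v; rewrite !inE; apply/idP/eqP => [hv|->] //.
    have [i ei /orP[h|h]] := memA v hv; first by rewrite ei (isP_uniq h hp).
    by have := noQ i; rewrite h -ei hv.
  apply: (CritP hp) => // i iW; rewrite ltnNge; apply/negP => si.
  have [q hq _] := isQ_ex iW si.
  have qA : xv q \notin A by have := noQ q; rewrite hq /= => ->.
  have := nq q; rewrite /q_free hq /= (_ : A :\ xv q = A) ?c //.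
  by apply/setP => v; rewrite !inE; case: eqP => //= ->; rewrite (negbTE qA).
- have eA : A = [set xv q].
    apply/setP => v; rewrite !inE; apply/idP/eqP => [hv|->] //.
    have [i ei /orP[h|h]] := memA v hv; last by rewrite ei (isQ_uniq h hq).
    by have := noP i; rewrite h -ei hv.
  have e0 : A :\ xv q = set0 by rewrite eA setDv.
  have nc0 : ~~ cov s R W set0 by have := nq q; rewrite /q_free hq e0.
  apply: (CritQ hq) => // p hp.
  have pA : xv p \notin A by have := noP p; rewrite hp /= => ->.
  have := np p; rewrite /p_free hp (_ : A :\ xv p = A) ?c /=; last first.
    by apply/setP => v; rewrite !inE; case: eqP => //= ->; rewrite (negbTE pA).
  rewrite negbK => /existsP[q' /andP[hq']]; rewrite (isQ_uniq hq' hq).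
  congr (cov _ _ _ _); apply/setP => v; rewrite eA !inE.
  case: eqP => [->|] /=; last by rewrite orbF.
  by rewrite xyE; apply/esym/negbTE; apply: contraNneq pA => <-.
have eA : A = set0.
  apply/setP => v; rewrite inE; apply/negP => hv.
  have [i ei /orP[h|h]] := memA v hv; first by have := noP i; rewrite h -ei hv.
  by have := noQ i; rewrite h -ei hv.
have noq q : ~~ isQ s W q.
  by apply/negP => hq; have := nq q; rewrite /q_free hq /= eA set0D -eA c.
have nop p : ~~ isP s W p.
  apply/negP => hp; have := np p; rewrite /p_free hp eA set0D -eA c /= negbK.
  by case/existsP => q /andP[h]; rewrite (negbTE (noq q)) in h.
apply: Crit0 => //; apply/setP => v; rewrite inE; apply/negP => vW.
case: (varP v) vW => [] [i ->] iW.
  case: (ltnP i s) => g; first by have [p hp] := isP_ex iW g; rewrite (negbTE (nop p)) in hp.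
  by have [p hp] := isQ_ex iW g; rewrite (negbTE (noq p)) in hp.
by have /forallP/(_ i) := c; rewrite iW /= eA => /existsP[l]; rewrite inE.
Qed.

Lemma card_itv a b : b <= n -> #|[set i : 'I_n | a <= i < b]| = b - a.
Proof.
move=> bn; rewrite -sum1_card big_mkcond /=.
under eq_bigr do rewrite inE.
rewrite -(big_mkord predT (fun l => if a <= l < b then 1 else 0)) -big_mkcond /=.
rewrite (big_cat_nat _ (n := b)) //= [X in _ + X]big_nat_cond [X in _ + X]big_pred0 => [|i]; last lia.
rewrite addn0; have [ab|ba] := leqP a b; last first.
  rewrite big_nat_cond big_pred0 => [|i]; lia.
rewrite (big_cat_nat _ (n := a)) //= big_nat_cond big_pred0 => [|i]; last lia.
rewrite big_nat_cond (eq_bigl (fun l => a <= l < b)) => [|i]; last lia.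
by rewrite -big_nat sum_nat_const_nat muln1.
Qed.

Lemma card_xy W : #|W| = #|[set i | xv i \in W]| + #|[set i | yv i \in W]|.
Proof.
rewrite -!sum1_card big_mkcond /= sum_xy.
by congr (_ + _); rewrite [RHS]big_mkcond; apply: eq_bigr => i _; rewrite inE.
Qed.

Hypotheses (s_le : s <= R) (R_lt : R < n).

(** The largest [W] whose last [x]'s are [x_p] and [x_q] and which these two cover ([crit_sub]). *)
Definition critW p q : {set V} :=
  [set xv i | i : 'I_n & (i <= p) || (s <= i <= q)] :|:
  [set yv j | j : 'I_n & (p < j <= R) || (maxn q R < j)].

Lemma critWx p q i : (xv i \in critW p q) = (i <= p) || (s <= i <= q).
Proof.
rewrite inE orbC; case: imsetP => [[j _ /eqP]|_] /=; first by rewrite xyE.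
apply/imsetP/idP => [[j]|h]; last by exists i; rewrite ?inE.
by rewrite inE => h /eqP; rewrite xyE => /eqP->.
Qed.

Lemma critWy p q j : (yv j \in critW p q) = (p < j <= R) || (maxn q R < j).
Proof.
rewrite inE; case: imsetP => [[i _ /eqP]|_] /=; first by rewrite xyE.
apply/imsetP/idP => [[i]|h]; last by exists j; rewrite ?inE.
by rewrite inE => h /eqP; rewrite xyE => /eqP->.
Qed.

(** Stated additively to avoid truncated subtraction: the size is [R + n + 1 - s] for [q >= R] and
    smaller for [q < R]. *)
Lemma card_critW p q : p < s -> s <= q -> #|critW p q| + maxn q R = R + n + 1 - s + q.
Proof.
move=> ps sq; rewrite card_xy.
have -> : [set i | xv i \in critW p q] = [set i : 'I_n | 0 <= i < p.+1] :|: [set i : 'I_n | s <= i < q.+1].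
  by apply/setP => i; rewrite [LHS]inE critWx !inE.
have -> : [set i | yv i \in critW p q] =
    [set i : 'I_n | p.+1 <= i < R.+1] :|: [set i : 'I_n | (maxn q R).+1 <= i < n].
  by apply/setP => i; rewrite [LHS]inE critWy !inE ltn_ord andbT.
have dis a b c d : b <= c -> [set i : 'I_n | a <= i < b] :&: [set i : 'I_n | c <= i < d] = set0.
  by move=> bc; apply/setP => i; rewrite !inE; lia.
have pn := ltn_ord p; have qn := ltn_ord q.
rewrite !cardsU !dis ?cards0 ?subn0 ?card_itv //; lia.
Qed.

Lemma crit_sub W A p q : isP s W p -> isQ s W q -> A = [set xv p; xv q] -> cov s R W A ->
  W \subset critW p q.
Proof.
case/and3P => pW ps /forallP mp /and3P[qW sq /forallP mq] -> /forallP c.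
apply/subsetP => v; case: (varP v) => [] [i ->] iW.
  rewrite critWx; have := mp i; have := mq i; rewrite iW /=.
  by case: (ltnP i s) => g /=; [move=> _ -> | move=> -> _; rewrite orbT].
rewrite critWy; have := c i; rewrite iW /= => /existsP[l /andP[]].
by rewrite !inE !xyE => /orP[] /eqP ->; rewrite cadjE; lia.
Qed.

(** For a single variable in [A] the degree has at most [R + 1] or [n - s] elements, according to
    the case; both are below [R + n - s] once [0 < s] and [R.+1 < n]. For two variables, equality in
    the bound requires [q >= R] and [W = critW p q]. *)
Lemma crit_card W A : A \subset W -> indep s R A -> (toggle s R W A).2 = None ->
  [\/ A = set0 /\ W = set0,
      #|A| = 1 /\ (0 < s -> R.+1 < n -> #|W| < R + n - s),
      (0 < s /\ #|A| = 2) /\ #|W| < R + n + 1 - s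
    | exists p q, [/\ p < s, R <= q, q.+1 < n, A = [set xv p; xv q] & W = critW p q]].
Proof.
move=> AW iA tA; have [[-> ->|p hp eA hW|q hq eA hW nc0|p q hp hq eA ncp ncq] c] := critP AW iA tA.
- by constructor 1.
- constructor 2; rewrite eA cards1; split=> // s0 Rn.
  case/and3P: hp => pW ps /forallP mp.
  have le : #|W| <= #|[set i : 'I_n | 0 <= i < p.+1]| + #|[set i : 'I_n | p.+1 <= i < R.+1]|.
    rewrite card_xy leq_add // subset_leq_card //; apply/subsetP => i; rewrite !inE => iW.
      by have := mp i; rewrite iW (hW i iW).
    have /forallP/(_ i) := c; rewrite iW eA /= => /existsP[l /andP[]].
    by rewrite !inE !xyE => /eqP ->; rewrite cadjE; lia.
  by move: le; rewrite !card_itv //; lia.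
- constructor 2; rewrite eA cards1; split=> // s0 Rn.
  case/and3P: hq => qW sq /forallP mq.
  have qn := ltn_ord q.
  have [p hp|nop] := pickP (isP s W); last first.
    have le : #|W| <= #|[set i : 'I_n | s <= i < q.+1]| + #|[set i : 'I_n | q.+1 <= i < n]|.
      rewrite card_xy leq_add // subset_leq_card //; apply/subsetP => i; rewrite !inE => iW.
        case: (ltnP i s) => g; first by have [p] := isP_ex iW g; rewrite nop.
        by have := mq i; rewrite iW g.
      have /forallP/(_ i) := c; rewrite iW eA /= => /existsP[l /andP[]].
      by rewrite !inE !xyE => /eqP ->; rewrite cadjE ltn_ord andbT => /andP[].
    by move: le; rewrite !card_itv //; lia.
  have Y i : yv i \in W -> q < i <= R.
    move=> iW; have /forallP/(_ i) := c; have /forallP/(_ i) := hW p hp.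
    rewrite iW eA /= => /existsP[l /andP[]]; rewrite !inE !xyE => /eqP -> + /existsP[l' /andP[]].
    rewrite !inE !xyE => + /eqP ->; rewrite !cadjE; case/and3P: hp => _ ps _; lia.
  have [y yW] : exists y, yv y \in W.
    by case/forallPn: nc0 => y; rewrite negb_imply => /andP[yW _]; exists y.
  have qR : q < R by have := Y y yW; lia.
  have le : #|W| <= #|[set i : 'I_n | 0 <= i < q.+1]| + #|[set i : 'I_n | q.+1 <= i < R.+1]|.
    rewrite card_xy leq_add // subset_leq_card //; apply/subsetP => i; rewrite !inE => iW.
      case: (ltnP i s) => g; first by lia.
      by have := mq i; rewrite iW g.
    exact: Y.
  by move: le; rewrite !card_itv //; lia.
have sub := crit_sub hp hq eA c.
case/and3P: (hp) => pW ps _; case/and3P: (hq) => qW sq _.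
have pq : p != q by rewrite -val_eqE neq_ltn (leq_trans ps sq).
have cA : #|A| = 2 by rewrite eA cards2 xyE pq.
have cW := card_critW ps sq; have le := subset_leq_card sub; have qn := ltn_ord q.
have s_gt0 : 0 < s := leq_ltn_trans (leq0n p) ps.
have [qR|Rq] := ltnP q R.
  by constructor 3; split=> //; move: cW le qR ps sq s_le; clear; lia.
have [lt|ge] := ltnP #|W| #|critW p q|.
  by constructor 3; split=> //; move: cW lt Rq ps sq s_le; clear; lia.
constructor 4; exists p, q; split=> //; last by apply/eqP; rewrite eqEcard sub ge.
(* A [y] not covered by [x_p] is covered by [x_q], so [q] is not the last vertex. *)
case/forallPn: ncp => y; rewrite negb_imply => /andP[yW ny].
have /forallP/(_ y) := c; rewrite yW eA /= => /existsP[l /andP[]].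
rewrite !inE !xyE => /orP[] /eqP -> a; last by have := ltn_ord y; move: a; rewrite cadjE; clear; lia.
by case/existsP: ny; exists p; rewrite !inE eqxx.
Qed.

(** Both variables are indispensable: of the two, only [x_p] blocks [y] at [R], because [q >= R],
    and only [x_q] blocks [y] at [n.-1], because [p < s] and [R < n.-1]. *)
Lemma toggle_crit p q : p < s -> R <= q -> q.+1 < n ->
  indep s R [set xv p; xv q] /\ (toggle s R (critW p q) [set xv p; xv q]).2 = None.
Proof.
move=> ps Rq qn.
have sq : s <= q by apply: leq_trans Rq.
have hp : isP s (critW p q) p.
  rewrite /isP critWx leqnn ps /=; apply/forallP => i; rewrite critWx; lia.
have hq : isQ s (critW p q) q.
  rewrite /isQ critWx leqnn sq orbT /=; apply/forallP => i; rewrite critWx; lia.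
have n1 : n.-1 < n by lia.
have yn : yv (Ordinal n1) \in critW p q by rewrite critWy /=; lia.
have yR : yv (Ordinal R_lt) \in critW p q by rewrite critWy /=; lia.
have ncp : ~~ cov s R (critW p q) [set xv p].
  apply/negP => /forallP/(_ (Ordinal n1)); rewrite yn => /existsP[l].
  by rewrite !inE !xyE => /andP[/eqP->]; rewrite cadjE /=; lia.
have ncq : ~~ cov s R (critW p q) [set xv q].
  apply/negP => /forallP/(_ (Ordinal R_lt)); rewrite yR => /existsP[l].
  by rewrite !inE !xyE => /andP[/eqP->]; rewrite cadjE /=; lia.
have pq : (p == q) = false by apply/negbTE; rewrite -val_eqE neq_ltn (leq_trans ps sq).
split; first by apply: indep_noY => j; rewrite !inE !xyE.
case: toggleP => [p0 h0|q0 h0 + _|j jW nj _ _ _|q0 /andP[h0 cq] _ _ _|p0 /and3P[h0 cp _] _ _ _ _|] //=.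
- by rewrite (isP_uniq h0 hp) => /existsP[i]; rewrite !inE !xyE -!val_eqE /=; lia.
- by rewrite (isQ_uniq h0 hq) => /existsP[i]; rewrite !inE !xyE -!val_eqE /=; lia.
- case/existsP: nj; move: jW; rewrite critWy => h.
  have [jR|Rj] := leqP j R; first by exists p; rewrite !inE !xyE eqxx cadjE; lia.
  by exists q; rewrite !inE !xyE eqxx orbT cadjE; lia.
- rewrite (isQ_uniq h0 hq) in cq; case/negP: ncp; apply: cov_mono cq.
  by apply/subsetP => v; rewrite !inE => /andP[/negbTE->]; rewrite orbF.
rewrite (isP_uniq h0 hp) in cp; case/negP: ncq; apply: cov_mono cp.
by apply/subsetP => v; rewrite !inE => /andP[/negbTE->].
Qed.

End Critical.

(** * Closed graphs *)

Section ClosedGraph.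
Variables (n : nat) (e : rel 'I_n).
Hypotheses (e_sym : symmetric e) (e_irr : irreflexive e).

Definition mono_edge (lt : rel 'I_n) : rel 'I_n := [rel a b | e a b && lt a b].

(** Closedness removes peaks: if the walk climbs to [x] and then descends to [v], both neighbours of
    [x] lie below it, so they are equal or adjacent and [x] can be skipped. The order is abstract so
    that valleys are covered as well. *)
Lemma mono_walk (lt : rel 'I_n) i p v :
  (forall a b, a != b -> lt a b || lt b a) ->
  (forall x a b, a != b -> e x a -> e x b -> lt a x -> lt b x -> e a b) ->
  path (mono_edge lt) i p -> e (last i p) v ->
  connect (mono_edge lt) i v || connect (mono_edge (fun a b => lt b a)) i v.
Proof.
move=> tot cl; have neq a b : e a b -> a != b by apply: contraTneq => ->; rewrite e_irr.
elim/last_ind: p v => [|p x IH] v /=.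
  move=> _ ev; case/orP: (tot _ _ (neq _ _ ev)) => h; apply/orP; [left | right];
    by apply: connect1; rewrite /mono_edge /= ev h.
rewrite rcons_path last_rcons => /andP[pp /andP[ex lx]] ev.
have cx : connect (mono_edge lt) i x.
  apply: (@connect_trans _ _ (last i p)); last by apply: connect1; rewrite /mono_edge /= ex lx.
  by apply/connectP; exists p.
case/orP: (tot _ _ (neq _ _ ev)) => h.
  by rewrite (connect_trans cx) //; apply: connect1; rewrite /mono_edge /= ev h.
have [<-|ne] := eqVneq (last i p) v.
  by apply/orP; left; apply/connectP; exists p.
by apply: IH => //; apply: (cl x) => //; rewrite e_sym.
Qed.

Hypotheses (Gconn : connected_graph e) (Gclosed : closed_graph e).

Lemma connect_mono i v : connect (mono_edge (fun a b => a < b)) i v ||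
  connect (mono_edge (fun a b => b < a)) i v.
Proof.
have /connectP[p pp ->] := Gconn i v.
have tot (a b : 'I_n) : a != b -> (a < b) || (b < a) by rewrite -val_eqE neq_ltn.
elim/last_ind: p pp => [|p x IH]; first by rewrite connect0.
rewrite rcons_path last_rcons => /andP[/IH h ex]; case/orP: h => /connectP[q pq hq].
  apply: (@mono_walk (fun a b => a < b) i q) => //; last by rewrite -hq.
  by move=> y a b ne ya yb ay by'; apply: (Gclosed (i := y)); rewrite // ay by' orbT.
rewrite orbC; apply: (@mono_walk (fun a b => b < a) i q) => //; last by rewrite -hq.
  by move=> a b /tot; rewrite orbC.
by move=> y a b ne ya yb ay by'; apply: (Gclosed (i := y)); rewrite // ay by'.
Qed.

(** A monotone walk between two consecutive labels has no room for an intermediate vertex. *)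
Lemma consecutive (i u : 'I_n) : val u = i.+1 -> e i u.
Proof.
move=> ui; have le (lt : rel nat) : transitive lt -> forall q (x : 'I_n),
    path (mono_edge (fun a b => lt a b)) x q -> last x q = x \/ lt x (last x q).
  move=> tr; elim=> [|y q IH] x /=; first by left.
  case/andP => /andP[_ xy] /IH [->|h]; right => //; exact: tr h.
case/orP: (connect_mono i u) => /connectP[q pq hq].
  case: q pq hq => [_ uE|y q /= /andP[/andP[ey iy] pq] hq]; first by move: ui; rewrite uE /=; lia.
  suff -> : u = y by [].
  case: (le ltn ltn_trans q y pq) => [h|h]; rewrite -hq in h; first by [].
  have {}h : y < u := h; move: ui iy => /= ui iy; lia.
case: (le gtn (fun b a c ab bc => ltn_trans bc ab) q i pq) => h; rewrite -hq in h.
  by move: ui; rewrite h /=; lia.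
have {}h : u < i := h; move: ui => /=; lia.
Qed.

(** Closing the triangle with an edge between consecutive labels moves either endpoint inwards by
    one. *)
Lemma edge_itv : forall i u i' u' : 'I_n, adj e i u -> i <= i' -> i' < u' -> u' <= u -> adj e i' u'.
Proof.
have up (i u : 'I_n) m (h : i + m < n) : i + m < u -> e i u -> e (Ordinal h) u.
  elim: m h => [|m IH] h hu eiu; first by rewrite (_ : Ordinal h = i) //; apply: val_inj; rewrite /= addn0.
  have h' : i + m < n by lia.
  apply: (Gclosed (i := Ordinal h')).
  - by rewrite -val_eqE /=; lia.
  - by apply: consecutive; rewrite /=; lia.
  - by apply: IH => //; lia.
  by apply/orP; left => /=; lia.
have down (i u : 'I_n) m (h : u - m < n) : i < u - m -> e i u -> e i (Ordinal h).
  elim: m h => [|m IH] h hu eiu; first by rewrite (_ : Ordinal h = u) //; apply: val_inj; rewrite /= subn0.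
  have h' : u - m < n by have := ltn_ord u; lia.
  apply: (Gclosed (i := Ordinal h')).
  - by rewrite -val_eqE /=; lia.
  - by rewrite e_sym; apply: IH => //; lia.
  - by rewrite e_sym; apply: consecutive; rewrite /=; lia.
  by apply/orP; right => /=; lia.
move=> i u i' u' /andP[eiu _] ii iu uu; rewrite /adj /= iu andbT.
have h1 : i + (i' - i) < n by have := ltn_ord i'; lia.
have e1 : e (Ordinal h1) u by apply: up => //; lia.
have h2 : u - (u - u') < n by have := ltn_ord u'; lia.
have := down _ _ (u - u') h2 _ e1.
rewrite (_ : Ordinal h1 = i'); last by apply: val_inj => /=; lia.
by rewrite (_ : Ordinal h2 = u'); [apply; rewrite /=; lia | apply: val_inj => /=; lia].
Qed.

Lemma deg_itv (i u : 'I_n) : i < u -> e i u = (u <= i + deg_gt e i).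
Proof.
move=> iu; apply/idP/idP => [eiu|].
  have : #|[set l : 'I_n | i.+1 <= l < u.+1]| <= deg_gt e i.
    apply: subset_leq_card; apply/subsetP => l; rewrite !inE => /andP[il lu].
    have := @edge_itv i u i l; rewrite /adj /= eiu iu il => /(_ isT (leqnn _) isT lu)/andP[-> _].
    by [].
  by rewrite card_itv //; lia.
apply: contraTT => neu; rewrite -ltnNge.
have : deg_gt e i <= #|[set l : 'I_n | i.+1 <= l < u]|.
  apply: subset_leq_card; apply/subsetP => l; rewrite !inE => /andP[il el]; rewrite il /=.
  rewrite ltnNge; apply: contra neu => ul.
  by have := @edge_itv i l i u; rewrite /adj /= el il iu => /(_ isT (leqnn _) isT ul)/andP[].
by rewrite (card_itv _ (ltnW (ltn_ord u))); lia.
Qed.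

Lemma deg_lt (i : 'I_n) : i + deg_gt e i < n.
Proof.
have : deg_gt e i <= #|[set l : 'I_n | i.+1 <= l < n]|.
  by apply: subset_leq_card; apply/subsetP => l; rewrite !inE ltn_ord andbT => /andP[].
by rewrite card_itv //; have := ltn_ord i; lia.
Qed.

(** [i + deg_gt e i] is the last vertex of the interval of later neighbours of [i], so [mu] counts
    the vertices beyond it. *)
Lemma mu_deg (i : 'I_n) : mu_seq e i + (i + deg_gt e i) = n.-1.
Proof. by rewrite /mu_seq; have := deg_lt i; lia. Qed.

Lemma mu_mono (i u : 'I_n) : i <= u -> mu_seq e u <= mu_seq e i.
Proof.
move=> iu; suff : i + deg_gt e i <= u + deg_gt e u by have := mu_deg i; have := mu_deg u; lia.
rewrite leqNgt; apply/negP => lt.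
have h : (u + deg_gt e u).+1 < n by have := deg_lt i; lia.
have [ui|ne] := eqVneq u i; first by move: lt; rewrite ui ltnn.
have iu' : i < u by rewrite ltn_neqAle iu eq_sym ne.
have : e i (Ordinal h) by rewrite deg_itv /=; lia.
move=> ei; have := @edge_itv i (Ordinal h) u (Ordinal h).
rewrite /adj /= ei => /(_ _ iu _ (leqnn _)) a.
have /andP[eu _] : e u (Ordinal h) && (u < Ordinal h).
  by apply: a; rewrite /=; lia.
by move: eu; rewrite deg_itv /=; lia.
Qed.

Lemma mu_before (v : 'I_n) : v < s_index e -> 0 < mu_seq e v.
Proof. by move/(before_find v); rewrite nth_ord_enum lt0n => ->. Qed.

Lemma mu_after (v : 'I_n) : s_index e <= v -> mu_seq e v = 0.
Proof.
move=> sv; have hs : s_index e < n by apply: leq_ltn_trans (ltn_ord v).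
have : has (fun v : 'I_n => mu_seq e v == 0) (enum 'I_n) by rewrite has_find size_enum_ord.
move/(nth_find v); rewrite -/(s_index e) -[s_index e]/(val (Ordinal hs)) nth_ord_enum => /eqP h0.
by have := @mu_mono (Ordinal hs) v sv; rewrite h0 leqn0 => /eqP.
Qed.

(** From [s] on, [mu] vanishes and a vertex sees everything later; before [s] it sees exactly up to
    [R]. *)
Lemma adj_cadj R : s_index e <= n ->
  (forall v : 'I_n, v < s_index e -> v + deg_gt e v = R) ->
  forall i u, adj e i u = cadj (s_index e) R i u.
Proof.
move=> sn h i u; rewrite /adj cadjE /=; case iu: (i < u); rewrite ?andbF //= andbT deg_itv //.
case: (leqP (s_index e) i) => si /=; last by rewrite h.
have := mu_deg i; rewrite mu_after //; have := ltn_ord u; lia.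
Qed.

End ClosedGraph.

Local Open Scope ring_scope.

(** * The matching transported to Koszul cells *)

Section KoszulMorse.
Variables (k : fieldType) (n : nat) (e : rel 'I_n) (s R : nat).
Local Notation N := (n + n)%N.
Hypothesis adjE : forall i u, adj e i u = cadj s R i u.

Lemma two_clique_itv : (s <= R)%N -> forall i u i' u' : 'I_n, adj e i u -> (i <= i')%N ->
  (i' < u')%N -> (u' <= u)%N -> adj e i' u'.
Proof. by move=> sR i u i' u'; rewrite !adjE !cadjE; lia. Qed.

Section Degree.
Variable j : nat.
Local Notation I := ('I_#|{: KB N j}|).
Implicit Types c : I.

Definition cW c : {set 'I_N} := [set v | 0 < cB c v]%N.
Definition cA c : {set 'I_N} := [set v | 0 < cE c v]%N.
(** A variable of multidegree at least 2 divides the monomial whether or not it is in the wedge, so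
    moving it changes no support and preserves standardness. Degrees that are not squarefree are
    thus matched completely. *)
Definition cell_toggle c : option 'I_N :=
  if [pick v | 1 < cB c v]%N is Some v then Some v else (toggle s R (cW c) (cA c)).2.
Definition cell_class c : nat :=
  if [pick v | 1 < cB c v]%N is Some v then 0%N else (toggle s R (cW c) (cA c)).1.
Definition src c := std e c && (if cell_toggle c is Some v then v \in cS c else false).
Definition crit c := std e c && (cell_toggle c == None).
Definition partner c := if cell_toggle c is Some v then nx c v else c.

Lemma std_indep c : std e c = indep s R (cA c).
Proof.
apply: eq_forallb => i; apply: eq_forallb => u.
by rewrite /has_edge adjE !inE.
Qed.

Lemma cA_sub c : cA c \subset cW c.
Proof. by apply/subsetP => v; rewrite !inE /cB addn_gt0 => ->. Qed.

Lemma cS_sub c : cS c \subset cW c.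
Proof. by apply/subsetP => v; rewrite !inE /cB addn_gt0 => ->; rewrite orbT. Qed.

Definition sqfree c := forall v, (cB c v <= 1)%N.

Lemma cA_sqfree c : sqfree c -> cA c = cW c :\: cS c.
Proof.
by move=> h; apply/setP => v; rewrite !inE; have := h v; rewrite /cB; case: (v \in cS c) => /=; lia.
Qed.

Lemma same_degree c c' : (forall v, cB c' v = cB c v) ->
  ((exists2 v, (1 < cB c v)%N & [/\ cell_toggle c = Some v, cell_toggle c' = Some v,
      cell_class c = 0%N & cell_class c' = 0%N]) \/
   [/\ sqfree c, sqfree c', cW c' = cW c,
     forall d, (d = c) \/ (d = c') -> cell_toggle d = (toggle s R (cW c) (cA d)).2 &
     forall d, (d = c) \/ (d = c') -> cell_class d = (toggle s R (cW c) (cA d)).1]).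
Proof.
move=> h.
have hp : [pick v | 1 < cB c' v]%N = [pick v | 1 < cB c v]%N by apply: eq_pick => v; rewrite h.
have hW : cW c' = cW c by apply/setP => v; rewrite !inE h.
rewrite /cell_toggle /cell_class; case ep: [pick v | 1 < cB c v]%N => [v|]; [left | right].
  exists v; last by rewrite hp ep.
  by move: ep; case: pickP => // u hu [<-].
have sq : sqfree c by move: ep; case: pickP => // no _ v; rewrite leqNgt no.
split=> // [v|d|d]; first by rewrite h.
  by case=> ->; rewrite ?hp ep ?hW.
by case=> ->; rewrite ?hp ep ?hW.
Qed.

Lemma nx_toggle c v : std e c -> cell_toggle c = Some v -> v \in cS c ->
  [/\ std e (nx c v), cell_toggle (nx c v) = Some v, v \notin cS (nx c v) &
      cell_class (nx c v) = cell_class c].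
Proof.
move=> sc tc vF; have [nS nE] := nxE vF.
have vS' : v \notin cS (nx c v) by rewrite nS !inE eqxx.
have [[u uB [t1 t2 c1 c2]]|[sq sq' eW tog cls]] := same_degree (fun u => cB_nx u vF).
  have uv : u = v by move: tc; rewrite t1 => -[].
  split; rewrite ?t2 ?uv ?c1 ?c2 //; move: sc; rewrite !std_indep; congr (indep _ _ _).
  apply/setP => x; rewrite !inE nE [addE _ _ _]ffunE; case: eqP => [->|_]; last by rewrite addn0.
  by rewrite addn1 -uv; move: uB; rewrite uv /cB vF; lia.
have [t1 t2] := (tog _ (or_introl erefl), tog _ (or_intror erefl)).
have [c1 c2] := (cls _ (or_introl erefl), cls _ (or_intror erefl)).
rewrite !std_indep t1 in sc tc *.
have [||ind e2] := @toggle_inv n s R (cW c) (cA c) (cA (nx c v)) v (cA_sub c) _ sc tc.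
- by rewrite -eW cA_sub.
- by apply/setP => x; rewrite !inE nE [addE _ _ _]ffunE; case: eqP => //= _; rewrite addn0.
split.
- exact: ind.
- by rewrite t2 e2; exact: tc.
- exact: vS'.
- rewrite c2 e2 c1; reflexivity.
Qed.

(** Every standard cell whose toggled variable is outside the wedge is the partner of a source; this
    is the surjectivity needed in [count_cells]. *)
Lemma prev_toggle c v : std e c -> cell_toggle c = Some v -> v \notin cS c ->
  exists c', [/\ std e c', cell_toggle c' = Some v, v \in cS c', nx c' v = c & (#|cS c'| = #|cS c|.+1)%N].
Proof.
move=> sc tc vF.
have Ev : (0 < cE c v)%N.
  have [[u uB [t1 _ _ _]]|[sq _ _ tog _]] := same_degree (fun u => erefl (cB c u)).
    have uv : u = v by move: tc; rewrite t1 => -[].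
    by move: uB; rewrite uv /cB (negbTE vF); lia.
  have := tc; rewrite (tog c) => [/toggle_mem|]; last by left.
  by rewrite inE /cB (negbTE vF) addn0.
pose E' : {ffun 'I_N -> nat} := [ffun u => (cE c u - (u == v))%N].
have EE : addE E' v = cE c.
  apply/ffunP => u; rewrite [LHS]ffunE [E' _]ffunE; case: eqP => [->|_] /=; first by rewrite subnK.
  by rewrite subn0 addn0.
have [|c' /andP[/eqP hS /eqP hE]] := @cell_ex N j (v |: cS c) E'.
  have := sum_addE E' v; rewrite EE => h; have := cell_deg c; rewrite h cardsU1 vF; lia.
have vF' : v \in cS c' by rewrite hS !inE eqxx.
have nxc : nx c' v = c.
  by apply: cell_inj; rewrite !(nxE vF') ?hS ?setU1K // hE.
have cc : (#|cS c'| = #|cS c|.+1)%N by rewrite hS cardsU1 vF.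
exists c'; split; [ | | exact: vF' | exact: nxc | exact: cc].
  have := same_degree (fun u => cB_nx u vF'); rewrite nxc.
  case=> [[u uB [t1 t2 c1 c2]]|[sq sq' eW tog cls]].
    have uv : u = v by move: tc; rewrite t2 => -[].
    rewrite std_indep; move: sc; rewrite std_indep; congr (indep _ _ _).
    apply/setP => x; rewrite !inE -{1}EE -hE [addE _ _ _]ffunE; case: eqP => [->|_]; last by rewrite addn0.
    by rewrite addn1; move: uB; rewrite uv /cB vF'; lia.
  rewrite std_indep; rewrite std_indep in sc; apply: indep_sub sc; apply/subsetP => x.
  by rewrite !inE hE [E' _]ffunE => h; lia.
have := same_degree (fun u => cB_nx u vF'); rewrite nxc.
case=> [[u uB [t1 t2 c1 c2]]|[sq sq' eW tog cls]].
  by rewrite t1 -t2; exact: tc.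
have [t1 t2] := (tog _ (or_introl erefl), tog _ (or_intror erefl)).
rewrite std_indep in sc; rewrite t2 in tc; rewrite -eW in tc t1.
have [||_ e2] := @toggle_inv n s R (cW c) (cA c) (cA c') v (cA_sub c) _ sc tc.
- by rewrite eW cA_sub.
- apply/setP => x; rewrite !inE -[in RHS]EE -hE [addE _ _ _]ffunE.
  by case: eqP => //= _; rewrite addn0.
by rewrite t1 e2; exact: tc.
Qed.

Lemma src_toggle c : src c -> exists2 v, v \in cS c & cell_toggle c = Some v.
Proof. by case/andP => _; case: cell_toggle => // v h; exists v. Qed.

Lemma src_partner c : src c -> std e (partner c) /\ kdiff k N j c (partner c) != 0.
Proof.
move=> sc; have [v vF tc] := src_toggle sc; case/andP: sc => st _.
have [a _ _ _] := nx_toggle st tc vF.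
by rewrite /partner tc; split=> //; rewrite kdiff_nx // sg_neq0.
Qed.

Lemma nx_inj c c' v : v \in cS c -> v \in cS c' -> nx c v = nx c' v -> c = c'.
Proof.
move=> vc vc' h; have [a b] := nxE vc; have [a' b'] := nxE vc'.
apply: cell_inj; first by rewrite -(setD1K vc) -(setD1K vc') -a -a' h.
apply/ffunP => u; move: b; rewrite h b' => /ffunP/(_ u).
by rewrite ![addE _ _ _]ffunE => /addIn.
Qed.

Lemma partner_inj c c' : src c -> src c' -> partner c = partner c' -> c = c'.
Proof.
move=> sc sc'; have [v vF tc] := src_toggle sc; have [v' vF' tc'] := src_toggle sc'.
case/andP: sc => st _; case/andP: sc' => st' _.
have [_ t1 _ _] := nx_toggle st tc vF; have [_ t2 _ _] := nx_toggle st' tc' vF'.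
rewrite /partner tc tc' => h; have vv : v = v' by move: t2; rewrite -h t1 => -[].
by subst v'; exact: (nx_inj vF vF' h).
Qed.

(** By [toggle_mono] the class cannot rise, and an equal class would give both cells the same
    toggled variable. That of [c] is still in the wedge of [partner c2], since [w] differs from it,
    whereas that of [partner c2] is not. *)
Lemma src_class c c2 : src c -> src c2 -> c != c2 -> kdiff k N j c (partner c2) != 0 ->
  (cell_class (partner c2) < cell_class (partner c))%N.
Proof.
move=> sc sc2 ne /kdiff_neq0 [w wF hw].
have [v vF tc] := src_toggle sc; have [v2 vF2 tc2] := src_toggle sc2.
have wv : v != w.
  apply: contra_neq ne => vw; apply: partner_inj => //.
  by rewrite hw /partner tc vw.
case/andP: (sc) => st _; case/andP: (sc2) => st2 _.
have [sg tg vg clg] := nx_toggle st2 tc2 vF2.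
have [_ _ _ cl1] := nx_toggle st tc vF.
rewrite {2}/partner tc cl1.
have pE : partner c2 = nx c2 v2 by rewrite /partner tc2.
rewrite -pE in sg tg vg clg.
have vS : v \in cS (partner c2) by rewrite hw (nxE wF).1 !inE wv.
have key : cell_toggle (partner c2) = cell_toggle c -> False.
  by rewrite tg tc => -[v2v]; rewrite v2v vS in vg.
have := same_degree (fun u => cB_nx u wF); rewrite -hw.
case=> [[u uB [t1 t2 _ _]]|[sq sq' eW tog cls]]; first by case: key; rewrite t1 t2.
have [t1 t2] := (tog _ (or_introl erefl), tog _ (or_intror erefl)).
have [c1 c2'] := (cls _ (or_introl erefl), cls _ (or_intror erefl)).
have AE : cA (partner c2) = w |: cA c.
  apply/setP => x; rewrite !inE hw (nxE wF).2 [addE _ _ _]ffunE.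
  by case: eqP => [->|_] /=; rewrite ?addn1 ?addn0.
have [] := @toggle_mono n s R (cW c) (cA c) w (cA_sub c) _ _.
- by rewrite (subsetP (cS_sub c)).
- by rewrite -AE -std_indep.
rewrite -AE => le h2.
rewrite ltn_neqAle; apply/andP; split; last first.
  by have := le; congr (_ <= _)%N; [exact: esym c2' | exact: esym c1].
apply/eqP => h; case: key; rewrite t1 t2; apply: h2.
exact: (etrans (esym c2') (etrans h c1)).
Qed.

Lemma count_cells i : stdi (fun c => #|cS c|) (@std n e j) i =
  (criti (fun c => #|cS c|) crit i + srci (fun c => #|cS c|) src i +
   srci (fun c => #|cS c|) src i.+1)%N.
Proof.
rewrite /stdi /criti /srci.
pose S0 := [set c : I | std e c && (#|cS c| == i)].
pose C0 := [set c | crit c && (#|cS c| == i)].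
pose S1 := [set c | src c && (#|cS c| == i)].
pose S2 := [set c | src c && (#|cS c| == i.+1)].
pose T0 := [set c | [&& std e c, if cell_toggle c is Some v then v \notin cS c else false & #|cS c| == i]].
have cT : #|T0| = #|S2|.
  have -> : T0 = partner @: S2.
    apply/setP => c; rewrite !inE; apply/and3P/imsetP.
      case=> sc; case tc: (cell_toggle c) => [v|] // vF /eqP ci.
      have [c' [sc' tc' vF' nxc cc]] := prev_toggle sc tc vF.
      exists c'; last by rewrite /partner tc' nxc.
      by rewrite inE /src sc' tc' vF' cc ci eqxx.
    case=> c'; rewrite inE => /andP[sc' /eqP ci] ->.
    have [v vF tc] := src_toggle sc'; case/andP: sc' => st _.
    have [a b d _] := nx_toggle st tc vF.
    have pE : partner c' = nx c' v by rewrite /partner tc.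
    rewrite pE b; split=> //.
    by have := cardsD1 v (cS c'); rewrite vF ci (nxE vF).1 => -[->].
  by apply: card_in_imset => c c'; rewrite !inE => /andP[a _] /andP[b _]; exact: partner_inj.
have -> : #|[pred c : I | std e c && (#|cS c| == i)]| = #|S0| by apply: eq_card => c; rewrite !inE.
have -> : #|[pred c | crit c && (#|cS c| == i)]| = #|C0| by apply: eq_card => c; rewrite !inE.
have -> : #|[pred c | src c && (#|cS c| == i)]| = #|S1| by apply: eq_card => c; rewrite !inE.
have -> : #|[pred c | src c && (#|cS c| == i.+1)]| = #|S2| by apply: eq_card => c; rewrite !inE.
rewrite -cT.
have -> : S0 = C0 :|: S1 :|: T0.
  apply/setP => c; rewrite !inE /crit /src; case: (std e c) => //=.
  by case: cell_toggle => [v|] /=; case: (v \in cS c) || idtac; case: (_ == i); rewrite ?orbT.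
rewrite !cardsU.
have -> : C0 :&: S1 = set0.
  by apply/setP => c; rewrite !inE /crit /src; case: cell_toggle => [v|]; rewrite ?andbF.
have -> : (C0 :|: S1) :&: T0 = set0.
  apply/setP => c; rewrite !inE /crit /src; case: cell_toggle => [v|]; rewrite ?andbF //=.
  by case: (v \in cS c); rewrite ?andbF.
by rewrite cards0 !subn0.
Qed.

End Degree.

Hypothesis sR : (s <= R)%N.
Variables (I : gfam k N) (eps : k).
Hypothesis eps_idem : eps * eps = eps.
Hypothesis I_gen : forall j, (ksub I j == Dg e j eps)%MS.

Lemma koszul_homE i j : koszul_hom I i j = homdim (fun c => #|cS c|) (kdiff k N j) (ksub I j) i.
Proof. by []. Qed.

Lemma ksub_sub j m (w : 'M[k]_(m, _)) : (w <= ksub I j)%MS = (w <= Dg e j eps)%MS.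
Proof. by have /eqmxP-> := I_gen j. Qed.

Lemma ksub_stable j : (ksub I j *m kdiff k N j <= ksub I j)%MS.
Proof. by rewrite ksub_sub (eqmxMr _ (eqmxP (I_gen j))) Dg_kdiff. Qed.

Let itv := two_clique_itv sR.
Let hd j := fun c : 'I_#|{: KB N j}| => #|cS c|.

Lemma ksub_reduce j c : ~~ std e c ->
  exists2 c' : 'I_#|{: KB N j}|, (hd c' = hd c /\ fw c' < fw c)%N &
  exists a : k, (((delta_mx 0 c - a *: delta_mx 0 c')%R : 'rV[k]_(#|{: KB N j}|)) <= ksub I j)%MS.
Proof.
move=> h; have [c' h1 [a h2]] := reduce_cell eps h.
by exists c' => //; exists a; rewrite ksub_sub.
Qed.

Lemma ksub_lead j (f : 'rV[k]_(#|{: KB N j}|)) c : (f <= ksub I j)%MS -> std e c -> f 0 c != 0 ->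
  exists2 c', f 0 c' != 0 & (fw c < fw c')%N.
Proof. by rewrite ksub_sub; apply: lead_cell. Qed.

Definition ncrit i j := criti (@hd j) (@crit j) i.

Lemma koszul_le_crit i j : (koszul_hom I i j <= ncrit i j)%N.
Proof.
rewrite koszul_homE.
exact: (homdim_le_crit (@kdiff_deg k N j) (@ksub_stable j) (@ksub_reduce j) (@ksub_lead j) (@kdiff_fw k n j)
  (@src_partner j) (@src_class j) (@count_cells j)).
Qed.

Lemma koszul_eq_crit i j : ncrit i j = 0%N -> ncrit i.+2 j = 0%N ->
  koszul_hom I i.+1 j = ncrit i.+1 j.
Proof.
rewrite koszul_homE.
exact: (homdim_eq_crit (@kdiff_deg k N j) (@kdiff_sq k N j) (@ksub_stable j)
  (@ksub_reduce j) (@ksub_lead j) (@kdiff_fw k n j)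
  (@src_partner j) (@src_class j) (@count_cells j)).
Qed.

End KoszulMorse.

(** * Four vertices inducing a path *)

Lemma move_unit x p q m : (p <= x)%N -> (x - p + q + m + p = x + m + q)%N.
Proof. by lia. Qed.

Lemma deg01 (x xa xb xc yb yc yd : nat) :
  (x + (xb + yc) = xa + xb + xb + yc + yc + yd + (xc + yb) -> x = xa + xb + xc + yb + yc + yd)%N.
Proof. by lia. Qed.

Lemma deg10 (x xa xb xc yb yc yd : nat) :
  (xa + xb + xc + yb + yc + yd + (xb + yc) = x + (xc + yb) -> x = xa + xb + xb + yc + yc + yd)%N.
Proof. by lia. Qed.

Section InducedPath.
Variables (k : fieldType) (n : nat) (e : rel 'I_n) (a b c d : 'I_n).
Local Notation N := (n + n)%N.
Hypothesis adj_itv : forall i u i' u' : 'I_n, adj e i u -> (i <= i')%N -> (i' < u')%N ->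
  (u' <= u)%N -> adj e i' u'.
Hypotheses (ab : (a < b)%N) (bc : (b < c)%N) (cd : (c < d)%N).
Hypotheses (Eab : adj e a b) (Ebc : adj e b c) (Ecd : adj e c d).
Hypotheses (Nac : ~~ adj e a c) (Nbd : ~~ adj e b d).
Local Notation I := ('I_#|{: KB N 6}|).

Let neq (i u : 'I_n) : (i < u)%N -> (i == u = false) * (u == i = false).
Proof. by move=> h; split; apply/negbTE; rewrite -val_eqE neq_ltn h ?orbT. Qed.

Let ac := ltn_trans ab bc.
Let bd := ltn_trans bc cd.
Let ad := ltn_trans ac cd.
Let Nad : ~~ adj e a d.
Proof. by apply: contra Nac => h; exact: adj_itv h (leqnn a) ac (ltnW cd). Qed.
Let ne := (neq ab, neq bc, neq cd, neq ac, neq bd, neq ad).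

Let ltxx (i u : 'I_n) : (xv i < xv u)%N = (i < u)%N. Proof. by []. Qed.
Let ltxy (i u : 'I_n) : (xv i < yv u)%N.
Proof. by rewrite /= (leq_trans (ltn_ord i)) ?leq_addr. Qed.
Let ltyx (i u : 'I_n) : (yv u < xv i)%N = false.
Proof. by apply/negbTE; rewrite -leqNgt ltnW // ltxy. Qed.
Let ltyy (i u : 'I_n) : (yv i < yv u)%N = (i < u)%N. Proof. by rewrite /= ltn_add2l. Qed.
Let asym (i u : 'I_n) : (i < u)%N -> (u < i)%N = false.
Proof. by move=> h; apply/negbTE; rewrite -leqNgt ltnW. Qed.
Let cmp := (ltxx, ltxy, ltyx, ltyy, ltnn, ab, bc, cd, ac, bd, ad,
  asym ab, asym bc, asym cd, asym ac, asym bd, asym ad).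

Definition six : seq 'I_N := [:: xv a; xv b; xv c; yv b; yv c; yv d].

Let uniq_six : uniq six.
Proof. by rewrite /six /= !inE !xyE !ne. Qed.

Lemma sum_six (V : nmodType) (F : {set 'I_N}) (g : 'I_N -> V) : {subset F <= six} ->
  \sum_(v in F) g v = \sum_(v <- six) (if v \in F then g v else 0).
Proof.
move=> h; rewrite big_uniq // -big_mkcondr /=.
by apply: eq_bigl => v; apply/idP/andP => [vF|[]//]; split=> //; apply: h.
Qed.

Definition deg0 : {ffun 'I_N -> nat} := [ffun v => ((v == xv a) + (v == xv b) + (v == xv c) +
  (v == yv b) + (v == yv c) + (v == yv d))%N].
Definition deg1 : {ffun 'I_N -> nat} := [ffun v => ((v == xv a) + (v == xv b) + (v == xv b) +
  (v == yv c) + (v == yv c) + (v == yv d))%N].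

(* In degree [deg0] the nonzero cells modulo the initial ideal form an octahedron, whose
   fundamental class is [phi0]; [phi1] is the correction making it vanish on the binomials. *)
Definition phi0 (F : {set 'I_N}) : k :=
  ([&& (xv a \in F) (+) (yv b \in F), (xv b \in F) (+) (yv c \in F) &
       (xv c \in F) (+) (yv d \in F)])%:R *
  (-1) ^+ (((yv b \in F) && (xv b \in F)) + ((yv b \in F) && (xv c \in F)) +
           ((yv c \in F) && (xv c \in F))).
Definition phi1 (F : {set 'I_N}) : k :=
  [&& xv a \in F, yv d \in F & (xv b \in F) (+) (yv c \in F)]%:R.

Definition cBf (x : I) : {ffun 'I_N -> nat} := [ffun v => cB x v].
Definition phi (x : I) : k :=
  if cBf x == deg0 then phi0 (cS x) else if cBf x == deg1 then phi1 (cS x) else 0.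

(** Makes the signs computable: over six named variables the closedness identities become finite
    checks over membership patterns. *)
Lemma sum_sg (F : {set 'I_N}) (f : {set 'I_N} -> k) : {subset F <= six} ->
  \sum_(v in F) sg k v F * f (F :\ v) =
  \sum_(v <- six) (if v \in F then
     (-1) ^+ (\sum_(u <- six) (if u \in F then (u < v)%N : nat else 0)) * f (F :\ v) else 0).
Proof.
move=> h; rewrite sum_six //; apply: eq_bigr => v _; case: ifP => // _.
congr (_ ^+ _ * _); rewrite -(sum_six (fun u => (u < v)%N : nat) h) -sum1_card.
rewrite [RHS]big_mkcond [LHS]big_mkcond; apply: eq_bigr => u _; rewrite inE.
by case: (u \in F); case: (u < v)%N.
Qed.

Lemma phi0_closed (F : {set 'I_N}) : {subset F <= six} ->
  \sum_(v in F) sg k v F * phi0 (F :\ v) = 0.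
Proof.
move=> h; rewrite sum_sg // /six !big_cons !big_nil /phi0 !inE !xyE !ne !eqxx !cmp /=.
case: (xv a \in F); case: (xv b \in F); case: (xv c \in F);
case: (yv b \in F); case: (yv c \in F); case: (yv d \in F) => /=; ring.
Qed.

Lemma phi1_closed (F : {set 'I_N}) : {subset F <= six} -> xv c \notin F -> yv b \notin F ->
  \sum_(v in F) sg k v F * phi1 (F :\ v) = 0.
Proof.
move=> h /negbTE xc /negbTE yb.
rewrite sum_sg // /six !big_cons !big_nil /phi1 !inE !xyE !ne !eqxx !cmp xc yb /=.
case: (xv a \in F); case: (xv b \in F); case: (yv c \in F); case: (yv d \in F) => /=; ring.
Qed.

Lemma kdiff_phi : kdiff k N 6 *m (\row_x phi x)^T = 0.
Proof.
apply/row_matrixP => x; rewrite row0 row_mul row_kdiff mulmx_suml.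
have cBfE v : v \in cS x -> cBf (nx x v) = cBf x.
  by move=> vF; apply/ffunP => u; rewrite !ffunE cB_nx.
have mem v : v \in cS x -> (0 < cBf x v)%N by move=> vF; rewrite ffunE /cB vF addn1.
apply/rowP => o; rewrite summxE [RHS]mxE.
transitivity (\sum_(v in cS x) sg k v (cS x) * phi (nx x v)).
  by apply: eq_bigr => v _; rewrite -scalemxAl -rowE !mxE.
have [e0|n0] := eqVneq (cBf x) deg0.
  rewrite -[RHS](@phi0_closed (cS x)).
    by apply: eq_bigr => v vF; rewrite /phi cBfE // e0 eqxx (nxE vF).1.
  move=> v /mem; rewrite e0 ffunE !inE.
    by case: (v == xv a); case: (v == xv b); case: (v == xv c);
       case: (v == yv b); case: (v == yv c); case: (v == yv d).
have [e1|n1] := eqVneq (cBf x) deg1.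
  rewrite -[RHS](@phi1_closed (cS x)).
  - by apply: eq_bigr => v vF; rewrite /phi cBfE // (negbTE n0) e1 eqxx (nxE vF).1.
  - move=> v /mem; rewrite e1 ffunE !inE.
    by case: (v == xv a); case: (v == xv b); case: (v == yv c); case: (v == yv d); rewrite ?orbT.
  - by apply: contraL (isT) => /mem; rewrite e1 ffunE !xyE !ne.
  - by apply: contraL (isT) => /mem; rewrite e1 ffunE !xyE !ne.
by rewrite big1 // => v vF; rewrite /phi cBfE // (negbTE n0) (negbTE n1) mulr0.
Qed.

(** In degree [deg0] a cell whose monomial is divisible by an edge has neither variable of the edge
    in its wedge, so [phi0] vanishes there. The only swap linking [deg0] and [deg1] replaces
    [x_b y_c] by [x_c y_b]; since [x_c] and [y_b] are absent from [deg1], [phi0] and [phi1] agree on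
    that wedge. *)
Lemma phi_sw x i u : has_edge (adj e) (cE x) i u -> phi x = 1 * phi (sw x i u).
Proof.
move=> he; have [sS sE] := sw_E he; case/and3P: he => a_iu hx hy; rewrite mul1r.
have iu := adj_lt a_iu; have niu := neq iu.
have BE v : (cBf (sw x i u) v + ((v == xv i) + (v == yv u)) =
    cBf x v + ((v == xv u) + (v == yv i)))%N.
  rewrite !ffunE /cB sS sE [swE _ _ _ _]ffunE.
  apply: move_unit; have [->|_] := eqVneq v (xv i); first by rewrite xyE addn0.
  exact: sub_unit.
have Bx : (0 < cBf x (xv i))%N by rewrite ffunE /cB addn_gt0 hx.
have By : (0 < cBf x (yv u))%N by rewrite ffunE /cB addn_gt0 hy.
have Bx' : (0 < cBf (sw x i u) (xv u))%N.
  by have := BE (xv u); rewrite !xyE !niu eqxx /= !addn0 addn1 => ->.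
have By' : (0 < cBf (sw x i u) (yv i))%N.
  by have := BE (yv i); rewrite !xyE !niu eqxx /= !add0n !addn0 addn1 => ->.
have memx v : cBf x v = 1%N -> (0 < cE x v)%N -> v \notin cS x.
  rewrite ffunE /cB => h1 h2; apply/negP => h; move: h1; rewrite h addn1 => -[h0].
  by rewrite h0 in h2.
have mem0 v : cBf x v = 0%N -> v \notin cS x.
  by rewrite ffunE /cB => h1; apply/negP => h; rewrite h addn1 in h1.
rewrite /phi sS.
have [e0|n0] := eqVneq (cBf x) deg0.
  have [hi hu] : i \in [:: a; b; c] /\ u \in [:: b; c; d].
    rewrite !inE; split.
      by move: Bx; rewrite e0 ffunE !xyE; case: (i == a); case: (i == b); case: (i == c).
    by move: By; rewrite e0 ffunE !xyE; case: (u == b); case: (u == c); case: (u == d).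
  have B1x : cBf x (xv i) = 1%N by move: hi; rewrite e0 ffunE !xyE !inE => /or3P[] /eqP ->; rewrite ?eqxx !ne.
  have B1y : cBf x (yv u) = 1%N by move: hu; rewrite e0 ffunE !xyE !inE => /or3P[] /eqP ->; rewrite ?eqxx !ne.
  have xF := memx _ B1x hx; have yF := memx _ B1y hy.
  have B0x : cBf (sw x i u) (xv i) = 0%N.
    by have := BE (xv i); rewrite B1x !xyE !niu eqxx /= !addn0 !addn1 => -[].
  have -> : (cBf (sw x i u) == deg0) = false.
    apply/negbTE/eqP => h; by move: B0x; rewrite h -e0 B1x.
  have -> : (cBf (sw x i u) == deg1) = false.
    apply/negbTE/eqP => h; move: B0x Bx'; rewrite h !ffunE !xyE.
    move: hi hu a_iu; rewrite !inE => /or3P[] /eqP -> /or3P[] /eqP ->; rewrite ?eqxx ?ne //=;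
    by move=> ai; have := adj_lt ai; rewrite ?cmp.
  rewrite /phi0; move: hi hu a_iu xF yF; rewrite !inE => /or3P[] /eqP -> /or3P[] /eqP -> //=;
    rewrite ?(negbTE Nac) ?(negbTE Nbd) ?(negbTE Nad) // => ai;
    try (by have := adj_lt ai; rewrite ?cmp);
    by move=> /negbTE -> /negbTE ->; rewrite /= ?andbF mul0r.
have [e1|n1] := eqVneq (cBf x) deg1.
  have [hi hu] : i \in [:: a; b] /\ u \in [:: c; d].
    rewrite !inE; split.
      by move: Bx; rewrite e1 ffunE !xyE; case: (i == a); case: (i == b).
    by move: By; rewrite e1 ffunE !xyE; case: (u == c); case: (u == d).
  have [ib uc] : i = b /\ u = c.
    move: hi hu a_iu; rewrite !inE => /orP[] /eqP -> /orP[] /eqP -> //;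
    by rewrite ?(negbTE Nac) ?(negbTE Nbd) ?(negbTE Nad).
  have -> : (cBf (sw x i u) == deg0).
    apply/eqP/ffunP => v; have := BE v; rewrite e1 ib uc [deg1 _]ffunE [deg0 _]ffunE; exact: deg01.
  have := mem0 (xv c); rewrite e1 !ffunE !xyE !ne => /(_ erefl)/negbTE xc.
  have := mem0 (yv b); rewrite e1 !ffunE !xyE !ne => /(_ erefl)/negbTE yb.
  rewrite /phi0 /phi1 xc yb !andbF /= expr0 mulr1 addbF.
  by case: (xv a \in _); case: (yv d \in _); rewrite ?andbF ?andbT.
have [e0'|n0'] := eqVneq (cBf (sw x i u)) deg0.
  have [hi hu] : i \in [:: b; c; d] /\ u \in [:: a; b; c].
    rewrite !inE; split.
      by move: By'; rewrite e0' ffunE !xyE; case: (i == b); case: (i == c); case: (i == d).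
    by move: Bx'; rewrite e0' ffunE !xyE; case: (u == a); case: (u == b); case: (u == c).
  have [ib uc] : i = b /\ u = c.
    move: hi hu iu; rewrite !inE => /or3P[] /eqP -> /or3P[] /eqP -> //; by rewrite ?cmp.
  case/eqP: n1; apply/ffunP => v; have := BE v.
  rewrite e0' ib uc [deg1 _]ffunE [deg0 _]ffunE; exact: deg10.
have [e1'|//] := eqVneq (cBf (sw x i u)) deg1.
have [hi hu] : i \in [:: c; d] /\ u \in [:: a; b].
  rewrite !inE; split.
    by move: By'; rewrite e1' ffunE !xyE; case: (i == c); case: (i == d).
  by move: Bx'; rewrite e1' ffunE !xyE; case: (u == a); case: (u == b).
by move: hi hu iu; rewrite !inE => /orP[] /eqP -> /orP[] /eqP ->; rewrite ?cmp.
Qed.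

End InducedPath.

(** * The explicit cycle and its nonzero class *)

Section Cycle.
Variables (k : fieldType) (n : nat) (e : rel 'I_n).
Local Notation N := (n + n)%N.
Local Notation I := ('I_#|{: KB N 6}|).
Variable x0 : I.
Implicit Types (f l : seq 'I_N).

Definition mon l : {ffun 'I_N -> nat} := [ffun v => count_mem v l].
Definition cell f l : I := toc x0 [set v in f] (mon l).
Definition dl f l : 'rV[k]_(#|{: KB N 6}|) := delta_mx 0 (cell f l).

Lemma sum_mon l : (\sum_v mon l v = size l)%N.
Proof.
elim: l => [|x l IH]; first by rewrite big1 // => v _; rewrite ffunE.
transitivity (\sum_v (mon l v + (v == x)))%N; last by rewrite big_split /= IH sum_unit addn1.
by apply: eq_bigr => v _; rewrite !ffunE /= eq_sym addnC.
Qed.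

Lemma cellE f l : uniq f -> (size f + size l = 6)%N ->
  (cS (cell f l) = [set v in f]) * (cE (cell f l) = mon l).
Proof.
move=> uf h; apply: tocE; rewrite sum_mon cardsE.
by rewrite (card_uniqP uf).
Qed.

Lemma dl_perm f l l' : perm_eq l l' -> dl f l = dl f l'.
Proof.
move=> /permP h; rewrite /dl /cell; suff -> : mon l = mon l' by [].
by apply/ffunP => v; rewrite !ffunE h.
Qed.

Lemma dl_sw f l (i u : 'I_n) : adj e i u -> uniq f -> (size f + size l = 4)%N ->
  (dl f [:: xv i, yv u & l] - dl f [:: xv u, yv i & l] <= Dg e 6 (1 : k))%MS.
Proof.
move=> a uf h.
have h6 x y : (size f + size [:: x, y & l] = 6)%N by rewrite /= !addnS h.
have [hS hE] := cellE uf (h6 (xv i) (yv u)).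
have [hS' hE'] := cellE uf (h6 (xv u) (yv i)).
have he : has_edge (adj e) (cE (cell f [:: xv i, yv u & l])) i u.
  by rewrite /has_edge a hE !ffunE /= !eqxx !xyE /= !addn_gt0 orbT.
have [sS sE] := sw_E he.
have := gen_Dg e (1 : k) (cell f [:: xv i, yv u & l], i, u); rewrite /gen he scale1r.
suff -> : sw (cell f [:: xv i, yv u & l]) i u = cell f [:: xv u, yv i & l] by [].
apply: cell_inj; rewrite ?sS ?hS ?hS' // sE hE hE'; apply/ffunP => v.
rewrite [LHS]ffunE ![mon _ _]ffunE /= ![_ == v]eq_sym.
move: (nat_of_bool (v == xv i)) (nat_of_bool (v == yv u)) (nat_of_bool (v == xv u))
  (nat_of_bool (v == yv i)) (count_mem v l) => p q r t m; clear; lia.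
Qed.

Lemma dl_trans f l1 l2 l3 : (dl f l1 - dl f l2 <= Dg e 6 (1 : k))%MS ->
  (dl f l2 - dl f l3 <= Dg e 6 (1 : k))%MS -> (dl f l1 - dl f l3 <= Dg e 6 (1 : k))%MS.
Proof. by move=> h1 h2; rewrite -(subrK (dl f l2) (dl f l1)) -addrA addmx_sub. Qed.

Lemma dl_kdiff (u1 u2 u3 : 'I_N) l : (u1 < u2)%N -> (u2 < u3)%N -> size l = 3 ->
  dl [:: u1; u2; u3] l *m kdiff k N 6 =
  dl [:: u2; u3] (u1 :: l) - dl [:: u1; u3] (u2 :: l) + dl [:: u1; u2] (u3 :: l).
Proof.
move=> h12 h23 sl; have h13 := ltn_trans h12 h23.
have ne (u v : 'I_N) : (u < v)%N -> (u == v = false) * (v == u = false).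
  by move=> h; split; apply/negbTE; rewrite -val_eqE neq_ltn h ?orbT.
have [n12 n12'] := ne _ _ h12; have [n23 n23'] := ne _ _ h23; have [n13 n13'] := ne _ _ h13.
have as_ (u v : 'I_N) : (u < v)%N -> (v < u)%N = false.
  by move=> h; apply/negbTE; rewrite -leqNgt ltnW.
have uf : uniq [:: u1; u2; u3] by rewrite /= !inE n12 n13 n23.
have h6 : (size [:: u1; u2; u3] + size l = 6)%N by rewrite sl.
have [hS hE] := cellE uf h6.
rewrite /dl -rowE row_kdiff hS.
have sgE v : sg k v [set v in [:: u1; u2; u3]] = (-1) ^+ count (fun u : 'I_N => (u < v)%N) [:: u1; u2; u3].
  congr (_ ^+ _); rewrite -size_filter -(card_uniqP (filter_uniq _ uf)).
  by apply: eq_card => u; rewrite inE mem_filter andbC inE.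
have nxC v f : v \in [:: u1; u2; u3] -> uniq f -> size f = 2 ->
    (forall u, (u \in f) = (u != v) && (u \in [:: u1; u2; u3])) ->
    nx (cell [:: u1; u2; u3] l) v = cell f (v :: l).
  move=> vF uf' sf hf; have vF' : v \in cS (cell [:: u1; u2; u3] l) by rewrite hS inE.
  have h6' : (size f + size (v :: l) = 6)%N by rewrite sf /= sl.
  have [fS fE] := cellE uf' h6'.
  apply: cell_inj; rewrite !(nxE vF') ?fS ?fE ?hS ?hE.
    by apply/setP => u; rewrite !inE hf !inE.
  by apply/ffunP => u; rewrite [LHS]ffunE ![mon _ _]ffunE /= addnC eq_sym.
transitivity (\sum_(v <- [:: u1; u2; u3]) sg k v [set v in [:: u1; u2; u3]] *:
    (delta_mx 0 (nx (cell [:: u1; u2; u3] l) v) : 'rV[k]_(#|{: KB N 6}|))).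
  by rewrite big_uniq //=; apply: eq_bigl => v; rewrite !inE.
rewrite !big_cons big_nil addr0 !sgE /= !ltnn h12 h13 h23 !(as_ _ _ h12) !(as_ _ _ h13) !(as_ _ _ h23) /=.
rewrite (nxC u1 [:: u2; u3]) ?(nxC u2 [:: u1; u3]) ?(nxC u3 [:: u1; u2]) ?inE ?eqxx ?orbT //=;
  rewrite ?inE ?n12 ?n13 ?n23 //.
- by rewrite !addn0 expr0 expr1 sqrrN expr1n !scale1r scaleN1r addrA.
all: move=> u; rewrite !inE; have [e1|_] := eqVneq u u1; first by rewrite ?e1 ?eqxx ?n12 ?n13.
all: have [e2|_] := eqVneq u u2; first by rewrite ?e2 ?eqxx ?n12' ?n23.
all: by have [e3|_] := eqVneq u u3; rewrite ?e3 ?eqxx ?n13' ?n23'.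
Qed.

Variables (a b c d : 'I_n).
Hypotheses (ab : (a < b)%N) (bc : (b < c)%N) (cd : (c < d)%N).
Hypotheses (Eab : adj e a b) (Ebc : adj e b c) (Ecd : adj e c d).

(* [xb xc] times the cycle [xa e_bcd - xb e_acd + xc e_abd - xd e_abc] of the
   Eagon-Northcott complex of the [2 x 4] matrix ([e_uvw] being the wedge of [yu, yv, yw]). *)
Definition path_cycle : 'rV[k]_(#|{: KB N 6}|) :=
  dl [:: yv b; yv c; yv d] [:: xv a; xv b; xv c] - dl [:: yv a; yv c; yv d] [:: xv b; xv b; xv c]
  + dl [:: yv a; yv b; yv d] [:: xv b; xv c; xv c] - dl [:: yv a; yv b; yv c] [:: xv b; xv c; xv d].

Lemma dl_step f l l' l1 (i u : 'I_n) : adj e i u -> uniq f -> size f = 2 -> size l1 = 2 ->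
  perm_eq l [:: xv i, yv u & l1] -> perm_eq l' [:: xv u, yv i & l1] ->
  (dl f l - dl f l' <= Dg e 6 (1 : k))%MS.
Proof.
move=> a_iu uf sf s1 pl pl'; rewrite (dl_perm _ pl) (dl_perm _ pl').
by apply: dl_sw; rewrite // sf s1.
Qed.

Local Ltac perm4 := apply/permP => P /=; clear; lia.

(** For each pair of [y]'s in the wedge the two boundary terms differ by a minor of the [2 x 4]
    matrix times [x_b x_c]. This factor lets the minor be reached by successive swaps along the
    edges [cd], [bc], [ab], even when its columns are not adjacent. *)
Lemma path_cycle_boundary : (path_cycle *m kdiff k N 6 <= Dg e 6 (1 : k))%MS.
Proof.
have ac := ltn_trans ab bc; have bd := ltn_trans bc cd; have ad := ltn_trans ac cd.
have lty (i u : 'I_n) : (i < u)%N -> (yv i < yv u)%N by rewrite /= ltn_add2l.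
have uy (i u : 'I_n) : (i < u)%N -> uniq [:: yv i; yv u].
  by move=> h; rewrite /= inE yy_eq -val_eqE neq_ltn h.
rewrite /path_cycle mulmxBl mulmxDl mulmxBl !dl_kdiff ?lty //.
have hcd : (dl [:: yv c; yv d] [:: yv b; xv a; xv b; xv c] -
    dl [:: yv c; yv d] [:: yv a; xv b; xv b; xv c] <= Dg e 6 (1 : k))%MS.
  by apply: (dl_step (l1 := [:: xv b; xv c]) Eab (uy _ _ cd) erefl erefl); perm4.
have hbd : (dl [:: yv b; yv d] [:: yv c; xv a; xv b; xv c] -
    dl [:: yv b; yv d] [:: yv a; xv b; xv c; xv c] <= Dg e 6 (1 : k))%MS.
  apply: (@dl_trans _ _ [:: xv c; yv b; xv a; xv c]).
    by apply: (dl_step (l1 := [:: xv a; xv c]) Ebc (uy _ _ bd) erefl erefl); perm4.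
  by apply: (dl_step (l1 := [:: xv c; xv c]) Eab (uy _ _ bd) erefl erefl); perm4.
have hbc : (dl [:: yv b; yv c] [:: yv d; xv a; xv b; xv c] -
    dl [:: yv b; yv c] [:: yv a; xv b; xv c; xv d] <= Dg e 6 (1 : k))%MS.
  apply: (@dl_trans _ _ [:: xv d; yv c; xv a; xv b]).
    by apply: (dl_step (l1 := [:: xv a; xv b]) Ecd (uy _ _ bc) erefl erefl); perm4.
  apply: (@dl_trans _ _ [:: xv c; yv b; xv a; xv d]).
    by apply: (dl_step (l1 := [:: xv a; xv d]) Ebc (uy _ _ bc) erefl erefl); perm4.
  by apply: (dl_step (l1 := [:: xv c; xv d]) Eab (uy _ _ bc) erefl erefl); perm4.
have had : (dl [:: yv a; yv d] [:: yv c; xv b; xv b; xv c] -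
    dl [:: yv a; yv d] [:: yv b; xv b; xv c; xv c] <= Dg e 6 (1 : k))%MS.
  by apply: (dl_step (l1 := [:: xv b; xv c]) Ebc (uy _ _ ad) erefl erefl); perm4.
have hac : (dl [:: yv a; yv c] [:: yv d; xv b; xv b; xv c] -
    dl [:: yv a; yv c] [:: yv b; xv b; xv c; xv d] <= Dg e 6 (1 : k))%MS.
  apply: (@dl_trans _ _ [:: xv d; yv c; xv b; xv b]).
    by apply: (dl_step (l1 := [:: xv b; xv b]) Ecd (uy _ _ ac) erefl erefl); perm4.
  by apply: (dl_step (l1 := [:: xv b; xv d]) Ebc (uy _ _ ac) erefl erefl); perm4.
have hab : (dl [:: yv a; yv b] [:: yv d; xv b; xv c; xv c] -
    dl [:: yv a; yv b] [:: yv c; xv b; xv c; xv d] <= Dg e 6 (1 : k))%MS.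
  by apply: (dl_step (l1 := [:: xv b; xv c]) Ecd (uy _ _ ab) erefl erefl); perm4.
have hopp := addmx_sub hbd hac; rewrite -eqmx_opp in hopp.
have := addmx_sub (addmx_sub (addmx_sub hcd hbc) (addmx_sub had hab)) hopp.
congr (_ <= _)%MS; move: (dl _ _) (dl _ _) (dl _ _) (dl _ _) (dl _ _) (dl _ _) (dl _ _) (dl _ _)
  (dl _ _) (dl _ _) (dl _ _) (dl _ _); clear => *.
by apply/rowP => o; rewrite !mxE; ring.
Qed.

Hypothesis adj_itv : forall i u i' u' : 'I_n, adj e i u -> (i <= i')%N -> (i' < u')%N ->
  (u' <= u)%N -> adj e i' u'.
Hypotheses (Nac : ~~ adj e a c) (Nbd : ~~ adj e b d).

Let phi_row : 'rV[k]_(#|{: KB N 6}|) := \row_x phi k a b c d x.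

(** Three of the four cells have [y_a] in the wedge, hence lie outside [deg0] and [deg1]; the
    remaining one has value 1. *)
Lemma path_cycle_phi : path_cycle *m phi_row^T != 0.
Proof.
have ac := ltn_trans ab bc; have bd := ltn_trans bc cd; have ad := ltn_trans ac cd.
have ne (i u : 'I_n) : (i < u)%N -> (i == u = false) * (u == i = false).
  by move=> h; split; apply/negbTE; rewrite -val_eqE neq_ltn h ?orbT.
have nes := (ne _ _ ab, ne _ _ bc, ne _ _ cd, ne _ _ ac, ne _ _ bd, ne _ _ ad).
have dlphi f l : dl f l *m phi_row^T = (phi k a b c d (cell f l))%:M.
  by apply/rowP => o; rewrite -rowE !mxE ord1 mulr1n.
have uf (i u v : 'I_n) : (i < u)%N -> (u < v)%N -> uniq [:: yv i; yv u; yv v].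
  by move=> h1 h2; rewrite /= !inE !yy_eq !ne // (ltn_trans h1 h2).
have zero (u v : 'I_n) l : (a < u)%N -> (u < v)%N -> size l = 3 -> phi k a b c d (cell [:: yv a; yv u; yv v] l) = 0.
  move=> au uv sl; have h6 : (size [:: yv a; yv u; yv v] + size l = 6)%N by rewrite sl.
  have [hS hE] := cellE (uf _ _ _ au uv) h6.
  have Ba : (0 < cBf (cell [:: yv a; yv u; yv v] l) (yv a))%N.
    by rewrite ffunE /cB hS !inE eqxx addn1.
  rewrite /phi; case: eqP => [h|_]; first by move: Ba; rewrite h ffunE !xyE !nes.
  by case: eqP => [h|_] //; move: Ba; rewrite h ffunE !xyE !nes.
rewrite /path_cycle mulmxBl mulmxDl mulmxBl !dlphi (zero c d [:: xv b; xv b; xv c] ac cd erefl)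
  (zero b d [:: xv b; xv c; xv c] ab bd erefl) (zero b c [:: xv b; xv c; xv d] ab bc erefl).
have h6 : (size [:: yv b; yv c; yv d] + size [:: xv a; xv b; xv c] = 6)%N by [].
have [hS hE] := cellE (uf _ _ _ bc cd) h6.
have B0 : cBf (cell [:: yv b; yv c; yv d] [:: xv a; xv b; xv c]) = deg0 a b c d.
  apply/ffunP => v; rewrite [LHS]ffunE /cB hS hE [mon _ _]ffunE [deg0 _ _ _ _ _]ffunE /=.
  rewrite !inE ![_ == v]eq_sym addn0 !addnA -!addnA; do 3 congr (_ + _)%N.
  have [->|_] := eqVneq v (yv b); first by rewrite !yy_eq !nes.
  by have [->|_] := eqVneq v (yv c); first by rewrite !yy_eq !nes.
rewrite /phi B0 eqxx /phi0 hS !inE !xyE !nes !eqxx ?orbT /= expr0 mulr1.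
apply/eqP => /rowP/(_ 0); rewrite !mxE eqxx !mulr1n !subr0 addr0 => /eqP.
by rewrite oner_eq0.
Qed.

Lemma koszul_hom_path : koszul_hom (JG k e) 3 6 != 0%N.
Proof.
have ac := ltn_trans ab bc; have bd := ltn_trans bc cd; have ad := ltn_trans ac cd.
have /eqmxP JE := ksub_JG k e 6.
apply: (@homdim_neq0 k _ (fun x : I => #|cS x|) (kdiff k N 6) (ksub (JG k e) 6)
  (@kdiff_deg k N 6) (@kdiff_sq k N 6) _ 3 path_cycle phi_row).
- by rewrite JE (eqmxMr _ JE) Dg_kdiff.
- rewrite sub_capmx sub_coker JE path_cycle_boundary andbT.
  have lty (i u : 'I_n) : (i < u)%N -> (i == u = false).
    by move=> h; apply/negbTE; rewrite -val_eqE neq_ltn h.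
  have h3 (i u v : 'I_n) l : (i < u)%N -> (u < v)%N -> size l = 3 ->
      (dl [:: yv i; yv u; yv v] l <= hmask k (fun x : I => #|cS x|) 3)%MS.
    move=> iu uv sl.
    have uf : uniq [:: yv i; yv u; yv v] by rewrite /= !inE !yy_eq !lty // (ltn_trans iu uv).
    have h6 : (size [:: yv i; yv u; yv v] + size l = 6)%N by rewrite sl.
    by apply: delta_mask; rewrite (cellE uf h6) cardsE (card_uniqP uf).
  by rewrite addmx_sub ?eqmx_opp ?addmx_sub ?eqmx_opp ?h3.
- exact: kdiff_phi.
- have /submxP[v ->] : (ksub (JG k e) 6 <= Dg e 6 (1 : k))%MS by rewrite JE.
  by rewrite -mulmxA Dg_ker ?mulmx0 // => x i u he; rewrite !mxE; exact: (phi_sw k adj_itv ab bc cd Nac Nbd he).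
exact: path_cycle_phi.
Qed.

End Cycle.

(** * Regularity and Betti numbers *)

Section Betti.
Variables (k : fieldType) (n : nat) (e : rel 'I_n) (s R : nat).
Local Notation N := (n + n)%N.
Hypothesis adjE : forall i u, adj e i u = cadj s R i u.
Hypotheses (s_le : (s <= R)%N) (R_lt : (R < n)%N).

Lemma sqfree_card j (c : 'I_#|{: KB N j}|) : sqfree c -> #|cW c| = j.
Proof.
have cardE' (F : {set 'I_N}) : #|F| = (\sum_v (v \in F))%N by rewrite -sum1_card big_mkcond.
move=> sq; rewrite -[RHS](cell_deg c) addnC !cardE' -big_split /=.
apply: eq_bigr => v _; have := sq v; rewrite inE /cB.
by case: (v \in cS c); case: (cE c v) => [|[]].
Qed.

Lemma crit_cell j (c : 'I_#|{: KB N j}|) : crit e s R c ->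
  [/\ sqfree c, indep s R (cA c), (toggle s R (cW c) (cA c)).2 = None & (#|cS c| + #|cA c| = j)%N].
Proof.
case/andP => sc /eqP tc.
have [[u _ [t1 _ _ _]]|[sq _ _ tog _]] := same_degree s R (fun v => erefl (cB c v)).
  by rewrite t1 in tc.
split=> //; first by rewrite -(std_indep adjE).
  by rewrite -tog //; left.
rewrite (cA_sqfree sq); apply: etrans (sqfree_card sq).
rewrite cardsD (setIidPr (cS_sub c)) subnKC //.
exact: subset_leq_card (cS_sub c).
Qed.

Lemma ncrit_ex i j : ncrit e s R i j != 0%N ->
  exists2 c : 'I_#|{: KB N j}|, crit e s R c & #|cS c| = i.
Proof. by rewrite -lt0n => /card_gt0P[c /andP[h /eqP]]; exists c. Qed.

Lemma ncrit_complete i j : s = 0%N -> ncrit e s R i j != 0%N -> (j <= i.+1)%N.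
Proof.
move=> s0 /ncrit_ex[c hc hi]; have [sq ic tc <-] := crit_cell hc; rewrite hi.
have [[-> _]|[-> _]|[[h _] _]|[p [q [h _ _ _ _]]]] := crit_card s_le R_lt (cA_sub c) ic tc.
- by rewrite cards0; lia.
- by lia.
- by rewrite s0 in h.
by rewrite s0 in h.
Qed.

Hypotheses (s_gt0 : (0 < s)%N) (R_lt1 : (R.+1 < n)%N).

Lemma ncrit_neq0 i j : ncrit e s R i.+1 j != 0%N ->
  (i.+2 = j /\ j < R + n - s)%N \/ (i.+3 = j /\ j <= R + n + 1 - s)%N.
Proof.
case/ncrit_ex => c hc hi; have [sq ic tc] := crit_cell hc; rewrite hi.
have jW := sqfree_card sq.
have [[-> W0]|[-> h]|[[_ ->] h]|[p [q [ps Rq qn -> WE]]]] := crit_card s_le R_lt (cA_sub c) ic tc.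
- by have := subset_leq_card (cS_sub c); rewrite W0 cards0 hi.
- by rewrite addn1 => hj; left; split=> //; rewrite -jW h.
- by rewrite addn2 => hj; right; split=> //; rewrite -jW ltnW.
have pq : p != q by rewrite -val_eqE neq_ltn (leq_trans ps (leq_trans s_le Rq)).
rewrite cards2 xyE pq addn2 => hj; right; split=> //.
by rewrite -jW; have := card_critW s_le R_lt ps (leq_trans s_le Rq); rewrite WE; clear -Rq; lia.
Qed.

Lemma pair_inj (p q p' q' : 'I_n) : (p < s)%N -> (R <= q)%N -> (p' < s)%N -> (R <= q')%N ->
  [set xv p; xv q] = [set xv p'; xv q'] -> p = p' /\ q = q'.
Proof.
move=> ps Rq ps' Rq' /setP h; split.
  have := h (xv p); rewrite !inE !xyE eqxx /= => /esym/orP[/eqP//|/eqP pq'].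
  by move: ps; rewrite pq'; clear -s_le Rq'; lia.
have := h (xv q); rewrite !inE !xyE eqxx orbT => /esym/orP[/eqP qp'|/eqP//].
by move: Rq; rewrite qp'; clear -s_le ps'; lia.
Qed.

(** A cell of squarefree degree is determined by [W] and [A], and in the top degree both are
    determined by the pair [(p, q)]. *)
Lemma ncrit_top j : j = (R + n + 1 - s)%N -> ncrit e s R j.-2 j = (s * (n.-1 - R))%N.
Proof.
move=> jE.
pose S := [set c : 'I_#|{: KB N j}| | crit e s R c && (#|cS c| == j.-2)].
pose T := setX [set i : 'I_n | 0 <= i < s]%N [set i : 'I_n | R <= i < n.-1]%N.
pose f (pq : 'I_n * 'I_n) : {set 'I_N} := [set xv pq.1; xv pq.2].
have j2 : (1 < j)%N by rewrite jE; clear -s_le R_lt1; lia.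
have top c : c \in S -> exists p q : 'I_n, [/\ (p < s)%N, (R <= q < n.-1)%N, cA c = [set xv p; xv q],
    cW c = critW s R p q & sqfree c].
  rewrite inE => /andP[hc /eqP hi]; have [sq ic tc] := crit_cell hc; rewrite hi => hA.
  have cA2 : #|cA c| = 2 by clear -hA j2; lia.
  have [[A0 _]|[A1 _]|[_ h]|[p [q [ps Rq qn AE WE]]]] := crit_card s_le R_lt (cA_sub c) ic tc.
  - by rewrite A0 cards0 in cA2.
  - by rewrite A1 in cA2.
  - by rewrite (sqfree_card sq) jE ltnn in h.
  by exists p, q; split=> //; rewrite Rq /=; clear -qn; lia.
have -> : ncrit e s R j.-2 j = #|S| by apply: eq_card => c; rewrite !inE.
have -> : (s * (n.-1 - R))%N = #|T|.
  by rewrite cardsX (card_itv 0 (ltnW (leq_ltn_trans s_le R_lt))) (card_itv R (leq_pred n)) subn0.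
have injS : {in S &, injective (@cA n j)}.
  move=> c c' /top[p [q [ps /andP[Rq _] AE WE sq]]] /top[p' [q' [ps' /andP[Rq' _] AE' WE' sq']]] hA.
  have [pp qq] : p = p' /\ q = q' by apply: pair_inj => //; rewrite -AE hA.
  have hW : cW c = cW c' by rewrite WE WE' pp qq.
  have hS x : sqfree x -> cS x = cW x :\: cA x.
    move=> sx; rewrite (cA_sqfree sx); apply/setP => v; rewrite !inE negb_and negbK.
    by have := subsetP (cS_sub x) v; rewrite inE; case: (v \in cS x) => [->|_] //; rewrite andNb.
  apply: cell_inj; first by rewrite !hS // hW hA.
  apply/ffunP => v; have := sq v; have := sq' v; move/setP/(_ v): hA; rewrite !inE /cB.
  by case: (cE c v) (cE c' v) => [|[|m]] [|[|m']].
have injT : {in T &, injective f}.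
  move=> [p q] [p' q']; rewrite !inE /= => /andP[ps /andP[Rq _]] /andP[ps' /andP[Rq' _]] h.
  by have [-> ->] := pair_inj ps Rq ps' Rq' h.
rewrite -(card_in_imset injS) -(card_in_imset injT).
suff -> : (@cA n j) @: S = f @: T by [].
apply/setP => A; apply/imsetP/imsetP => [[c /top[p [q [ps Rqn AE _ _]]] ->]|[[p q]]].
  by exists (p, q) => //; rewrite !inE /= ps.
rewrite !inE /= => /andP[ps /andP[Rq qn]] ->; rewrite /f /=.
have qn' : (q.+1 < n)%N by clear -qn; lia.
have [ind tog] := toggle_crit s_le R_lt ps Rq qn'.
have sq : (s <= q)%N := leq_trans s_le Rq.
set W := critW s R p q in tog; set B := [set xv p; xv q] in ind tog *.
have BW : B \subset W.
  by apply/subsetP => v; rewrite in_set2 => /orP[] /eqP ->; rewrite /W critWx leqnn ?sq ?orbT.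
have cardB : #|B| = 2 by rewrite cards2 xyE -val_eqE neq_ltn (leq_trans ps sq).
have cardW : #|W| = j.
  by have := card_critW s_le R_lt ps sq; rewrite -/W jE; clear -Rq; lia.
have [|c /andP[/eqP hS /eqP hE]] := @cell_ex N j (W :\: B) [ffun v => (v \in B : nat)].
  rewrite cardsD (setIidPr BW) cardB; under eq_bigr do rewrite ffunE.
  by rewrite -big_mkcond sum1_card cardB cardW subnK.
have hB v : cB c v = (v \in W).
  rewrite /cB hS hE ffunE in_setD; have := subsetP BW v.
  by case: (v \in B) => /= [/(_ isT) ->|_].
have sqc : sqfree c by move=> v; rewrite hB leq_b1.
have hW : cW c = W by apply/setP => v; rewrite [LHS]inE hB lt0b.
have hA : cA c = B by apply/setP => v; rewrite [LHS]inE hE ffunE lt0b.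
exists c; last by rewrite hA.
rewrite inE /crit (std_indep adjE) hA ind /=.
have [[u uB _]|[_ _ _ tg _]] := same_degree s R (fun v => erefl (cB c v)).
  by have := sqc u; rewrite leqNgt uB.
rewrite tg; last by left.
by rewrite hW hA tog /= hS cardsD (setIidPr BW) cardB cardW subn2.
Qed.

Variables (I : gfam k N) (eps : k).
Hypothesis eps_idem : eps * eps = eps.
Hypothesis I_gen : forall j, (ksub I j == Dg e j eps)%MS.

Lemma betti_neq0 i j : betti I i j <> 0%N ->
  (i.+2 = j /\ j < R + n - s)%N \/ (i.+3 = j /\ j <= R + n + 1 - s)%N.
Proof.
move=> h; apply: ncrit_neq0; apply/eqP => z; apply: h.
by have := koszul_le_crit adjE s_le eps_idem I_gen i.+1 j; rewrite z leqn0 => /eqP.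
Qed.

(** In the neighbouring homological degrees an unmatched cell would have one or three variables
    outside the wedge. The first is excluded by the bound [R + n - s] on its degree, the second
    never occurs. *)
Lemma betti_top p : (p + 3 = R + n + 1 - s)%N -> (0 < p)%N ->
  betti I p (p + 3) = (s * (n.-1 - R))%N.
Proof.
move=> pE p0; rewrite /betti (koszul_eq_crit adjE s_le eps_idem I_gen).
- by have := ncrit_top pE; rewrite !addn3.
- case: p p0 pE => // p _ pE; apply/eqP; apply: contraT => /ncrit_neq0; clear; lia.
apply/eqP; apply: contraT => /ncrit_neq0; clear -pE; lia.
Qed.

Lemma betti_pd p : (p + 3 = R + n + 1 - s)%N -> (0 < p)%N ->
  is_pd I p /\ (forall j, j <> (p + 3)%N -> betti I p j = 0%N).
Proof.
move=> pE p0; split.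
  split; first by exists (p + 3)%N; rewrite betti_top // => /eqP; rewrite muln_eq0; clear -s_gt0 R_lt1; lia.
  move=> i j pi; apply/eqP; apply: contraT => /eqP /betti_neq0; clear -pi pE; lia.
move=> j nj; apply/eqP; apply: contraT => /eqP /betti_neq0; clear -nj pE; lia.
Qed.

End Betti.

(** * Regularity 3 forces two cliques *)

Section Regularity.
Variables (k : fieldType) (n : nat) (e : rel 'I_n).
Hypotheses (e_sym : symmetric e) (e_irr : irreflexive e).
Hypotheses (Gconn : connected_graph e) (Gclosed : closed_graph e).
Local Notation N := (n + n)%N.

Lemma s_index_lt : (0 < n)%N -> (s_index e < n)%N.
Proof.
move=> n0; have n1 : (n.-1 < n)%N by rewrite prednK.
have sn : (s_index e <= n)%N by rewrite -[leqRHS](size_enum_ord n) find_size.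
rewrite ltn_neqAle sn andbT; apply/eqP => s_n.
have := @mu_before n e (Ordinal n1); rewrite s_n => /(_ n1).
by have := mu_deg e (Ordinal n1) => /=; lia.
Qed.

(** The path is [a], [b], the last neighbour [c] of [b], and [d = c + 1]. Since [mu] drops at [b],
    the neighbours of [a] end before [c]; since [mu] is positive at [b], the vertex [d] exists. *)
Lemma mu_step_path (a b : 'I_n) : val b = a.+1 -> (b < s_index e)%N ->
  mu_seq e a != mu_seq e b -> koszul_hom (JG k e) 3 6 != 0%N.
Proof.
move=> ba bs ne; have ab : (a < b)%N by rewrite -ba.
have le := mu_mono e_sym e_irr Gconn Gclosed (ltnW ab).
have mb := mu_before bs; have dega := mu_deg e a; have degb := mu_deg e b.
have sn := s_index_lt (leq_ltn_trans (leq0n a) (ltn_ord a)).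
have lt : (mu_seq e b < mu_seq e a)%N by rewrite ltn_neqAle eq_sym ne.
have consec := consecutive e_sym e_irr Gconn Gclosed.
have degE := deg_itv e_sym e_irr Gconn Gclosed.
have hb : (b.+1 < n)%N by rewrite (leq_ltn_trans bs).
have rb : (b < b + deg_gt e b)%N.
  by have := degE b (Ordinal hb) (ltnSn _); rewrite consec //= => <-.
have hc : (b + deg_gt e b < n)%N by exact: deg_lt.
have hd : ((b + deg_gt e b).+1 < n)%N by clear -mb degb; lia.
pose c := Ordinal hc; pose d := Ordinal hd.
have bc : (b < c)%N by [].
have cd : (c < d)%N by exact: ltnSn.
have ac := ltn_trans ab bc; have bd := ltn_trans bc cd.
(* Any cell of degree 6 serves as the default of [toc]; here it is the sixth power of [x_a]. *)
pose E0 : {ffun 'I_N -> nat} := [ffun v => 6 * (v == xv a)]%N.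
have [|x0 _] := @cell_ex N 6 set0 E0.
  rewrite cards0 add0n; under eq_bigr do rewrite ffunE.
  by rewrite -big_distrr /= sum_unit.
apply: (koszul_hom_path k x0 ab bc cd).
- by rewrite /adj /= ab consec.
- by rewrite /adj /= bc degE //= leqnn.
- by rewrite /adj /= ltnSn consec.
- exact: (edge_itv e_sym e_irr Gconn Gclosed).
- rewrite /adj /= negb_and degE // -ltnNge; apply/orP; left.
  by clear -lt dega degb; rewrite /=; lia.
by rewrite /adj /= negb_and degE //= -ltnNge ltnSn.
Qed.

(** For [s = 0] the graph is complete, and an unmatched cell has at most one variable outside its
    wedge, whereas [beta_{i,i+3}] would need two. *)
Lemma reg3_s_gt0 : is_reg (JG k e) 3 -> (0 < s_index e)%N.
Proof.
case=> [[i hi]] _; rewrite lt0n; apply/eqP => s0; apply: hi; apply/eqP; rewrite -leqn0.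
(* For [n = 0] no [R < n] exists; there are then no variables, so no cell has the required
   degree. *)
have [n0|n0] := posnP n.
  have itv : forall i u i' u' : 'I_n, adj e i u -> (i <= i')%N -> (i' < u')%N -> (u' <= u)%N -> adj e i' u'.
    by case=> x hx; exfalso; move: hx; rewrite n0.
  have adjE i0 u : adj e i0 u = cadj 0 0 i0 u by case: i0 => x hx; exfalso; move: hx; rewrite n0.
  apply: leq_trans (koszul_le_crit adjE (leqnn 0) (mulr1 (1 : k)) (fun j => ksub_JG k e j) _ _) _.
  rewrite leqNgt; apply/negP => /card_gt0P[c /andP[/(crit_cell adjE)[_ _ _ hj] /eqP hc]].
  have h : (#|cA c| <= n + n)%N by rewrite -[leqRHS]card_ord max_card.
  by move: hj; rewrite hc; clear -h n0; lia.
have hR : (n.-1 < n)%N by rewrite prednK.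
have adjE : forall i u, adj e i u = cadj (s_index e) n.-1 i u.
  by apply: adj_cadj => // [|v]; rewrite s0.
have sR : (s_index e <= n.-1)%N by rewrite s0.
apply: leq_trans (koszul_le_crit adjE sR (mulr1 (1 : k)) (fun j => ksub_JG k e j) _ _) _.
rewrite leqn0; apply: contraT => /(ncrit_complete adjE sR hR s0); clear; lia.
Qed.

Lemma reg3_mu_const : is_reg (JG k e) 3 -> forall u v : 'I_n, (u <= v)%N -> (v < s_index e)%N ->
  mu_seq e v = mu_seq e u.
Proof.
case=> _ hreg u v uv vs.
have step (a b : 'I_n) : val b = a.+1 -> (b < s_index e)%N -> mu_seq e b = mu_seq e a.
  move=> ba bs; apply/eqP; rewrite eq_sym; apply: contraT => ne.
  by have := hreg 2 6 (elimN eqP (mu_step_path ba bs ne)).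
case: v uv vs => m hm /= uv; rewrite -(subnKC uv) in hm *.
elim: (m - u)%N hm => [|l IH] hm vs.
  by rewrite (_ : Ordinal hm = u) //; apply: val_inj; rewrite /= addn0.
have hm' : (u + l < n)%N by apply: leq_ltn_trans hm; rewrite addnS.
rewrite -(IH hm'); first by apply: step => //=; rewrite addnS.
by apply: leq_ltn_trans vs; rewrite addnS.
Qed.

(** [n.-1 - mu] is the common last neighbour of the vertices before [s]; it is at least [s] because
    [s - 1] and [s] are adjacent. *)
Lemma two_cliques mu : (0 < s_index e)%N -> (1 <= mu)%N ->
  (forall v : 'I_n, (v < s_index e)%N -> mu_seq e v = mu) ->
  [/\ forall i u, adj e i u = cadj (s_index e) (n.-1 - mu) i u, (s_index e <= n.-1 - mu)%N,
      (n.-1 - mu < n)%N, ((n.-1 - mu).+1 < n)%N & (n.-1 - (n.-1 - mu) = mu)%N].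
Proof.
move=> s0 mu1 hmu.
have n0 : (0 < n)%N.
  by rewrite (leq_trans s0) // -[leqRHS](size_enum_ord n) find_size.
have sn := s_index_lt n0.
have hs : ((s_index e).-1 < n)%N by clear -sn; lia.
pose v := Ordinal hs.
have vs : (v < s_index e)%N by rewrite /= prednK.
have degv := mu_deg e v; rewrite (hmu v vs) in degv.
have := deg_itv e_sym e_irr Gconn Gclosed (_ : v < Ordinal sn)%N.
rewrite (consecutive e_sym e_irr Gconn Gclosed) /= ?prednK // => /(_ (leqnn _))/esym hdeg.
split.
- apply: adj_cadj => // [|u us]; first exact: ltnW.
  by have := mu_deg e u; rewrite hmu //; clear; lia.
all: move: degv hdeg; clear -s0 mu1 n0 sn; rewrite /=; lia.
Qed.

End Regularity.

Theorem theorem4p5 (k : fieldType) (n : nat) (e : rel 'I_n)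
  (e_sym : symmetric e) (e_irr : irreflexive e)
  (Gconn : connected_graph e) (Gncut : no_cut_vertex e) (Gclosed : closed_graph e) :
  (is_reg (JG k e) 3 <->
     (0 < s_index e)%N /\
     exists mu : nat, (1 <= mu)%N /\ forall v : 'I_n, (v < s_index e)%N -> mu_seq e v = mu)
  /\
  (forall mu : nat, (0 < s_index e)%N -> (1 <= mu)%N ->
     (forall v : 'I_n, (v < s_index e)%N -> mu_seq e v = mu) ->
     exists p : nat,
       (p + mu + s_index e + 3 = 2 * n)%N /\
       is_pd (JG k e) p /\ is_pd (initial (JG k e)) p /\
       betti (JG k e) p (p + 3) = (s_index e * mu)%N /\
       betti (initial (JG k e)) p (p + 3) = (s_index e * mu)%N /\
       (forall j, j <> (p + 3)%N ->
          betti (JG k e) p j = 0%N /\ betti (initial (JG k e)) p j = 0%N)).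
Proof.
have itv := edge_itv e_sym e_irr Gconn Gclosed.
split.
  split=> [hreg|[s0 [mu [mu1 hmu]]]].
    have s0 := reg3_s_gt0 e_sym e_irr Gconn Gclosed hreg; split=> //.
    have n0 : (0 < n)%N by rewrite (leq_trans s0) // -[leqRHS](size_enum_ord n) find_size.
    exists (mu_seq e (Ordinal n0)); split; first exact: mu_before.
    by move=> v; apply: (reg3_mu_const e_sym e_irr Gconn Gclosed hreg).
  have [adjE sR R_lt R_lt1 muE] := two_cliques e_sym e_irr Gconn Gclosed s0 mu1 hmu.
  set R := (n.-1 - mu)%N in adjE sR R_lt R_lt1 muE.
  split; last first.
    move=> i j /(betti_neq0 adjE sR R_lt s0 R_lt1 (mulr1 1) (ksub_JG k e)); clear; lia.
  have pE : (R + n - s_index e - 2 + 3 = R + n + 1 - s_index e)%N by clear -s0 sR R_lt1; lia.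
  have p0 : (0 < R + n - s_index e - 2)%N by clear -s0 sR R_lt1; lia.
  exists (R + n - s_index e - 2)%N.
  rewrite (betti_top adjE sR R_lt s0 R_lt1 (mulr1 1) (ksub_JG k e) pE p0) muE.
  by move/eqP; rewrite muln_eq0 !gtn_eqF.
move=> mu s0 mu1 hmu.
have [adjE sR R_lt R_lt1 muE] := two_cliques e_sym e_irr Gconn Gclosed s0 mu1 hmu.
have muR : (n.-1 - mu + mu = n.-1)%N by move: R_lt1 muE; clear -mu1; lia.
set R := (n.-1 - mu)%N in adjE sR R_lt R_lt1 muE muR.
have pE : (R + n - s_index e - 2 + 3 = R + n + 1 - s_index e)%N by clear -s0 sR R_lt1; lia.
have p0 : (0 < R + n - s_index e - 2)%N by clear -s0 sR R_lt1; lia.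
have J := ksub_JG k e; have inJ := ksub_initial k itv.
have e1 : 1 * 1 = 1 :> k := mulr1 1; have e0 : 0 * 0 = 0 :> k := mulr0 0.
have [pd1 z1] := betti_pd adjE sR R_lt s0 R_lt1 e1 J pE p0.
have [pd0 z0] := betti_pd adjE sR R_lt s0 R_lt1 e0 inJ pE p0.
(* The top degree [R + n + 1 - s] minus 3, which equals [2n - mu - s - 3] for [R = n - 1 - mu]. *)
exists (R + n - s_index e - 2)%N; split; first by clear -muR R_lt1 s0 sR; lia.
do 2 (split; first by []).
rewrite (betti_top adjE sR R_lt s0 R_lt1 e1 J pE p0) (betti_top adjE sR R_lt s0 R_lt1 e0 inJ pE p0) muE.
by do 2 (split; first by []); move=> j nj; rewrite z1 ?z0.
Qed.
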